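(* Let $K$ be a compact metric space, let $n \geq 2$, let $\gamma = (\gamma_1, \dots, \gamma_n)$ be a system of proper contractions on $K$ and let $\varphi: K \to K$ be (Borel) measurable. Suppose that $\gamma_1, \dots, \gamma_n$ are inverse branches of $\varphi$. Assume that $K$ is self-similar with respect to $\gamma$ and that $\gamma$ satisfies the measure separation condition in $K$. Then the C$^*$-algebra $\mathcal{MC}_{\gamma_1, \dots, \gamma_n}$ is isomorphic (as a C$^*$-algebra) to the Cuntz algebra $\mathcal{O}_n$.
   Context: Let $(K,d)$ be a compact metric space with Borel $\sigma$-algebra $\mathcal{B}(K)$. A continuous map $\gamma: K \to K$ is a proper contraction if there exist constants $0 < c_1 \leq c_2 < 1$ such that $c_1 d(x,y) \leq d(\gamma(x),\gamma(y)) \leq c_2 d(x,y)$ for all $x, y \in K$. A system of proper contractions is a finite family $\gamma = (\gamma_1, \dots, \gamma_n)$ of proper contractions on $K$. $K$ is self-similar with respect to $\gamma$ if $K = \bigcup_{i=1}^n \gamma_i(K)$. For real numbers $p_1, \dots, p_n > 0$ with $\sum_{i=1}^n p_i = 1$, the self-similar measure on $K$ with $\{p_i\}_{i=1}^n$ is the unique Borel probability measure $\mu$ on $K$ such that $\mu(E) = \sum_{i=1}^n p_i\, \mu(\gamma_i^{-1}(E))$ for all $E \in \mathcal{B}(K)$ (its existence and uniqueness is a theorem of Hutchinson). The Hutchinson measure $\mu^H$ is the self-similar measure with $p_i = \frac{1}{n}$ for all $i$. The system $\gamma$ satisfies the measure separation condition in $K$ if $\mu(\gamma_i(K) \cap \gamma_j(K))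 = 0$ for every self-similar measure $\mu$ (i.e. for every choice of weights $p_1, \dots, p_n > 0$ with $\sum_{i=1}^n p_i = 1$) and all $i \neq j$. The maps $\gamma_1, \dots, \gamma_n$ are inverse branches of $\varphi$ if $\varphi(\gamma_i(x)) = x$ for all $x \in K$ and $i = 1, \dots, n$. On the complex Hilbert space $L^2(K, \mathcal{B}(K), \mu^H)$: for $a \in C(K)$, the multiplication operator is $M_a f = a f$; the composition operator induced by $\gamma_i$ is $C_{\gamma_i} f = f \circ \gamma_i$, which is a well-defined bounded operator when $K$ is self-similar with respect to $\gamma$ and $\gamma$ satisfies the measure separation condition in $K$. $\mathcal{MC}_{\gamma_1, \dots, \gamma_n}$ denotes the C$^*$-algebra of operators on $L^2(K, \mathcal{B}(K), \mu^H)$ generated by all $M_a$, $a \in C(K)$, and $C_{\gamma_1}, \dots, C_{\gamma_n}$. The Cuntz algebra $\mathcal{O}_n$ ($n \geq 2$) is the universal unital C$^*$-algebra generated by isometries $S_1, \dots, S_n$ with $S_i^* S_i = 1$ for all $i$ and $\sum_{j=1}^n S_j S_j^* = 1$. *)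

(* Defs.v *)
From HB Require Import structures.
From mathcomp Require Import all_boot all_order all_algebra ring lra generic_quotient ring_quotient.
From mathcomp Require Import complex.
From mathcomp Require Import all_classical all_reals all_analysis measurable_realfun.

Set Implicit Arguments.
Unset Strict Implicit.
Unset Printing Implicit Defensive.

Import Order.TTheory GRing.Theory Num.Theory numFieldNormedType.Exports.
Import ComplexField.Normc.

Local Open Scope classical_set_scope.
Local Open Scope ring_scope.

(* [algType] excludes the zero algebra.  The norm takes values in [R]; the
   library's normed modules over [R[i]] have an [R[i]]-valued norm and no
   common upper bound with [algType] in its hierarchy. *)
HB.mixin Record isCStar (R : realType) A & GRing.Algebra R[i] A := {
  star : A -> A ;
  cnorm : A -> R ;
  starD : forall a b : A, star (a + b) = star a + star b ;
  starZ : forall (c : R[i]) (a : A), star (c *: a) = conjc c *: star a ;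
  starM : forall a b : A, star (a * b) = star b * star a ;
  starK : forall a : A, star (star a) = a ;
  cnorm0_eq0 : forall a : A, cnorm a = 0 -> a = 0 ;
  ler_cnormD : forall a b : A, cnorm (a + b) <= cnorm a + cnorm b ;
  cnormZ : forall (c : R[i]) (a : A), cnorm (c *: a) = normc c * cnorm a ;
  ler_cnormM : forall a b : A, cnorm (a * b) <= cnorm a * cnorm b ;
  cnorm_star_mul : forall a : A, cnorm (star a * a) = cnorm a ^+ 2 ;
  cnorm_complete : forall u : nat -> A,
    (forall e : R, 0 < e -> exists N : nat, forall m n : nat,
       (N <= m)%N -> (N <= n)%N -> cnorm (u m - u n) <= e) ->
    exists l : A, forall e : R, 0 < e ->
      exists N : nat, forall n : nat, (N <= n)%N -> cnorm (u n - l) <= e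
}.

#[short(type="cstarAlgType")]
HB.structure Definition CStarAlgebra (R : realType) :=
  {A of isCStar R A & GRing.Algebra R[i] A}.

Section CStarSubalgebra.
Context (R : realType) (A : cstarAlgType R).

Definition cstar_subalgebra (B : set A) : Prop :=
  [/\ B 1,
      forall (c : R[i]) (a b : A), B a -> B b -> B (c *: a + b),
      forall a b : A, B a -> B b -> B (a * b),
      forall a : A, B a -> B (star a) &
      forall a : A,
        (forall e : R, 0 < e -> exists2 b : A, B b & cnorm (a - b) <= e) ->
        B a].

Definition cstar_generated (G : set A) : set A := smallest cstar_subalgebra G.

End CStarSubalgebra.

Definition star_morphism (R : realType) (A B : cstarAlgType R)
  (f : {lrmorphism A -> B}) : Prop := forall a : A, f (star a) = star (f a).

Definition cuntz_family (R : realType) (n : nat) (A : cstarAlgType R)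
    (S : 'I_n -> A) : Prop :=
  (forall i, star (S i) * S i = 1) /\ \sum_(j < n) S j * star (S j) = 1.

Definition is_cuntz_algebra (R : realType) (n : nat) (O : cstarAlgType R) :
    Prop :=
  exists S : 'I_n -> O,
    [/\ cuntz_family S,
        cstar_generated (range S) = setT &
        forall (B : cstarAlgType R) (T : 'I_n -> B), cuntz_family T ->
          exists2 f : {lrmorphism O -> B},
            star_morphism f & forall i, f (S i) = T i].

Section Operators.
Context (R : realType) (H : lmodType R[i]) (ip : H -> H -> R[i]).

Definition hnorm (x : H) : R := Num.sqrt (complex.Re (ip x x)).

Definition bounded_operator (T : H -> H) : Prop :=
  linear T /\ exists M : R, forall x, hnorm (T x) <= M * hnorm x.

Definition adjoint_of (T T' : H -> H) : Prop :=
  forall x y, ip (T x) y = ip x (T' y).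

(* In the last clause, the bound on [T x - S x] says that [T] is within [e]
   of [S] in operator norm. *)
Definition operator_cstar_algebra (A : set (H -> H)) : Prop :=
  [/\ A `<=` bounded_operator,
      A (fun=> 0) /\ (forall (c : R[i]) (S T : H -> H), A S -> A T ->
        A (fun x => c *: S x + T x)),
      forall S T : H -> H, A S -> A T -> A (S \o T),
      forall T T' : H -> H, A T -> adjoint_of T T' -> A T' &
      forall T : H -> H, bounded_operator T ->
        (forall e : R, 0 < e -> exists2 S, A S &
           forall x, hnorm (T x - S x) <= e * hnorm x) ->
        A T].

Definition operator_cstar_generated (G : set (H -> H)) : set (H -> H) :=
  smallest operator_cstar_algebra G.

(* [rho] is a bijective *-homomorphism from [O] onto [A]. *)
Definition cstar_isomorphic (O : cstarAlgType R) (A : set (H -> H)) : Prop :=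
  exists rho : O -> H -> H,
    [/\ injective rho /\ range rho = A,
        forall (c : R[i]) (a b : O),
          rho (c *: a + b) = (fun x => c *: rho a x + rho b x),
        forall a b : O, rho (a * b) = rho a \o rho b,
        rho 1 = id &
        forall a : O, adjoint_of (rho a) (rho (star a))].

End Operators.

Section L2.
Context d (T : measurableType d) (R : realType).
Variable mu : {measure set T -> \bar R}.

Definition square_integrable (f : T -> R[i]^o) : Prop :=
  [/\ measurable_fun setT (fun x => complex.Re (f x)),
      measurable_fun setT (fun x => complex.Im (f x)) &
      (\int[mu]_x ((normc (f x)) ^+ 2)%:E < +oo)%E].

Definition sqint : {pred T -> R[i]^o} := mem [set f | square_integrable f].

Let sqr_normc (z : R[i]) : normc z ^+ 2 = complex.Re z ^+ 2 + complex.Im z ^+ 2.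
Proof. by case: z => a b /=; rewrite sqr_sqrtr// addr_ge0// sqr_ge0. Qed.

Let Re_lin (c z w : R[i]) : complex.Re (c * z + w) =
  complex.Re c * complex.Re z - complex.Im c * complex.Im z + complex.Re w.
Proof. by case: c z w => ? ? [? ?] [? ?]. Qed.

Let Im_lin (c z w : R[i]) : complex.Im (c * z + w) =
  complex.Re c * complex.Im z + complex.Im c * complex.Re z + complex.Im w.
Proof. by case: c z w => ? ? [? ?] [? ?]. Qed.

Let measurable_sqr_normc (f : T -> R[i]^o) :
  measurable_fun setT (fun x => complex.Re (f x)) ->
  measurable_fun setT (fun x => complex.Im (f x)) ->
  measurable_fun setT (fun x => normc (f x) ^+ 2 : R).
Proof.
move=> mr mi; under eq_fun do rewrite sqr_normc.
by apply: measurable_funD; apply: measurable_funX.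
Qed.

Let sqr_normcD (c z w : R[i]) :
  normc (c * z + w) ^+ 2 <= 2 * normc c ^+ 2 * normc z ^+ 2 + 2 * normc w ^+ 2.
Proof.
rewrite -mulrA -exprMn -normcM; move: (c * z) => {c}z.
rewrite !sqr_normc -mulrDr; case: z w => [a b] [a' b'] /=.
rewrite -subr_ge0 (_ : _ - _ = (a - a') ^+ 2 + (b - b') ^+ 2); last by ring.
by rewrite addr_ge0 ?sqr_ge0.
Qed.

Lemma sqint_submod_closed : submod_closed sqint.
Proof.
split.
  rewrite inE; split; [exact: measurable_cst|exact: measurable_cst|].
  under eq_integral do rewrite (_ : (0 : T -> R[i]^o) _ = 0)// normc0 expr0n.
  by rewrite integral0.
move=> c f g; rewrite !inE => -[fr fi ff] [gr gi gf].
have hr : measurable_fun setT (fun x => complex.Re ((c *: f + g) x)).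
  rewrite (_ : (fun x => _) = (fun x => complex.Re c * complex.Re (f x)
      - complex.Im c * complex.Im (f x) + complex.Re (g x))); last first.
    by apply/funext => x; rewrite -Re_lin.
  by apply: measurable_funD => //; apply: measurable_funB;
    (apply: measurable_funM; [exact: measurable_cst|]).
have hi : measurable_fun setT (fun x => complex.Im ((c *: f + g) x)).
  rewrite (_ : (fun x => _) = (fun x => complex.Re c * complex.Im (f x)
      + complex.Im c * complex.Re (f x) + complex.Im (g x))); last first.
    by apply/funext => x; rewrite -Im_lin.
  by apply: measurable_funD => //; apply: measurable_funD;
    (apply: measurable_funM; [exact: measurable_cst|]).
split=> //; pose h x : \bar R := ((2 * normc c ^+ 2)%:E * (normc (f x) ^+ 2)%:E
                 + 2%:E * (normc (g x) ^+ 2)%:E)%E.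
have mf : measurable_fun setT (fun x => (normc (f x) ^+ 2 : R)%:E).
  by apply/measurable_EFinP; exact: measurable_sqr_normc.
have mg : measurable_fun setT (fun x => (normc (g x) ^+ 2 : R)%:E).
  by apply/measurable_EFinP; exact: measurable_sqr_normc.
apply: (@le_lt_trans _ _ (\int[mu]_x h x)%E).
  apply: ge0_le_integral => //=.
  - by move=> x _; rewrite lee_fin sqr_ge0.
  - by apply/measurable_EFinP; exact: measurable_sqr_normc.
  - by apply: emeasurable_funD; apply: measurable_funeM.
  - by move=> x _; rewrite /h -!EFinM -EFinD lee_fin; exact: sqr_normcD.
have c0 : (0 <= 2 * normc c ^+ 2 :> R) by rewrite mulr_ge0// sqr_ge0.
rewrite /h ge0_integralD//=; last 4 first.
- by move=> x _; rewrite mule_ge0// lee_fin ?sqr_ge0.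
- exact: measurable_funeM.
- by move=> x _; rewrite mule_ge0// lee_fin ?sqr_ge0.
- exact: measurable_funeM.
rewrite !ge0_integralZl//=; last 2 first.
- by move=> x _; rewrite lee_fin sqr_ge0.
- by move=> x _; rewrite lee_fin sqr_ge0.
by rewrite lte_add_pinfty// lte_mul_pinfty// ?lee_fin.
Qed.

HB.instance Definition _ :=
  GRing.isSubmodClosed.Build _ _ sqint sqint_submod_closed.

Definition sqint_fun := {f : T -> R[i]^o | f \in sqint}.
HB.instance Definition _ := SubType.on sqint_fun.
HB.instance Definition _ := Choice.on sqint_fun.
HB.instance Definition _ := [SubChoice_isSubLmodule of sqint_fun by <:].

Definition ae_null : {pred sqint_fun} :=
  mem [set f : sqint_fun | {ae mu, forall x, val f x = 0}].

Lemma ae_null_submod_closed : submod_closed ae_null.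
Proof.
split; first by rewrite inE; exact: nearW.
move=> c f g; rewrite !inE /= => f0 g0.
apply: filterS2 f0 g0 => x f0 g0.
by rewrite fctE /= [X in X + _](_ : _ = c *: sval f x)// f0 g0 scaler0 addr0.
Qed.

HB.instance Definition _ :=
  GRing.isSubmodClosed.Build _ _ ae_null ae_null_submod_closed.

Definition L2 : Type := Quotient.quot ae_null.
HB.instance Definition _ := GRing.Zmodule.on L2.
HB.instance Definition _ := EqQuotient.on L2.

Local Open Scope quotient_scope.

Definition L2_scale (c : R[i]) (x : L2) : L2 := \pi_L2 (c *: repr x).

Lemma eq_pi_L2 (f g : sqint_fun) : (\pi_L2 f = \pi_L2 g) <-> (f - g \in ae_null).
Proof. by rewrite Quotient.idealrBE; split => [->|/eqP]. Qed.

Lemma pi_L2D (f g : sqint_fun) : \pi_L2 (f + g) = \pi_L2 f + \pi_L2 g.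
Proof. exact: pi_addr. Qed.

Lemma pi_L2Z (c : R[i]) (f : sqint_fun) : \pi_L2 (c *: f) = L2_scale c (\pi_L2 f).
Proof.
apply/eq_pi_L2; rewrite -scalerBr; apply: rpredZ.
by apply/eq_pi_L2; rewrite reprK.
Qed.

Let L2_scaleA a b x : L2_scale a (L2_scale b x) = L2_scale (a * b) x.
Proof. by elim/quotW: x => f; rewrite -(pi_L2Z b) -!pi_L2Z scalerA. Qed.

Let L2_scale1 : left_id 1 L2_scale.
Proof. by elim/quotW => f; rewrite -pi_L2Z scale1r. Qed.

Let L2_scaleDr : right_distributive L2_scale +%R.
Proof.
move=> a; elim/quotW => f; elim/quotW => g.
by rewrite -pi_L2D -!pi_L2Z -pi_L2D scalerDr.
Qed.

Let L2_scaleDl x : {morph L2_scale^~ x : a b / a + b}.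
Proof.
by move=> a b; elim/quotW: x => f; rewrite -!pi_L2Z -pi_L2D scalerDl.
Qed.

HB.instance Definition _ := GRing.Zmodule_isLmodule.Build R[i] L2
  L2_scaleA L2_scale1 L2_scaleDr L2_scaleDl.

(* Total: [0] if [f] is not measurable or not square integrable. *)
Definition L2_class (f : T -> R[i]) : L2 :=
  if insub f is Some u then \pi_L2 (u : sqint_fun) else 0.

Definition L2_repr (x : L2) : T -> R[i] := val (repr x).

Lemma L2_reprK (x : L2) : L2_class (L2_repr x) = x.
Proof. by rewrite /L2_class /L2_repr valK reprK. Qed.

(* Linear in the first argument. *)
Definition L2_ip (x y : L2) : R[i] :=
  let h t := L2_repr x t * conjc (L2_repr y t) in
  Complex (\int[mu]_t complex.Re (h t)) (\int[mu]_t complex.Im (h t)).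

End L2.
Arguments L2_ip {d T R} mu x y.

(* Measurable types are pointed; a space carrying a probability measure is
   nonempty. *)
#[short(type="pmetricType")]
HB.structure Definition PointedMetric (R : numDomainType) :=
  {K of Metric R K & isPointed K}.

Section SelfSimilar.
Context (R : realType) (K : pmetricType R).

Definition borel : Type := g_sigma_algebraType (@open K).
HB.instance Definition _ := Measurable.on borel.

Definition proper_contraction (g : K -> K) : Prop :=
  continuous g /\
  exists c1 c2 : R, [/\ 0 < c1, c1 <= c2, c2 < 1 &
    forall x y : K, c1 * mdist x y <= mdist (g x) (g y) <= c2 * mdist x y].

Context (n : nat) (gamma : 'I_n -> K -> K).

Definition self_similar : Prop :=
  [set: K] = \bigcup_(i in [set: 'I_n]) range (gamma i).

Definition probability_weights (p : 'I_n -> R) : Prop :=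
  (forall i, 0 < p i) /\ \sum_(i < n) p i = 1.

Definition self_similar_measure (p : 'I_n -> R) (mu : probability borel R) :
    Prop :=
  forall E : set borel, measurable E ->
    (mu E = \sum_(i < n) (p i)%:E * mu (gamma i @^-1` E))%E.

Definition hutchinson_measure (mu : probability borel R) : Prop :=
  self_similar_measure (fun=> n%:R^-1) mu.

Definition measure_separation : Prop :=
  forall (p : 'I_n -> R) (mu : probability borel R),
    probability_weights p -> self_similar_measure p mu ->
    forall i j : 'I_n, i != j -> mu (range (gamma i) `&` range (gamma j)) = 0%E.

Definition inverse_branches (phi : K -> K) : Prop :=
  forall (i : 'I_n) (x : K), phi (gamma i x) = x.

Variable mu : probability borel R.

(* The two operators below are defined on representatives; the result depends
   only on the class when [g] pulls null sets back to null sets. *)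
Definition mult_op (a : K -> R[i]) (f : L2 mu) : L2 mu :=
  L2_class mu (fun x => a x * L2_repr f x).

Definition comp_op (g : K -> K) (f : L2 mu) : L2 mu :=
  L2_class mu (fun x => L2_repr f (g x)).

Definition MC : set (L2 mu -> L2 mu) :=
  operator_cstar_generated (L2_ip mu)
    ([set mult_op a | a in [set a : K -> R[i]^o | continuous a]] `|`
     [set comp_op (gamma i) | i in [set: 'I_n]]).

End SelfSimilar.
Arguments mult_op {R K} mu a f.
Arguments comp_op {R K} mu g f.
Arguments MC {R K n} gamma mu.

(* Main.v *)
Require Import Defs.
From HB Require Import structures.
From mathcomp Require Import all_boot all_order all_algebra ring lra zify.
From mathcomp Require Import generic_quotient complex.
From mathcomp Require Import all_classical all_reals all_analysis.
From mathcomp Require Import measurable_realfun.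
Set Implicit Arguments.
Unset Strict Implicit.
Unset Printing Implicit Defensive.
Import Order.TTheory GRing.Theory Num.Theory numFieldNormedType.Exports.
Import ComplexField.Normc.
Local Open Scope classical_set_scope.
Local Open Scope ring_scope.

(* The operators [V_i f = sqrt n . 1_(gamma_i K) . (f o phi)] are isometries of
   L2(mu), with adjoint [f |-> (f o gamma_i) / sqrt n]; self-similarity of [mu] and
   the separation condition make them a Cuntz family.  A multiplication operator
   satisfies [M_a = sum_i V_i M_(a o gamma_i) V_i^*]; iterating, the symbols
   become nearly constant, so [M_a] is a norm limit of combinations of the
   [V_u V_u^*], and the [V_i] generate the whole algebra.

   It remains to see that a C*-algebra generated by a Cuntz family (n >= 2) is
   universal, i.e. that |x(T)| <= |x(S)| for two Cuntz families S, T and every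
   combination x of the words [S_u S_v^*].  By the C*-identity
   |x|^(2m) = |(x^* x)^m| (m a power of 2), it is enough to prove this up to a
   constant growing polynomially in the degree of x.  For x in the span of the
   words with |u| = |v| = k the coefficients are recovered as S_u^* x S_v, so
   the two norms are equivalent, hence equal.  In general x is a sum of at most
   2d + 1 gauge-homogeneous components; the degree 0 component is extracted by
   a compression [x |-> Q^* x Q] with an isometry Q, and the other ones are
   shifted to degree 0. *)

(** * C*-algebras *)

(** The abstract side argues from the norm axioms directly. The relations of a Cuntz family do not
    state that the ranges of the isometries are orthogonal. Classically this is a positivity
    argument; here estimates of [|1 + z|] and [|1 - z|] play the part of positivity.

    No model of the Cuntz algebra is constructed: the operator algebra itself is shown to have the
    universal property. Two Cuntz families are joined into the family of pairs [(S i, T i)] in the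
    product algebra. A scalar of the product is a coefficient shared by both families, and the
    morphism to be found is a closed subalgebra of the product, read as a graph.

    On the operator side, an operator algebra is closed under those adjoints that exist, so the
    existence of adjoints has to be propagated from the generators to the whole algebra, through
    norm limits included. *)

Lemma normc_real (R : realType) (r : R) : normc r%:C%C = `|r|.
Proof. by rewrite /= expr0n addr0 sqrtr_sqr. Qed.

Section CStarBasics.
Context (R : realType) (A : cstarAlgType R).
Implicit Types a b : A.

Lemma star1 : star 1 = 1 :> A.
Proof. by rewrite -[LHS]mulr1 -[X in _ * X]starK -starM mulr1 starK. Qed.

Lemma star0 : star 0 = 0 :> A.
Proof. by have /eqP := starD (0 : A) 0; rewrite addr0 eq_sym -subr_eq0 addrK => /eqP. Qed.

Lemma cnorm0 : cnorm (0 : A) = 0.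
Proof. by rewrite -(scale0r 0) cnormZ normc0 mul0r. Qed.

Lemma cnormN a : cnorm (- a) = cnorm a.
Proof. by rewrite -scaleN1r cnormZ normcN normc1 mul1r. Qed.

Lemma cnorm_ge0 a : 0 <= cnorm a.
Proof. by have := ler_cnormD a (- a); rewrite subrr cnorm0 cnormN; lra. Qed.

Lemma cnorm_real (r : R) a : cnorm (r%:C%C *: a) = `|r| * cnorm a.
Proof. by rewrite cnormZ normc_real. Qed.

Lemma cnorm1 : cnorm (1 : A) = 1.
Proof.
have := cnorm_star_mul (1 : A); rewrite star1 mulr1 => /eqP.
rewrite -subr_eq0 expr2 -{1}(mulr1 (cnorm 1)) -mulrBr mulf_eq0 subr_eq0.
by case/orP => [/eqP/cnorm0_eq0/eqP|/eqP //]; rewrite oner_eq0.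
Qed.

Lemma star_sum (I : Type) (s : seq I) (F : I -> A) :
  star (\sum_(i <- s) F i) = \sum_(i <- s) star (F i).
Proof. exact: (big_morph _ (@starD _ _) star0). Qed.

Lemma starB a b : star (a - b) = star a - star b.
Proof. by rewrite starD -scaleN1r starZ rmorphN1 scaleN1r. Qed.

Lemma ler_cnorm_sum (I : Type) (s : seq I) (P : pred I) (F : I -> A) :
  cnorm (\sum_(i <- s | P i) F i) <= \sum_(i <- s | P i) cnorm (F i).
Proof.
elim/big_ind2: _ => [|x u y v xu yv|//]; first by rewrite cnorm0.
exact: le_trans (ler_cnormD _ _) (lerD xu yv).
Qed.

Lemma cnorm_star a : cnorm (star a) = cnorm a.
Proof.
have le b : cnorm b <= cnorm (star b).
  have [b0|b0] := eqVneq (cnorm b) 0; first by rewrite b0 cnorm_ge0.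
  have b_gt0 : 0 < cnorm b by rewrite lt_def b0 cnorm_ge0.
  by rewrite -(ler_pM2r b_gt0) -expr2 -cnorm_star_mul ler_cnormM.
by apply/eqP; rewrite eq_le le -{2}(starK a) le.
Qed.

End CStarBasics.

(** * Orthogonality of the ranges in a Cuntz family *)

Section CuntzOrthogonality.
Context (R : realType) (A : cstarAlgType R).

Let quad (z : A) (a b c : R[i]) : A := a *: 1 + b *: z + c *: (z * z).

Let quadD z a b c a' b' c' :
  quad z a b c + quad z a' b' c' = quad z (a + a') (b + b') (c + c').
Proof. by rewrite /quad !scalerDl addrACA [X in X + _ = _]addrACA. Qed.

Let quadZ z k a b c : k *: quad z a b c = quad z (k * a) (k * b) (k * c).
Proof. by rewrite /quad !scalerDr !scalerA. Qed.

Let quad_mul z a b : (1 + a *: z) * (1 + b *: z) = quad z 1 (a + b) (a * b).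
Proof.
rewrite /quad mulrDr mulr1 mulrDl mul1r -scalerAl -scalerAr scalerA.
by rewrite scale1r scalerDl !addrA.
Qed.

Let lin_quad (z : A) (a : R[i]) : 1 + a *: z = quad z 1 a 0.
Proof. by rewrite /quad scale1r scale0r addr0. Qed.

Let ler_cnorm_mul1 (a b : A) : cnorm a <= 1 -> cnorm b <= 1 -> cnorm (a * b) <= 1.
Proof.
move=> a1 b1; apply: le_trans (ler_cnormM _ _) _.
by rewrite mulr_ile1 ?cnorm_ge0.
Qed.

(* With [l = (4 + 3i)/5] of modulus one, [|1 + l z|^2 = |1 + (8/5) z + z^2|] and
   [1 + (8/5) z + z^2] is a convex combination of [(1 + z)^2] and [(1 - z)^2];
   then [1 + (5/4) z] is a convex combination of [(1 + l z)^2],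
   [(1 + l^* z)^2] and [(1 + z) (1 - z)]. *)
Lemma cnorm_add1_amplify (z : A) : star z = z ->
  cnorm (1 + z) <= 1 -> cnorm (1 - z) <= 1 ->
  cnorm (1 + (5 / 4)%:C%C *: z) <= 1.
Proof.
move=> zs p1 m1.
have pE : 1 + z = 1 + 1 *: z by rewrite scale1r.
have mE : 1 - z = 1 + (-1) *: z by rewrite scaleN1r.
pose l : R[i] := Complex (4 / 5) (3 / 5).
have normal (k : R[i]) : k + conjc k = (8 / 5)%:C%C -> k * conjc k = 1 ->
    cnorm (1 + k *: z) <= 1.
  move=> kD kM; rewrite -(@ler_sqr _ _ 1) ?nnegrE ?cnorm_ge0 ?ler01// expr1n.
  rewrite -cnorm_star_mul starD star1 starZ zs quad_mul.
  rewrite [conjc k + k]addrC kD [conjc k * k]mulrC kM.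
  have -> : quad z 1 (8 / 5)%:C%C 1 = (9 / 10)%:C%C *: ((1 + z) * (1 + z))
      + (1 / 10)%:C%C *: ((1 - z) * (1 - z)).
    rewrite pE mE !quad_mul !quadZ quadD; congr quad;
      by apply/eqP; rewrite eq_complex /=; apply/andP; split; apply/eqP; field.
  apply: le_trans (ler_cnormD _ _) _; rewrite !cnorm_real.
  have := ler_cnorm_mul1 p1 p1; have := ler_cnorm_mul1 m1 m1.
  by rewrite !ger0_norm; lra.
have h1 : cnorm (1 + l *: z) <= 1.
  by apply: normal; apply/eqP; rewrite eq_complex /=; apply/andP; split;
    apply/eqP; field.
have h2 : cnorm (1 + conjc l *: z) <= 1.
  by apply: normal; apply/eqP; rewrite eq_complex /=; apply/andP; split;
    apply/eqP; field.
have -> : 1 + (5 / 4)%:C%C *: z =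
    (25 / 64)%:C%C *: ((1 + l *: z) * (1 + l *: z)) +
    (25 / 64)%:C%C *: ((1 + conjc l *: z) * (1 + conjc l *: z)) +
    (7 / 32)%:C%C *: ((1 + z) * (1 - z)).
  rewrite lin_quad pE mE !quad_mul !quadZ !quadD; congr quad;
    by apply/eqP; rewrite eq_complex /=; apply/andP; split; apply/eqP; field.
apply: le_trans (ler_cnormD _ _) _; rewrite cnorm_real.
apply: le_trans (lerD (ler_cnormD _ _) (lexx _)) _; rewrite !cnorm_real.
have := ler_cnorm_mul1 p1 m1; have := ler_cnorm_mul1 h1 h1.
have := ler_cnorm_mul1 h2 h2.
by rewrite !ger0_norm; lra.
Qed.

(** The amplification can be iterated: all multiples [(5/4)^k z] satisfy the same two bounds, so
    their norms stay below 2, which forces [z = 0]. In spectral terms, the spectrum of [z] lies both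
    in [-2, 0] and in [0, 2]. *)
Lemma cnorm_add1_sub1 (z : A) : star z = z ->
  cnorm (1 + z) <= 1 -> cnorm (1 - z) <= 1 -> z = 0.
Proof.
move=> zs p1 m1.
have bound k : cnorm (((5 / 4) ^+ k)%:C%C *: z) <= 2.
  suff [hp hm] : cnorm (1 + ((5 / 4) ^+ k)%:C%C *: z) <= 1 /\
      cnorm (1 - ((5 / 4) ^+ k)%:C%C *: z) <= 1.
    set w := _ *: z in hp *; rewrite -(addKr 1 w) addrC.
    by apply: le_trans (ler_cnormD _ _) _; rewrite cnormN cnorm1; lra.
  elim: k => [|k [IHp IHm]]; first by rewrite expr0 scale1r.
  have zks : star (((5 / 4) ^+ k)%:C%C *: z) = ((5 / 4) ^+ k)%:C%C *: z.
    by rewrite starZ zs conjc_real.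
  rewrite exprS rmorphM -!scalerA; split; first exact: cnorm_add1_amplify.
  rewrite -scalerN; apply: cnorm_add1_amplify => //; last by rewrite opprK.
  by rewrite -sub0r starB star0 zks.
apply: cnorm0_eq0; apply/eqP; rewrite eq_le cnorm_ge0 andbT leNgt; apply/negP => z0.
have ge k : k%:R / 4 <= (5 / 4) ^+ k :> R.
  elim: k => [|k IH]; first by rewrite mul0r expr0.
  have : 1 <= (5 / 4) ^+ k :> R by rewrite exprn_ege1//; lra.
  by rewrite exprS -(natr1 k); lra.
pose k := Num.bound (8 / cnorm z).
have := bound k; rewrite cnorm_real ger0_norm; last by rewrite exprn_ge0//; lra.
apply/negP; rewrite -ltNge -ltr_pdivrMr//; apply: lt_le_trans (ge k).
have : 8 / cnorm z < k%:R by apply: archi_boundP; rewrite divr_ge0// ltW.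
have -> : 8 / cnorm z = 4 * (2 / cnorm z) by rewrite mulrA; congr (_ / _); ring.
lra.
Qed.

(** The compressions [y k] of the range projections are positive, their sum is 1 and [y i = 1], so
    the others must vanish. Positivity enters as [|1 - 2 y k| <= 1]: summing over the [k] other than
    [i] and [j] bounds [|m + 2 y j|] by [m], and [cnorm_add1_sub1] then applies to a multiple of
    [y j]. *)
Lemma cuntz_family_orthogonal n (S : 'I_n -> A) : cuntz_family S ->
  forall i j, i != j -> star (S i) * S j = 0.
Proof.
move=> [SS S1] i j ij.
pose P k := S k * star (S k); pose y k := star (S i) * P k * S i.
have cS k : cnorm (S k) = 1.
  apply/eqP; rewrite -(@eqrXn2 _ 2) ?cnorm_ge0 ?ler01// expr1n.
  by rewrite -cnorm_star_mul SS cnorm1.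
have Ps k : star (P k) = P k by rewrite /P starM starK.
have Pidem k : P k * P k = P k by rewrite /P mulrA -(mulrA (S k)) SS mulr1.
have ys k : star (y k) = y k by rewrite /y 2!starM Ps starK mulrA.
have yE k : y k = star (star (S k) * S i) * (star (S k) * S i).
  by rewrite starM starK /y /P !mulrA.
(* [1 - 2 P k] is a self-adjoint unitary, so its compression by the isometry [S i] has norm at most
   1. *)
have y1 k : cnorm (1 - 2 *: y k) <= 1.
  have -> : 1 - 2 *: y k = star (S i) * (1 - 2 *: P k) * S i.
    by rewrite mulrBr mulr1 mulrBl SS -scalerAr -scalerAl.
  apply: le_trans (ler_cnormM _ _) _; rewrite cS mulr1.
  apply: le_trans (ler_cnormM _ _) _; rewrite cnorm_star cS mul1r.
  rewrite -(@ler_sqr _ _ 1) ?nnegrE ?cnorm_ge0 ?ler01// expr1n -cnorm_star_mul.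
  rewrite starB star1 starZ Ps (_ : conjc 2 = 2 :> R[i]) ?rmorph_nat//.
  rewrite mulrBr mulr1 -scalerAr mulrBl mul1r -scalerAl Pidem.
  have -> : P k - 2 *: P k = - P k by rewrite scaler_nat mulr2n opprD addNKr.
  by rewrite scalerN opprK subrK cnorm1.
have ysum : \sum_(k < n | k != i) y k = 0.
  have : \sum_(k < n) y k = 1 by rewrite /y -mulr_suml -mulr_sumr S1 mulr1 SS.
  rewrite (bigD1 i)//= {1}/y /P mulrA SS mul1r SS.
  by move/(canRL (addKr _)); rewrite addNr.
have ji : j != i by rewrite eq_sym.
rewrite -[LHS]starK starM starK; apply/eqP.
suff : y j = 0.
  rewrite yE => /(congr1 cnorm); rewrite cnorm_star_mul cnorm0 => /eqP.
  by rewrite expf_eq0/= => /eqP/cnorm0_eq0 ->; rewrite star0.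
pose m : R := #|[pred k : 'I_n | k != i & k != j]|%:R.
have m0 : 0 <= m by rewrite ler0n.
have mp : cnorm (m%:C%C *: 1 + 2 *: y j) <= m.
  have -> : m%:C%C *: 1 + 2 *: y j =
      \sum_(k < n | (k != i) && (k != j)) (1 - 2 *: y k).
    move/eqP: ysum; rewrite (bigD1 j)//= addrC addr_eq0 => /eqP ysum.
    rewrite sumrB -scaler_sumr ysum scalerN opprK sumr_const; congr (_ + _).
    by rewrite /m rmorph_nat scaler_nat.
  apply: le_trans (ler_cnorm_sum _ _ _) _.
  by rewrite /m -sum1_card natr_sum; apply: ler_sum => k _; exact: y1.
(* [m = n - 2] may be 0; with the extra 1, both signs of [2 y j] are bounded by the same positive
   [m + 1]. *)
have M1 : 0 < m + 1 by lra.
pose z := (2 / (m + 1))%:C%C *: y j.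
have zE : (m + 1)%:C%C *: z = 2 *: y j.
  by rewrite scalerA -rmorphM mulrC divfK ?gt_eqF// rmorph_nat.
have scale e : cnorm ((m + 1)%:C%C *: 1 + e *: (2 *: y j)) <= m + 1 ->
    cnorm (1 + e *: z) <= 1.
  rewrite -zE (scalerA e) mulrC -scalerA -scalerDr cnorm_real gtr0_norm//.
  by rewrite -{2}[m + 1]mulr1 ler_pM2l.
have : z = 0.
  apply: cnorm_add1_sub1.
  - by rewrite /z starZ conjc_real ys.
  - rewrite -[z]scale1r; apply: scale; rewrite scale1r rmorphD/= scalerDl scale1r.
    rewrite addrAC; apply: le_trans (ler_cnormD _ _) _; rewrite cnorm1.
    by rewrite lerD2r.
  - rewrite -scaleN1r; apply: scale; rewrite scaleN1r rmorphD/= scalerDl scale1r.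
    rewrite -addrA; apply: le_trans (ler_cnormD _ _) _.
    rewrite cnorm_real cnorm1 mulr1 ger0_norm//.
    by rewrite lerD2l; exact: y1.
move=> /eqP; rewrite scaler_eq0 => /orP[|/eqP //].
by rewrite eq_complex/= eqxx andbT mulf_eq0 invr_eq0 gt_eqF//= gt_eqF.
Qed.

End CuntzOrthogonality.

(** * The product of two C*-algebras with the maximum norm *)

Section CStarProduct.
Context (R : realType) (A B : cstarAlgType R).
Implicit Types x y : (A * B)%type.

Let pstar x : A * B := (star x.1, star x.2).
Let pnorm x : R := Num.max (cnorm x.1) (cnorm x.2).

Let pnorm_ge1 x : cnorm x.1 <= pnorm x. Proof. by rewrite le_max lexx. Qed.
Let pnorm_ge2 x : cnorm x.2 <= pnorm x. Proof. by rewrite le_max lexx orbT. Qed.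
Let pnorm_ge0 x : 0 <= pnorm x.
Proof. exact: le_trans (cnorm_ge0 _) (pnorm_ge1 x). Qed.

Let pstarD x y : pstar (x + y) = pstar x + pstar y.
Proof. by rewrite /pstar /= !starD. Qed.

Let pstarZ (c : R[i]) x : pstar (c *: x) = conjc c *: pstar x.
Proof. by rewrite /pstar /= !starZ. Qed.

Let pstarM x y : pstar (x * y) = pstar y * pstar x.
Proof. by rewrite /pstar /= !starM. Qed.

Let pstarK x : pstar (pstar x) = x.
Proof. by rewrite /pstar /= !starK -surjective_pairing. Qed.

Let pnorm0_eq0 x : pnorm x = 0 -> x = 0.
Proof.
move=> x0; rewrite [x]surjective_pairing; congr pair; apply: cnorm0_eq0; apply/eqP.
  by rewrite eq_le cnorm_ge0 andbT -x0.
by rewrite eq_le cnorm_ge0 andbT -x0.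
Qed.

Let ler_pnormD x y : pnorm (x + y) <= pnorm x + pnorm y.
Proof.
by rewrite ge_max !(le_trans (ler_cnormD _ _))// lerD.
Qed.

Let pnormZ (c : R[i]) x : pnorm (c *: x) = normc c * pnorm x.
Proof.
rewrite /pnorm /= !cnormZ maxr_pMr//; case: c => a b /=; exact: sqrtr_ge0.
Qed.

Let ler_pnormM x y : pnorm (x * y) <= pnorm x * pnorm y.
Proof.
by rewrite ge_max !(le_trans (ler_cnormM _ _))// ler_pM ?cnorm_ge0.
Qed.

Let pnorm_star_mul x : pnorm (pstar x * x) = pnorm x ^+ 2.
Proof.
rewrite {1}/pnorm /= !cnorm_star_mul; apply/eqP; rewrite eq_le; apply/andP; split.
  by rewrite ge_max !lerXn2r// nnegrE ?cnorm_ge0.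
by rewrite /pnorm; case: (leP (cnorm x.1)) => _; rewrite le_max lexx ?orbT.
Qed.

Let pnorm_complete (u : nat -> A * B) :
  (forall e : R, 0 < e -> exists N : nat, forall m n : nat,
     (N <= m)%N -> (N <= n)%N -> pnorm (u m - u n) <= e) ->
  exists l : A * B, forall e : R, 0 < e ->
    exists N : nat, forall n : nat, (N <= n)%N -> pnorm (u n - l) <= e.
Proof.
move=> cu.
have [l1 h1] : exists l : A, forall e : R, 0 < e ->
    exists N : nat, forall n : nat, (N <= n)%N -> cnorm ((u n).1 - l) <= e.
  apply: cnorm_complete => e /cu[N uN]; exists N => m k Nm Nk.
  exact: le_trans (pnorm_ge1 _) (uN _ _ Nm Nk).
have [l2 h2] : exists l : B, forall e : R, 0 < e ->
    exists N : nat, forall n : nat, (N <= n)%N -> cnorm ((u n).2 - l) <= e.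
  apply: cnorm_complete => e /cu[N uN]; exists N => m k Nm Nk.
  exact: le_trans (pnorm_ge2 _) (uN _ _ Nm Nk).
exists (l1, l2) => e e0; have [N1 hN1] := h1 e e0; have [N2 hN2] := h2 e e0.
exists (maxn N1 N2) => k; rewrite geq_max => /andP[k1 k2].
by rewrite ge_max hN1 ?hN2.
Qed.

HB.instance Definition _ := isCStar.Build R (A * B)%type pstarD pstarZ pstarM
  pstarK pnorm0_eq0 ler_pnormD pnormZ ler_pnormM pnorm_star_mul pnorm_complete.

End CStarProduct.

(** * Words in a Cuntz family *)

(** What is proved about the words of the paired family holds for both families at once, with the
    same scalars. *)
Lemma cuntz_family_pair (R : realType) (A B : cstarAlgType R) n
    (S : 'I_n -> A) (T : 'I_n -> B) : cuntz_family S -> cuntz_family T ->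
  cuntz_family (fun i => (S i, T i)).
Proof.
move=> [SS S1] [TT T1]; split=> [i|]; rewrite [LHS]surjective_pairing [RHS]surjective_pairing.
  by congr pair; [exact: SS|exact: TT].
by congr pair; [rewrite (raddf_sum fst)|rewrite (raddf_sum snd)].
Qed.

Section CuntzWords.
Context (R : realType) (A : cstarAlgType R) (n : nat) (S : 'I_n -> A).

Definition word (u : seq 'I_n) : A := \prod_(i <- u) S i.

Lemma word_nil : word [::] = 1. Proof. exact: big_nil. Qed.

Lemma word_cons i u : word (i :: u) = S i * word u.
Proof. exact: big_cons. Qed.

Lemma word_cat u v : word (u ++ v) = word u * word v.
Proof. exact: big_cat. Qed.

Lemma word_rcons u i : word (rcons u i) = word u * S i.
Proof. by rewrite -cats1 word_cat word_cons word_nil mulr1. Qed.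

Definition scalar (a : A) := exists c : R[i], a = c *: 1.

Lemma scalar0 : scalar 0. Proof. by exists 0; rewrite scale0r. Qed.
Lemma scalar1 : scalar 1. Proof. by exists 1; rewrite scale1r. Qed.

Lemma scalarD a b : scalar a -> scalar b -> scalar (a + b).
Proof. by move=> [c ->] [d ->]; exists (c + d); rewrite scalerDl. Qed.

Lemma scalarM a b : scalar a -> scalar b -> scalar (a * b).
Proof.
by move=> [c ->] [d ->]; exists (c * d); rewrite -scalerAl mul1r scalerA.
Qed.

Lemma scalarZ c a : scalar a -> scalar (c *: a).
Proof. by move=> [d ->]; exists (c * d); rewrite scalerA. Qed.

Lemma scalar_star a : scalar a -> scalar (star a).
Proof. by move=> [c ->]; exists (conjc c); rewrite starZ star1. Qed.

(* The span of the [word u * star (word v)] with [u] of length [p] and [v] of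
   length [q], described by its coefficients. *)
Definition words_span (p q : nat) (x : A) := forall u v,
  size u = p -> size v = q -> scalar (star (word u) * x * word v).

(* Homogeneity of degree [a - b] under the gauge action [S i |-> z S i], [|z| = 1]. *)
Definition gauge_degree (a b : nat) (x : A) :=
  exists m, words_span (m + a) (m + b) x.

Hypothesis cuntzS : cuntz_family S.

Let orth i j : star (S i) * S j = (i == j)%:R.
Proof.
have [<-|ij] := eqVneq; first by case: cuntzS => ->.
exact: (cuntz_family_orthogonal cuntzS).
Qed.

Let sumS : \sum_i S i * star (S i) = 1. Proof. by case: cuntzS. Qed.

Lemma word_isometry u : star (word u) * word u = 1.
Proof.
elim: u => [|i u IH]; first by rewrite word_nil star1 mulr1.
by rewrite word_cons starM mulrA -(mulrA (star _)) orth eqxx mulr1.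
Qed.

Lemma star_word_mul u v : (size u <= size v)%N ->
  star (word u) * word v =
  if take (size u) v == u then word (drop (size u) v) else 0.
Proof.
elim: u v => [|i u IH] [|j v] //=.
- by rewrite word_nil star1 mulr1.
- by rewrite word_nil star1 mul1r.
move=> uv; rewrite !word_cons starM mulrA -(mulrA (star _)) orth eqseq_cons.
rewrite eq_sym; case: eqP => _; first by rewrite mulr1 IH.
by rewrite mulr0 mul0r.
Qed.

(** The resolution of the identity by the words [v] of length [q], inserted between [a] and [b].
    Phrasing it with an additive predicate avoids sums indexed by words. *)
Lemma insert_words (P : A -> Prop) : P 0 ->
    (forall x y, P x -> P y -> P (x + y)) ->
  forall q a b, (forall v, size v = q -> P (a * word v * (star (word v) * b))) ->
  P (a * b).
Proof.
move=> P0 PD; elim=> [|q IH] a b h.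
  by have := h [::] erefl; rewrite word_nil star1 mulr1 mul1r.
rewrite -(mulr1 a) -sumS mulr_sumr mulr_suml; apply: (big_ind P) => // i _.
rewrite mulrA -mulrA; apply: IH => v vq.
by have := h (i :: v); rewrite /= vq word_cons starM !mulrA; apply.
Qed.

Lemma word_cancel q x : (forall v, size v = q -> star (word v) * x = 0) -> x = 0.
Proof.
move=> h; rewrite -[x]mul1r; apply: (@insert_words (eq^~ 0) _ _ q) => //.
  by move=> ? ? -> ->; rewrite addr0.
by move=> v /h ->; rewrite mulr0.
Qed.

Lemma word_cancel2 p q x : (forall u v, size u = p -> size v = q ->
  star (word u) * x * word v = 0) -> x = 0.
Proof.
move=> h; apply: (@word_cancel p) => u up; apply: (can_inj (@starK _ _)).
rewrite star0; apply: (@word_cancel q) => v vq.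
by apply: (can_inj (@starK _ _)); rewrite starM !starK star0 h.
Qed.

(** Resolving the identity on both sides of [x] gives [n^(p + q)] terms of norm at most [M]. The
    crude factor is harmless, because it depends on [p] and [q] only. *)
Lemma cnorm_le_words p q x M :
  (forall u v, size u = p -> size v = q ->
    cnorm (star (word u) * x * word v) <= M) ->
  cnorm x <= n%:R ^+ (p + q) * M.
Proof.
have cS i : cnorm (S i) = 1.
  apply/eqP; rewrite -(@eqrXn2 _ 2) ?cnorm_ge0 ?ler01// expr1n.
  by rewrite -cnorm_star_mul orth eqxx cnorm1.
have bound r y N : (forall u, size u = r -> cnorm (star (word u) * y) <= N) ->
    cnorm y <= n%:R ^+ r * N.
  elim: r y => [|r IH] y h.
    by have := h [::] erefl; rewrite word_nil star1 !mul1r.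
  rewrite -[y]mul1r -sumS mulr_suml; apply: le_trans (ler_cnorm_sum _ _ _) _.
  rewrite exprS -mulrA mulr_natl -[X in _ *+ X]card_ord -sumr_const.
  apply: ler_sum => i _; rewrite -mulrA; apply: le_trans (ler_cnormM _ _) _.
  rewrite cS mul1r; apply: IH => u ur; rewrite mulrA -starM -word_cons.
  by apply: h; rewrite /= ur.
move=> h; rewrite exprD -mulrA; apply: (bound) => u up; rewrite -cnorm_star.
apply: bound => v vq; rewrite -cnorm_star starM !starK.
exact: h.
Qed.

Lemma words_span0 p q : words_span p q 0.
Proof. by move=> u v _ _; rewrite mulr0 mul0r; exact: scalar0. Qed.

Lemma words_spanD p q x y :
  words_span p q x -> words_span p q y -> words_span p q (x + y).
Proof.
by move=> hx hy u v up vq; rewrite mulrDr mulrDl; apply: scalarD;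
  [exact: hx|exact: hy].
Qed.

Lemma words_spanZ p q c x : words_span p q x -> words_span p q (c *: x).
Proof.
by move=> hx u v up vq; rewrite -scalerAr -scalerAl; apply/scalarZ/hx.
Qed.

Lemma words_span_star p q x : words_span p q x -> words_span q p (star x).
Proof.
move=> hx u v up vq; have := scalar_star (hx v u vq up).
by rewrite !starM starK mulrA.
Qed.

Lemma words_spanM p q r x y :
  words_span p q x -> words_span q r y -> words_span p r (x * y).
Proof.
move=> hx hy u w up wr; rewrite mulrA -mulrA.
apply: (insert_words scalar0 scalarD (q := q)) => v vq.
by rewrite [star (word v) * _]mulrA; apply: scalarM; [exact: hx|exact: hy].
Qed.

(** Reflects [S_u S_v^* = \sum_i S_(u i) S_(v i)^*]: the scalar at [u, v] reappears at [u i, v j],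
    multiplied by the Kronecker symbol of [i] and [j]. *)
Lemma words_span_raise k p q x : words_span p q x -> words_span (k + p) (k + q) x.
Proof.
elim: k => // k IH /IH hx u v; case/lastP: u => [//|u i]; case/lastP: v => [//|v j].
rewrite !size_rcons => -[up] [vq]; have [c hc] := hx u v up vq.
rewrite !word_rcons starM !mulrA -(mulrA (star (S i))) -(mulrA (star (S i))) hc.
rewrite -scalerAr mulr1 -scalerAl orth; apply: scalarZ.
by case: eqP => _; [exact: scalar1|exact: scalar0].
Qed.

Lemma words_span_word u v : words_span (size u) (size v) (word u * star (word v)).
Proof.
move=> w z wu zv; rewrite mulrA -mulrA; apply: scalarM.
  rewrite star_word_mul ?wu// take_size drop_size; case: eqP => _.
    by rewrite word_nil; exact: scalar1.
  exact: scalar0.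
rewrite star_word_mul ?zv// -zv take_size drop_size; case: eqP => _.
  by rewrite word_nil; exact: scalar1.
exact: scalar0.
Qed.

Lemma gauge_degree_shift k a b x :
  gauge_degree a b x <-> gauge_degree (k + a) (k + b) x.
Proof.
split=> -[m h].
  by exists m; rewrite !(addnCA m); exact: words_span_raise.
by exists (m + k)%N; rewrite -!addnA.
Qed.

Lemma gauge_degree0 a b : gauge_degree a b 0.
Proof. by exists 0%N; exact: words_span0. Qed.

Lemma gauge_degreeD a b x y :
  gauge_degree a b x -> gauge_degree a b y -> gauge_degree a b (x + y).
Proof.
move=> [k hx] [m hy]; exists (k + m)%N; apply: words_spanD.
  by rewrite [(k + m)%N]addnC -!addnA; exact: words_span_raise.
by rewrite -!addnA; exact: words_span_raise.
Qed.

Lemma gauge_degreeZ a b c x : gauge_degree a b x -> gauge_degree a b (c *: x).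
Proof. by move=> [k hx]; exists k; exact: words_spanZ. Qed.

Lemma gauge_degree_star a b x : gauge_degree a b x -> gauge_degree b a (star x).
Proof. by move=> [k hx]; exists k; exact: words_span_star. Qed.

Lemma gauge_degreeM a b c x y :
  gauge_degree a b x -> gauge_degree b c y -> gauge_degree a c (x * y).
Proof.
move=> [k hx] [m hy]; exists (k + m)%N; apply: (@words_spanM _ (k + m + b)).
  by rewrite [(k + m)%N]addnC -!addnA; exact: words_span_raise.
by rewrite -!addnA; exact: words_span_raise.
Qed.

Lemma gauge_degree_word u v :
  gauge_degree (size u) (size v) (word u * star (word v)).
Proof. by exists 0%N; exact: words_span_word. Qed.

End CuntzWords.

(** * Extraction of homogeneous components by compression *)

Section GaugeComponents.
Context (R : realType) (A : cstarAlgType R) (n : nat) (S : 'I_n -> A).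
Hypothesis cuntzS : cuntz_family S.
Variables (i0 i1 : 'I_n).
Hypothesis i01 : i0 != i1.

Let orth i j : star (S i) * S j = (i == j)%:R.
Proof.
have [<-|ij] := eqVneq; first by case: cuntzS => ->.
exact: (cuntz_family_orthogonal cuntzS).
Qed.

(** The canonical endomorphism of a Cuntz algebra. The values of its k-th iterate commute with every
    [S_u S_v^*] such that [|u| = |v| = k]. *)
Definition cuntz_shift (x : A) : A := \sum_i S i * x * star (S i).

Lemma shift_word u x :
  iter (size u) cuntz_shift x * word S u = word S u * x.
Proof.
elim: u x => [|i u IH] x; first by rewrite word_nil mul1r mulr1.
rewrite word_cons iterS /cuntz_shift mulr_suml (bigD1 i)//= big1 ?addr0.
  by rewrite -/cuntz_shift -!mulrA [star (S i) * _]mulrA orth eqxx mul1r IH mulrA.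
move=> j ji; rewrite -!mulrA [star (S j) * _]mulrA orth (negbTE ji).
by rewrite mul0r !mulr0.
Qed.

(* No proper shift of the word [i0 ... i0 i1] by at most [D] letters overlaps it. *)
Let marker D := word S (rcons (nseq D i0) i1).

(** Writing [M] for the marker, the insertion of the words [v] of length [r] leaves multiples of
    [M^* S_v M]. Such a term is nonzero only if the marker word is a prefix of [v] followed by the
    marker word. *)
Let marker_kill D r t : (0 < r <= D)%N -> words_span S r 0 t ->
  star (marker D) * t * marker D = 0.
Proof.
move=> /andP[r0 rD] ht; rewrite -mulrA.
apply: (@insert_words _ _ _ _ cuntzS (eq^~ 0) _ _ r) => //.
  by move=> ? ? -> ->; rewrite addr0.
move=> v vr; have [c] := ht v [::] vr erefl; rewrite word_nil mulr1 => hc.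
rewrite [star (word S v) * _]mulrA hc -scalerAl mul1r -scalerAr -mulrA -word_cat.
rewrite (star_word_mul cuntzS) ?size_cat ?leq_addl// size_rcons size_nseq.
(* The letter at index [D] of the marker word is [i1]; in the longer word it is the letter
   [D - r < D] of the marker word, hence [i0]. *)
case: eqP => [/(congr1 (fun s => nth i0 s D))|]; last by rewrite scaler0.
rewrite nth_take// nth_cat vr ltnNge rD/= !nth_rcons size_nseq ltnn eqxx.
have -> : (D - r < D)%N by lia.
by rewrite nth_nseq if_same => /eqP; rewrite (negbTE i01).
Qed.

(** Shifting the marker [K] times makes it commute with the words [S_u S_v^*], [|u| = |v| = K].
    Compression by [Q] therefore fixes their span, and on other elements it acts as compression by
    the marker once the outer words of length [K] are stripped off. *)
Let Q K D := iter K cuntz_shift (marker D).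

Let compress K D y u v : size u = K -> size v = K ->
  star (word S u) * (star (Q K D) * y * Q K D) * word S v =
  star (marker D) * (star (word S u) * y * word S v) * marker D.
Proof.
move=> uK vK.
have Qv : Q K D * word S v = word S v * marker D by rewrite -vK shift_word.
have uQ : star (word S u) * star (Q K D) = star (marker D) * star (word S u).
  by rewrite -!starM -uK shift_word.
by rewrite !mulrA uQ -[_ * Q K D * _]mulrA Qv !mulrA.
Qed.

Let compress0 K D r y : (0 < r <= D)%N -> words_span S (K + r) K y ->
  star (Q K D) * y * Q K D = 0.
Proof.
move=> rD hy; apply: (@word_cancel2 _ _ _ _ cuntzS K K) => u v uK vK.
rewrite compress//; apply: (marker_kill rD) => u' v' u'r /size0nil ->.
rewrite word_nil mulr1 !mulrA -starM -word_cat; apply: hy => //.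
by rewrite size_cat uK u'r.
Qed.

Let compress_id K D y : words_span S K K y -> star (Q K D) * y * Q K D = y.
Proof.
move=> hy; apply/eqP; rewrite -subr_eq0; apply/eqP.
apply: (@word_cancel2 _ _ _ _ cuntzS K K) => u v uK vK.
rewrite mulrBr mulrBl compress//; have [c ->] := hy u v uK vK.
by rewrite -scalerAr mulr1 -scalerAl (word_isometry cuntzS) subrr.
Qed.

Let cnormQ K D : cnorm (Q K D) = 1.
Proof.
apply/eqP; rewrite -(@eqrXn2 _ 2) ?cnorm_ge0 ?ler01// expr1n.
(* The unit lies in the span at level [K], so [compress_id] applied to it says that [Q] is an
   isometry. *)
rewrite -cnorm_star_mul -[star _]mulr1 compress_id ?cnorm1//.
move=> u v uK vK; rewrite mulr1 (star_word_mul cuntzS) ?uK ?vK// -vK take_size drop_size.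
case: eqP => _; first by rewrite word_nil; exact: scalar1.
exact: scalar0.
Qed.

Lemma cnorm_gauge_invariant_part M s l (y : nat -> A) k0 :
  (forall k, gauge_degree S (k + s) l (y k)) -> (k0 < M)%N -> (k0 + s = l)%N ->
  cnorm (y k0) <= cnorm (\sum_(k < M) y k).
Proof.
move=> hy k0M k0l.
have [t ht] : exists t, forall k, (k < M)%N ->
    words_span S (t + (k + s)) (t + l) (y k).
  elim: {k0M}M => [|M [t ht]]; first by exists 0%N.
  have [m hm] := hy M; exists (m + t)%N => k; rewrite ltnS leq_eqVlt.
  case/orP => [/eqP ->|kM]; last first.
    by rewrite -!addnA; apply: (words_span_raise cuntzS); exact: ht.
  by rewrite [(m + t)%N]addnC -!addnA; apply: (words_span_raise cuntzS).
(* Up to a star, component [k] can be raised to words of lengths [K + r] and [K] with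
   [r = |k + s - l|], and [D] bounds all these [r]. *)
pose K := (t + l)%N; pose D := (M + s + l)%N.
have -> : y k0 = star (Q K D) * (\sum_(k < M) y k) * Q K D.
  rewrite mulr_sumr mulr_suml (bigD1 (Ordinal k0M))//= big1 ?addr0.
    by rewrite compress_id// /K; have := ht _ k0M; rewrite k0l.
  move=> k kk0; have kM := ltn_ord k; have := ht k kM.
  have [kl|kl|kl] := ltngtP (k + s)%N l.
  - move=> /(@words_span_raise _ _ _ _ cuntzS (l - (k + s)) _ _ _) /words_span_star h.
    apply: (can_inj (@starK _ _)); rewrite star0 !starM starK mulrA.
    apply: (@compress0 _ _ (l - (k + s))); first by rewrite /D; lia.
    by move: h; congr (words_span S _ _ _); rewrite /K; lia.
  - move=> h; apply: (@compress0 _ _ (k + s - l)); first by rewrite /D; lia.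
    by move: h; congr (words_span S _ _ _); rewrite /K; lia.
  - by move: kk0; rewrite -val_eqE/= => /eqP[]; lia.
apply: le_trans (ler_cnormM _ _) _; rewrite cnormQ mulr1.
by apply: le_trans (ler_cnormM _ _) _; rewrite cnorm_star cnormQ mul1r.
Qed.

Lemma cnorm_gauge_component M d (y : nat -> A) j :
  (forall k, gauge_degree S k d (y k)) -> (j < M)%N ->
  cnorm (y j) <= cnorm (\sum_(k < M) y k).
Proof.
(* The subtractions are truncated: at most one of [p] and [q] is nonzero, and [j + p = d + q].
   Multiplying by isometries on the appropriate side thus brings component [j] to degree 0,
   reversibly. *)
move=> hy jM; pose p := (d - j)%N; pose q := (j - d)%N.
pose a := word S (nseq p i0); pose b := word S (nseq q i0).
have ca u : cnorm (word S u) = 1.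
  apply/eqP; rewrite -(@eqrXn2 _ 2) ?cnorm_ge0 ?ler01// expr1n.
  by rewrite -cnorm_star_mul (word_isometry cuntzS) cnorm1.
pose z k := a * y k * star b.
have hz k : gauge_degree S (k + p) (d + q) (z k).
  apply: (@gauge_degreeM _ _ _ _ cuntzS _ d).
    apply: (@gauge_degreeM _ _ _ _ cuntzS _ k) (hy k).
    have := gauge_degree_word cuntzS (nseq p i0) [::].
    rewrite word_nil star1 mulr1 size_nseq.
    by move/(gauge_degree_shift cuntzS k); rewrite addn0.
  have := gauge_degree_word cuntzS [::] (nseq q i0).
  rewrite word_nil mul1r size_nseq.
  by move/(gauge_degree_shift cuntzS d); rewrite addn0.
have -> : y j = star a * z j * b.
  rewrite /z !mulrA (word_isometry cuntzS) mul1r -mulrA (word_isometry cuntzS).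
  by rewrite mulr1.
apply: le_trans (ler_cnormM _ _) _; rewrite ca mulr1.
apply: le_trans (ler_cnormM _ _) _; rewrite cnorm_star ca mul1r.
have jpq : (j + p = d + q)%N by rewrite /p /q; lia.
apply: le_trans (cnorm_gauge_invariant_part hz jM jpq) _.
rewrite /z -mulr_suml -mulr_sumr.
apply: le_trans (ler_cnormM _ _) _; rewrite cnorm_star ca mulr1.
by apply: le_trans (ler_cnormM _ _) _; rewrite ca mul1r.
Qed.

End GaugeComponents.

(** * Comparison of norms between two Cuntz families *)

Lemma le_of_pow2_bound (R : realType) (C a b : R) : 0 <= a -> 0 <= b ->
  (forall j, a ^+ (2 ^ j) <= C * (2 ^ j).+1%:R * b ^+ (2 ^ j)) -> a <= b.
Proof.
move=> a0 b0 h; rewrite leNgt; apply/negP => ba.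
have b_gt0 : 0 < b.
  rewrite lt_def b0 andbT; apply/eqP => b00; have := h 0%N.
  by rewrite expn0 !expr1 b00 mulr0 leNgt; case/negP; rewrite -b00.
pose q := a / b - 1.
have q0 : 0 < q by rewrite subr_gt0 ltr_pdivlMr// mul1r.
have bernoulli m : m%:R * q <= (a / b) ^+ m.
  elim: m => [|m IH]; first by rewrite mul0r expr0.
  have abE : a / b = 1 + q by rewrite /q addrC subrK.
  have : 1 <= (a / b) ^+ m by rewrite exprn_ege1// abE lerDl ltW.
  move: ((a / b) ^+ m) IH (exprS (a / b) m) => x IH ->.
  by rewrite abE -(natr1 m); nra.
(* Bernoulli's inequality is squared by taking the exponent [2 m]: the result
   [m^2 q^2 <= C (2 m + 1) <= 3 C m] bounds [m], whereas Bernoulli alone would only compare two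
   linear functions of [m]. *)
have key j : (2 ^ j)%:R * q ^+ 2 <= 3 * C.
  set m := (2 ^ j)%N; have m0 : 0 < m%:R :> R by rewrite ltr0n expn_gt0.
  have m1 : 1 <= m%:R :> R by rewrite ler1n expn_gt0.
  have := h j.+1; rewrite expnSr -/m => hm.
  have : (a / b) ^+ (m * 2) <= C * (m * 2).+1%:R.
    by rewrite expr_div_n ler_pdivrMr ?exprn_gt0.
  rewrite exprM => hm2.
  have h3 : (m%:R * q) ^+ 2 <= C * (m * 2).+1%:R.
    apply: le_trans hm2; rewrite lerXn2r ?nnegrE//.
      by rewrite mulr_ge0// ltW.
    by rewrite exprn_ge0// divr_ge0.
  have C0 : 0 <= C.
    have : 0 <= C * (m * 2).+1%:R by apply: le_trans h3; rewrite sqr_ge0.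
    by rewrite pmulr_lge0// ltr0n.
  rewrite -(ler_pM2l m0); move: h3; rewrite -natr1 natrM => h3.
  by rewrite mulrA -expr2 -exprMn; nra.
pose k := Num.bound (3 * C / q ^+ 2).
have C0 : 0 <= 3 * C.
  by apply: le_trans (key 0%N); rewrite mulr_ge0// sqr_ge0.
have kE : 3 * C / q ^+ 2 < k%:R by apply: archi_boundP; rewrite divr_ge0// sqr_ge0.
have := key k; apply/negP; rewrite -ltNge -ltr_pdivrMr ?exprn_gt0//.
by apply: lt_trans kE _; rewrite ltr_nat ltn_expl.
Qed.

Lemma cnorm_pow2 (R : realType) (A : cstarAlgType R) (a : A) j :
  star a = a -> cnorm (a ^+ (2 ^ j)) = cnorm a ^+ (2 ^ j).
Proof.
move=> sa; elim: j => [|j IH]; first by rewrite expn0 !expr1.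
have sX m : star (a ^+ m) = a ^+ m.
  by elim: m => [|m IHm]; rewrite ?expr0 ?star1// exprSr starM IHm sa -exprS exprSr.
by rewrite expnSr !exprM -IH -cnorm_star_mul sX expr2.
Qed.

(* The C*-identity gives [|x|^(2 * 2^j) = |(x^* x)^(2^j)|], so a comparison of
   the two norms up to a factor growing subexponentially in the degree is
   enough. *)
Lemma cnorm_snd_le_fst (R : realType) (A B : cstarAlgType R) (x : A * B) C :
  (forall m, cnorm ((star x * x) ^+ m).2 <=
     C * m.+1%:R * cnorm ((star x * x) ^+ m).1) ->
  cnorm x.2 <= cnorm x.1.
Proof.
move=> h; rewrite -(@ler_sqr R) ?nnegrE ?cnorm_ge0// -!cnorm_star_mul.
apply: (@le_of_pow2_bound _ C); rewrite ?cnorm_ge0// => j.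
rewrite -!cnorm_pow2 ?starM ?starK//.
have e1 m : ((star x * x) ^+ m).1 = (star x.1 * x.1) ^+ m.
  by elim: m => // m IH; rewrite !exprS -IH.
have e2 m : ((star x * x) ^+ m).2 = (star x.2 * x.2) ^+ m.
  by elim: m => // m IH; rewrite !exprS -IH.
by rewrite -e1 -e2.
Qed.

Section GaugeFinite.
Context (R : realType) (A : cstarAlgType R) (n : nat) (S : 'I_n -> A).
Hypothesis cuntzS : cuntz_family S.

(* The summand [y k] has degree [k - d], so the degrees range over [-d], ..., [d]. *)
Definition gauge_finite (d : nat) (x : A) :=
  exists2 y : nat -> A, (forall k, gauge_degree S k d (y k)) &
    x = \sum_(k < d.*2.+1) y k.

Lemma gauge_finite_homogeneous k d x :
  (k <= d.*2)%N -> gauge_degree S k d x -> gauge_finite d x.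
Proof.
move=> kd hx; exists (fun j => if j == k then x else 0) => [j|].
  by case: eqP => [->//|_]; exact: gauge_degree0.
by rewrite -big_mkcond (big_pred1 (Ordinal (kd : (k < d.*2.+1)%N))).
Qed.

Lemma gauge_finite1 d : gauge_finite d 1.
Proof.
apply: (@gauge_finite_homogeneous d); first by rewrite -addnn leq_addr.
have := gauge_degree_word cuntzS [::] [::]; rewrite !word_nil star1 mulr1.
by move/(gauge_degree_shift cuntzS d); rewrite addn0.
Qed.

Lemma gauge_finite_generator i : gauge_finite 1 (S i).
Proof.
apply: (@gauge_finite_homogeneous 2) => //.
have := gauge_degree_word cuntzS [:: i] [::].
rewrite word_cons !word_nil star1 !mulr1.
by move/(gauge_degree_shift cuntzS 1).
Qed.

Lemma gauge_finiteM d e x y :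
  gauge_finite d x -> gauge_finite e y -> gauge_finite (d + e) (x * y).
Proof.
move=> [u hu ->] [v hv ->].
exists (fun j => \sum_(k < d.*2.+1) \sum_(l < e.*2.+1 | (k + l == j)%N) u k * v l).
  move=> j; apply: (big_ind (gauge_degree S j (d + e))).
  - exact: gauge_degree0.
  - exact: gauge_degreeD.
  move=> k _; apply: (big_ind (gauge_degree S j (d + e))).
  - exact: gauge_degree0.
  - exact: gauge_degreeD.
  move=> l /eqP <-; apply: (@gauge_degreeM _ _ _ _ cuntzS _ (d + l)).
    by rewrite [(k + l)%N]addnC [(d + l)%N]addnC -gauge_degree_shift.
  by rewrite -gauge_degree_shift.
rewrite exchange_big/= mulr_suml; apply: eq_bigr => k _.
rewrite mulr_sumr.
under [RHS]eq_bigr do rewrite big_mkcond/=.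
rewrite exchange_big/=; apply: eq_bigr => l _.
have kl : (k + l < (d + e).*2.+1)%N.
  by have := ltn_ord k; have := ltn_ord l; lia.
rewrite (bigD1 (Ordinal kl))//= eqxx big1 ?addr0// => j.
by rewrite -val_eqE/= eq_sym => /negbTE ->.
Qed.

Lemma gauge_finiteD d x y :
  gauge_finite d x -> gauge_finite d y -> gauge_finite d (x + y).
Proof.
move=> [u hu ->] [v hv ->]; exists (fun k => u k + v k); last by rewrite big_split.
by move=> k; exact: gauge_degreeD.
Qed.

Lemma gauge_finiteZ d c x : gauge_finite d x -> gauge_finite d (c *: x).
Proof.
move=> [u hu ->]; exists (fun k => c *: u k); last by rewrite scaler_sumr.
by move=> k; exact: gauge_degreeZ.
Qed.

Lemma gauge_finite_star d x : gauge_finite d x -> gauge_finite d (star x).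
Proof.
(* The star reverses degrees, so component [k] comes from component [2 d - k]; beyond [2 d] the
   value is 0, which has every degree. *)
move=> [u hu ->]; exists (fun k => if (k <= d.*2)%N then star (u (d.*2 - k)%N) else 0).
  move=> k; case: leqP => kd; last exact: gauge_degree0.
  rewrite (gauge_degree_shift cuntzS (d.*2 - k)) subnK// addnC -[in d.*2]addnn.
  rewrite -(gauge_degree_shift cuntzS d); apply: gauge_degree_star.
  by rewrite addnn.
rewrite star_sum (reindex_inj rev_ord_inj)/=; apply: eq_bigr => k _.
by rewrite -ltnS ltn_ord subSS.
Qed.

End GaugeFinite.

Section CuntzNormComparison.
Context (R : realType) (A B : cstarAlgType R) (n : nat).
Variables (S : 'I_n -> A) (T : 'I_n -> B).
Hypotheses (cuntzS : cuntz_family S) (cuntzT : cuntz_family T).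
Hypothesis n2 : (2 <= n)%N.

Let U i : A * B := (S i, T i).
Let cuntzU : cuntz_family U. Proof. exact: cuntz_family_pair. Qed.

Let wordU u : word U u = (word S u, word T u).
Proof. by elim: u => [|i u IH]; rewrite ?word_nil// !word_cons IH. Qed.

Let words_span_fst p q x : words_span U p q x -> words_span S p q x.1.
Proof.
move=> h u v up vq; have [c hc] := h u v up vq; exists c.
by move: hc => /(congr1 fst); rewrite !wordU.
Qed.

(** The coefficients of [x.1] and of [x.2] are the two components of one scalar of the product,
    hence the same complex number. Its modulus is at most [|x.1|], and the coefficients bound
    [|x.2|]. *)
Let words_span_bound k x : words_span U k k x ->
  cnorm x.2 <= n%:R ^+ (k + k) * cnorm x.1.
Proof.
move=> h; apply: (cnorm_le_words cuntzT) => u v uk vk.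
have [c] := h u v uk vk; rewrite !wordU => hc.
have h1 : star (word S u) * x.1 * word S v = c *: 1 by case: hc.
have h2 : star (word T u) * x.2 * word T v = c *: 1 by case: hc.
rewrite h2 cnormZ cnorm1 -(cnorm1 A) -cnormZ -h1.
have ca w : cnorm (word S w) = 1.
  apply/eqP; rewrite -(@eqrXn2 _ 2) ?cnorm_ge0 ?ler01// expr1n.
  by rewrite -cnorm_star_mul (word_isometry cuntzS) cnorm1.
apply: le_trans (ler_cnormM _ _) _; rewrite ca mulr1.
by apply: le_trans (ler_cnormM _ _) _; rewrite cnorm_star ca mul1r.
Qed.

(** For a fixed [k] the span is stable under products and star, so all powers of [x^* x] obey the
    previous bound with one constant. *)
Let words_span_compare k x : words_span U k k x -> cnorm x.2 <= cnorm x.1.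
Proof.
move=> h; apply: (@cnorm_snd_le_fst _ _ _ _ (n%:R ^+ (k + k))) => m.
have hb : words_span U k k ((star x * x) ^+ m).
  elim: m => [|m IH]; last first.
    rewrite exprS; apply: (words_spanM cuntzU _ IH).
    by apply: (words_spanM cuntzU _ h); exact: words_span_star.
  have := @words_span_word _ _ _ _ cuntzU [::] [::]; rewrite !word_nil star1 mulr1.
  by move/(@words_span_raise _ _ _ _ cuntzU k _ _ _); rewrite addn0.
apply: le_trans (words_span_bound hb) _; apply: ler_wpM2r; first exact: cnorm_ge0.
by rewrite ler_peMr ?exprn_ge0// ler1n.
Qed.

Let gauge_degree_compare a b x : gauge_degree U a b x -> cnorm x.2 <= cnorm x.1.
Proof.
move=> [m hx]; rewrite -(@ler_sqr R) ?nnegrE ?cnorm_ge0// -!cnorm_star_mul.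
apply: (@words_span_compare (m + b) (star x * x)).
by apply: (words_spanM cuntzU _ hx); exact: words_span_star.
Qed.

Let gauge_finite_bound d x : gauge_finite U d x ->
  cnorm x.2 <= d.*2.+1%:R * cnorm x.1.
Proof.
move=> [y hy ->]; rewrite (raddf_sum snd) (raddf_sum fst).
apply: le_trans (ler_cnorm_sum _ _ _) _.
rewrite [leRHS](_ : _ = \sum_(k < d.*2.+1) cnorm (\sum_(k < d.*2.+1) (y k).1)); last first.
  by rewrite sumr_const card_ord mulr_natl.
apply: ler_sum => k _.
apply: le_trans (gauge_degree_compare (hy k)) _.
(* The hypothesis [2 <= n] supplies the two distinct letters of the marker word. *)
have i01 : Ordinal (ltnW n2) != Ordinal n2 by rewrite -val_eqE.
apply: (cnorm_gauge_component cuntzS i01 (d := d) (y := fun k => (y k).1)) => // j.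
by have [m hm] := hy j; exists m; exact: words_span_fst.
Qed.

Lemma gauge_finite_compare d x : gauge_finite U d x -> cnorm x.2 <= cnorm x.1.
Proof.
(* The m-th power of [x^* x] has [4 d m + 1] homogeneous components, and
   [4 d m + 1 <= (4 d + 1) (m + 1)]. *)
move=> h; apply: (@cnorm_snd_le_fst _ _ _ _ (4 * d).+1%:R) => m.
have hb : gauge_finite U (2 * d * m) ((star x * x) ^+ m).
  elim: m => [|m IH]; first by rewrite muln0; exact: gauge_finite1.
  rewrite exprS mulnS; apply: (gauge_finiteM cuntzU) IH.
  by rewrite mul2n -addnn; apply: (gauge_finiteM cuntzU) (h); exact: gauge_finite_star.
apply: le_trans (gauge_finite_bound hb) _; apply: ler_wpM2r; first exact: cnorm_ge0.
by rewrite -natrM ler_nat; lia.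
Qed.

End CuntzNormComparison.

(** * Universality *)

Section CStarClosure.
Context (R : realType) (A : cstarAlgType R).

Definition cstar_closure (G : set A) : set A :=
  [set a | forall e : R, 0 < e -> exists2 b, G b & cnorm (a - b) <= e].

Lemma sub_cstar_closure G : G `<=` cstar_closure G.
Proof. by move=> a Ga e e0; exists a; rewrite // subrr cnorm0 ltW. Qed.

Lemma cstar_closure_subalgebra (G : set A) : G 1 ->
  (forall (c : R[i]) a b, G a -> G b -> G (c *: a + b)) ->
  (forall a b, G a -> G b -> G (a * b)) ->
  (forall a, G a -> G (star a)) -> cstar_subalgebra (cstar_closure G).
Proof.
move=> G1 GZ GM Gs; split.
- exact: sub_cstar_closure.
- move=> c a b ha hb e e0; have e2 : 0 < e / 2 by rewrite divr_gt0.
  have c0 : 0 <= normc c by case: (c) => ? ? /=; exact: sqrtr_ge0.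
  have ec : 0 < e / 2 / (normc c + 1) by rewrite divr_gt0// ltr_wpDl.
  have [a' Ga a'e] := ha _ ec; have [b' Gb b'e] := hb _ e2.
  exists (c *: a' + b'); first exact: GZ.
  rewrite opprD addrACA -scalerBr; apply: le_trans (ler_cnormD _ _) _.
  rewrite cnormZ [leRHS](splitr e); apply: lerD => //.
  move: a'e; rewrite ler_pdivlMr ?ltr_wpDl//.
  have := cnorm_ge0 (a - a'); set t := cnorm _; nra.
- move=> a b ha hb e e0.
  have a0 := cnorm_ge0 a; have b0 := cnorm_ge0 b.
  (* With both errors at most [d <= 1], the product is off by at most [d |a| + d |b| + d^2 <= d (|a|
     + |b| + 1) <= e]. *)
  pose d := Num.min 1 (e / (cnorm a + cnorm b + 1)).
  have M0 : 0 < cnorm a + cnorm b + 1 by rewrite ltr_wpDl ?addr_ge0.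
  have d0 : 0 < d by rewrite lt_min ltr01 divr_gt0.
  have dM : d * (cnorm a + cnorm b + 1) <= e by rewrite -ler_pdivlMr// ge_min lexx orbT.
  have d1 : d <= 1 by rewrite ge_min lexx.
  have [a' Ga a'd] := ha _ d0; have [b' Gb b'd] := hb _ d0.
  exists (a' * b'); first exact: GM.
  have -> : a * b - a' * b' = a * (b - b') + (a - a') * b - (a - a') * (b - b').
    have E (x y : A) : a * b - (a - y) * (b - x) = a * x + y * b - y * x.
      by rewrite mulrBl !mulrBr !opprB addrCA [a * b + _]addrC subrK addrC addrA.
    by have := E (b - b') (a - a'); rewrite !subKr.
  apply: le_trans (ler_cnormD _ _) _; rewrite cnormN.
  apply: le_trans (lerD (ler_cnormD _ _) (lexx _)) _.
  have := ler_cnormM a (b - b'); have := ler_cnormM (a - a') b.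
  have := ler_cnormM (a - a') (b - b').
  have := cnorm_ge0 (a - a'); have := cnorm_ge0 (b - b').
  move: a'd b'd; set u := cnorm (a - a'); set v := cnorm (b - b').
  nra.
- move=> a ha e /ha[b Gb ab]; exists (star b); first exact: Gs.
  by rewrite -starB cnorm_star.
- move=> a ha e e0; have e2 : 0 < e / 2 by rewrite divr_gt0.
  have [b hb ab] := ha _ e2; have [c Gc bc] := hb _ e2; exists c => //.
  rewrite -(subrK b a) -addrA; apply: le_trans (ler_cnormD _ _) _.
  by rewrite (splitr e) lerD.
Qed.

End CStarClosure.

Section CuntzUniversality.
Context (R : realType) (A : cstarAlgType R) (n : nat) (S : 'I_n -> A).
Hypotheses (cuntzS : cuntz_family S) (n2 : (2 <= n)%N).
Hypothesis genS : cstar_generated (range S) = setT.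

(** The graph [G] of the morphism is the closure of the gauge-finite elements of the paired family.
    Since the second coordinate is dominated by the first on [G], the graph is single valued; the
    same domination makes its domain closed, so the domain is a C*-subalgebra that contains the
    generators. *)
Lemma cuntz_universal (B : cstarAlgType R) (T : 'I_n -> B) : cuntz_family T ->
  exists2 f : {lrmorphism A -> B}, star_morphism f & forall i, f (S i) = T i.
Proof.
move=> cuntzT; pose U i : A * B := (S i, T i).
have cuntzU : cuntz_family U by exact: cuntz_family_pair.
pose G : set (A * B)%type := cstar_closure [set x | exists d, gauge_finite U d x].
have [G1 GZ GM Gs Gc] : cstar_subalgebra G.
  apply: cstar_closure_subalgebra.
  - by exists 0%N; exact: gauge_finite1.
  - move=> c x y [d hx] [e hy]; exists (d + e)%N; apply: (gauge_finiteD cuntzU).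
      apply: gauge_finiteZ; rewrite -[x]mulr1; apply: (gauge_finiteM cuntzU hx).
      exact: gauge_finite1.
    by rewrite -[y]mul1r; apply: (gauge_finiteM cuntzU) hy; exact: gauge_finite1.
  - by move=> x y [d hx] [e hy]; exists (d + e)%N; exact: gauge_finiteM.
  - by move=> x [d hx]; exists d; exact: gauge_finite_star.
have Gle x : G x -> cnorm x.2 <= cnorm x.1.
  move=> hx; apply/ler_addgt0Pr => e e0; have e2 : 0 < e / 2 by rewrite divr_gt0.
  have [y [d hy]] := hx _ e2; rewrite ge_max => /andP[y1 y2].
  rewrite -(subrK y.2 x.2); apply: le_trans (ler_cnormD _ _) _.
  have := gauge_finite_compare cuntzS cuntzT n2 hy.
  have : cnorm y.1 <= cnorm x.1 + cnorm (x.1 - y.1).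
    rewrite -{1}(subKr x.1 y.1); apply: le_trans (ler_cnormD _ _) _.
    by rewrite cnormN.
  by move: y1 y2 => /=; lra.
have GB x y : G x -> G y -> G (x - y).
  by move=> hx hy; rewrite addrC -scaleN1r; exact: GZ.
have GU i : G (U i).
  by apply: sub_cstar_closure; exists 1%N; exact: gauge_finite_generator.
have total a : exists b, G (a, b).
  have : cstar_generated (range S) a by rewrite genS.
  move=> /(_ [set a | exists b, G (a, b)]); apply; split; last first.
    by move=> _ [i _ <-]; exists (T i); exact: GU.
  split.
  - by exists 1.
  - by move=> c x y [x' hx] [y' hy]; exists (c *: x' + y'); exact: GZ hx hy.
  - by move=> x y [x' hx] [y' hy]; exists (x' * y'); exact: GM hx hy.
  - by move=> x [x' hx]; exists (star x'); exact: Gs hx.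
  move=> {}a ha.
  have pos (k : nat) : 0 < k.+1%:R^-1 :> R by rewrite invr_gt0.
  have approx k : exists x : A * B, G x /\ cnorm (a - x.1) <= k.+1%:R^-1.
    by have [b [b' hb] ab] := ha _ (pos k); exists (b, b').
  have [u hu] := choice approx.
  have small e : 0 < e -> exists N : nat, forall k, (N <= k)%N -> k.+1%:R^-1 <= e :> R.
    move=> e0; exists (Num.bound e^-1) => k Nk.
    rewrite -[leRHS]invrK lef_pV2 ?posrE ?invr_gt0//; apply: ltW.
    apply: (lt_le_trans (archi_boundP _)); first by rewrite invr_ge0 ltW.
    by rewrite ler_nat (leq_trans Nk).
  (* Domination on [G] turns the convergence of the first coordinates into a Cauchy condition on the
     second ones. *)
  have [b hb] : exists b : B, forall e : R, 0 < e ->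
      exists N : nat, forall k, (N <= k)%N -> cnorm ((u k).2 - b) <= e.
    apply: cnorm_complete => e e0; have [N hN] := small _ (divr_gt0 e0 (ltr0Sn _ 1)).
    exists N => k l Nk Nl; have := Gle _ (GB _ _ (hu k).1 (hu l).1).
    move/le_trans; apply.
    have -> : (u k - u l).1 = (a - (u l).1) - (a - (u k).1).
      by rewrite opprB [RHS]addrC addrA subrK.
    apply: le_trans (ler_cnormD _ _) _; rewrite cnormN.
    by rewrite [leRHS]splitr lerD ?(le_trans (hu _).2) ?hN.
  exists b; apply: Gc => e e0; have [N hN] := small _ e0; have [M hM] := hb _ e0.
  exists (u (maxn N M)); first exact: (hu _).1.
  rewrite ge_max /= (le_trans (hu _).2) ?hN ?leq_maxl//=.
  by rewrite -opprB cnormN hM ?leq_maxr.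
have [f hf] := choice total.
have fE a b : G (a, b) -> f a = b.
  move=> hab; apply/eqP; rewrite -subr_eq0; apply/eqP/cnorm0_eq0/eqP.
  rewrite eq_le cnorm_ge0 andbT.
  by have := Gle _ (GB _ _ (hf a) hab); rewrite /= subrr cnorm0.
have fl : linear f by move=> c x y; apply: fE; exact: GZ (hf x) (hf y).
have fm : monoid_morphism f.
  by split=> [|x y]; apply: fE => //; exact: GM (hf x) (hf y).
pose lmix := GRing.isLinear.Build _ _ _ _ f fl.
pose mmix := GRing.isMonoidMorphism.Build _ _ f fm.
pose F : {lrmorphism A -> B} := HB.pack f lmix mmix.
exists F => [x|i]; apply: fE; first exact: Gs (hf x).
exact: GU.
Qed.

Lemma cuntz_algebra_of_generators : is_cuntz_algebra n A.
Proof. by exists S; split=> // B T; exact: cuntz_universal. Qed.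

End CuntzUniversality.

(** * Operators on Hilbert spaces *)

(** Polarization: the diagonal values at [x + y] and [i x + y] give [B x y + B y x = 0] and
    [B x y = B y x]. *)
Lemma sesquilinear_diag0 (R : realType) (H : lmodType R[i]) (B : H -> H -> R[i]) :
  (forall c x y z, B (c *: x + y) z = c * B x z + B y z) ->
  (forall c x y z, B z (c *: x + y) = conjc c * B z x + B z y) ->
  (forall x, B x x = 0) -> forall x y, B x y = 0.
Proof.
move=> Bl Br B0 x y.
have h1 : B x y + B y x = 0.
  have := B0 (1 *: x + y); rewrite Bl !Br !B0 !mulr0 rmorph1 !mul1r.
  by rewrite add0r addr0.
have ci : conjc 'i%C = - 'i%C :> R[i].
  by apply/eqP; rewrite eq_complex /= oppr0 !eqxx.
have h2 : 'i%C * (B x y - B y x) = 0.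
  have := B0 ('i%C *: x + y); rewrite Bl !Br !B0 !mulr0 add0r addr0 => <-.
  by rewrite ci mulrBr mulNr.
have i0 : 'i%C != 0 :> R[i] by rewrite eq_complex /= oner_eq0 andbF.
move/eqP: h2; rewrite mulf_eq0 (negbTE i0) subr_eq0 /= => /eqP h2.
move/eqP: h1; rewrite -h2 -mulr2n -mulr_natl mulf_eq0 pnatr_eq0 /=.
by move=> /eqP.
Qed.

Section HilbertSpace.
Context (R : realType) (H : lmodType R[i]) (ip : H -> H -> R[i]).

Record hilbert_space : Prop := HilbertSpace {
  ip_linear : forall c x y z, ip (c *: x + y) z = c * ip x z + ip y z ;
  ip_conj : forall x y, ip y x = conjc (ip x y) ;
  ip_ge0 : forall x, 0 <= complex.Re (ip x x) ;
  ip_eq0 : forall x, complex.Re (ip x x) = 0 -> x = 0 ;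
  hnorm_complete : forall u : nat -> H,
    (forall e : R, 0 < e -> exists N : nat, forall m n : nat,
       (N <= m)%N -> (N <= n)%N -> hnorm ip (u m - u n) <= e) ->
    exists l : H, forall e : R, 0 < e ->
      exists N : nat, forall n : nat, (N <= n)%N -> hnorm ip (u n - l) <= e }.

Hypothesis hH : hilbert_space.

Lemma ipDl x y z : ip (x + y) z = ip x z + ip y z.
Proof. by have := ip_linear hH 1 x y z; rewrite scale1r mul1r. Qed.

Lemma ip0l z : ip 0 z = 0.
Proof. by have /eqP := ipDl 0 0 z; rewrite addr0 eq_sym -subr_eq0 addrK => /eqP. Qed.

Lemma ipZl c x z : ip (c *: x) z = c * ip x z.
Proof. by rewrite -[c *: x]addr0 (ip_linear hH) ip0l addr0. Qed.

Lemma ipNl x z : ip (- x) z = - ip x z.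
Proof. by rewrite -scaleN1r ipZl mulN1r. Qed.

Lemma ipDr x y z : ip z (x + y) = ip z x + ip z y.
Proof. by rewrite (ip_conj hH) ipDl rmorphD/= -!(ip_conj hH). Qed.

Lemma ipZr c x z : ip z (c *: x) = conjc c * ip z x.
Proof. by rewrite (ip_conj hH) ipZl rmorphM/= -(ip_conj hH). Qed.

Lemma ipNr x z : ip z (- x) = - ip z x.
Proof. by rewrite (ip_conj hH) ipNl rmorphN/= -(ip_conj hH). Qed.

Lemma ipBl x y z : ip (x - y) z = ip x z - ip y z.
Proof. by rewrite ipDl ipNl. Qed.

Lemma ipBr x y z : ip z (x - y) = ip z x - ip z y.
Proof. by rewrite ipDr ipNr. Qed.

Lemma ip0r z : ip z 0 = 0.
Proof. by rewrite (ip_conj hH) ip0l rmorph0. Qed.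

Lemma ip_sumr (I : Type) (s : seq I) (F : I -> H) z :
  ip z (\sum_(i <- s) F i) = \sum_(i <- s) ip z (F i).
Proof. exact: (big_morph (ip z) (fun x y => ipDr x y z) (ip0r z)). Qed.

Lemma hnorm_ge0 x : 0 <= hnorm ip x.
Proof. exact: sqrtr_ge0. Qed.

Lemma hnorm_sqr x : hnorm ip x ^+ 2 = complex.Re (ip x x).
Proof. by rewrite sqr_sqrtr// (ip_ge0 hH). Qed.

Lemma ip_self x : ip x x = (hnorm ip x ^+ 2)%:C%C.
Proof.
rewrite hnorm_sqr; have := ip_conj hH x x; case: (ip x x) => a b [] /= eb.
by congr Complex; lra.
Qed.

Lemma hnorm0 : hnorm ip 0 = 0.
Proof. by rewrite /hnorm ip0l sqrtr0. Qed.

Lemma hnorm_eq0 x : hnorm ip x = 0 -> x = 0.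
Proof. by move=> x0; apply: (ip_eq0 hH); rewrite -hnorm_sqr x0 expr0n. Qed.

Lemma normc_sqr (z : R[i]) : z * conjc z = (normc z ^+ 2)%:C%C.
Proof.
case: z => a b; rewrite /= sqr_sqrtr ?addr_ge0 ?sqr_ge0//.
by congr Complex; ring.
Qed.

Lemma normc_ge0 (z : R[i]) : 0 <= normc z.
Proof. by case: z => a b /=; exact: sqrtr_ge0. Qed.

Lemma hnormZ c x : hnorm ip (c *: x) = normc c * hnorm ip x.
Proof.
apply/eqP; rewrite -(@eqrXn2 _ 2) ?mulr_ge0 ?hnorm_ge0 ?normc_ge0// exprMn !hnorm_sqr.
by rewrite ipZl ipZr mulrA normc_sqr; case: (ip x x) => a b /=; rewrite mul0r subr0.
Qed.

Lemma hnormN x : hnorm ip (- x) = hnorm ip x.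
Proof. by rewrite -scaleN1r hnormZ normcN normc1 mul1r. Qed.

(** Positivity at [t x - <x, y> y] with [t = |y|^2]; scaling [x] by [t] keeps the computation free
    of division. *)
Lemma cauchy_schwarz x y : normc (ip x y) <= hnorm ip x * hnorm ip y.
Proof.
have [y0|y0] := eqVneq y 0.
  by rewrite y0 (ip_conj hH) ip0l rmorph0 normc0 hnorm0 mulr0.
have ny0 : 0 < hnorm ip y.
  by rewrite lt_def hnorm_ge0 andbT; apply: contra_neq y0; exact: hnorm_eq0.
rewrite -(@ler_sqr R) ?nnegrE ?mulr_ge0 ?hnorm_ge0 ?normc_ge0// exprMn.
have t0 : 0 < hnorm ip y ^+ 2 by rewrite exprn_gt0.
move: (hnorm ip y ^+ 2) t0 (ip_self y) => t t0 ipyy.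
have E : ip (t%:C%C *: x - ip x y *: y) (t%:C%C *: x - ip x y *: y) =
    (t * (t * hnorm ip x ^+ 2 - normc (ip x y) ^+ 2))%:C%C.
  rewrite rmorphM/= rmorphB/= rmorphM/= -normc_sqr.
  rewrite ipBl !ipBr !ipZl !ipZr ipyy ip_self conjc_real (ip_conj hH x y).
  by ring.
have := ip_ge0 hH (t%:C%C *: x - ip x y *: y).
by rewrite E /= pmulr_rge0// subr_ge0 mulrC.
Qed.

Lemma ler_hnormD x y : hnorm ip (x + y) <= hnorm ip x + hnorm ip y.
Proof.
rewrite -(@ler_sqr R) ?nnegrE ?addr_ge0 ?hnorm_ge0// hnorm_sqr.
rewrite ipDl !ipDr (ip_conj hH x y) !ip_self.
have := cauchy_schwarz x y.
have : complex.Re (ip x y) <= normc (ip x y).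
  case: (ip x y) => a b /=; apply: le_trans (ler_norm a) _.
  by rewrite -sqrtr_sqr ler_wsqrtr// lerDl sqr_ge0.
by case: (ip x y) => a b /=; nra.
Qed.

Lemma ip_inj x y : (forall z, ip x z = ip y z) -> x = y.
Proof.
move=> h; apply/eqP; rewrite -subr_eq0; apply/eqP/(ip_eq0 hH).
by rewrite ipBl h subrr.
Qed.

Lemma adjoint_of_sym T T' : adjoint_of ip T T' -> adjoint_of ip T' T.
Proof. by move=> h x y; rewrite (ip_conj hH) -h -(ip_conj hH). Qed.

Lemma adjoint_of_uniq T T1 T2 :
  adjoint_of ip T T1 -> adjoint_of ip T T2 -> T1 = T2.
Proof.
move=> /adjoint_of_sym h1 /adjoint_of_sym h2; apply/funext => x.
by apply: ip_inj => z; rewrite h1 h2.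
Qed.

Lemma adjoint_of_linear T T' : adjoint_of ip T T' -> linear T'.
Proof.
move=> /adjoint_of_sym h c x y; apply: ip_inj => z.
by rewrite (ip_linear hH) !h (ip_linear hH).
Qed.

(** One has [|T' x|^2 = <T (T' x), x> <= M |T' x| |x|], to be divided by [|T' x|]. *)
Lemma adjoint_of_bound T T' M : 0 <= M ->
  (forall x, hnorm ip (T x) <= M * hnorm ip x) -> adjoint_of ip T T' ->
  forall x, hnorm ip (T' x) <= M * hnorm ip x.
Proof.
move=> M0 hT TT' x; have [->|n0] := eqVneq (hnorm ip (T' x)) 0.
  by rewrite mulr_ge0 ?hnorm_ge0.
have n_gt0 : 0 < hnorm ip (T' x) by rewrite lt_def n0 hnorm_ge0.
rewrite -(ler_pM2l n_gt0) -expr2 hnorm_sqr -TT'.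
apply: (@le_trans _ _ (normc (ip (T (T' x)) x))).
  case: (ip _ x) => a b /=; apply: le_trans (ler_norm a) _.
  by rewrite -sqrtr_sqr ler_wsqrtr// lerDl sqr_ge0.
apply: le_trans (cauchy_schwarz _ _) _.
by rewrite mulrA ler_wpM2r ?hnorm_ge0// mulrC hT.
Qed.

(* The adjoints of approximants of [T] form a Cauchy sequence, and their pointwise
   limit is an adjoint of [T]. *)
Lemma adjointable_limit T :
  (forall e : R, 0 < e -> exists2 S,
     exists S', adjoint_of ip S S' &
     forall x, hnorm ip (T x - S x) <= e * hnorm ip x) ->
  exists T', adjoint_of ip T T'.
Proof.
move=> hT.
have pos (k : nat) : 0 < k.+1%:R^-1 :> R by rewrite invr_gt0.
have approx k : exists SS : (H -> H) * (H -> H),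
    adjoint_of ip SS.1 SS.2 /\
    forall x, hnorm ip (T x - SS.1 x) <= k.+1%:R^-1 * hnorm ip x.
  by have [S [S' SS'] hS] := hT _ (pos k); exists (S, S').
have [u hu] := choice approx.
have small e : 0 < e -> exists N : nat, forall k, (N <= k)%N -> k.+1%:R^-1 <= e :> R.
  move=> e0; exists (Num.bound e^-1) => k Nk.
  rewrite -[leRHS]invrK lef_pV2 ?posrE ?invr_gt0//; apply: ltW.
  apply: (lt_le_trans (archi_boundP _)); first by rewrite invr_ge0 ltW.
  by rewrite ler_nat (leq_trans Nk).
have lim y : exists l, forall e : R, 0 < e -> exists N : nat, forall k, (N <= k)%N ->
    hnorm ip ((u k).2 y - l) <= e.
  apply: (hnorm_complete hH) => e e0.
  have y1 : 0 < hnorm ip y + 1 by rewrite ltr_wpDl ?hnorm_ge0.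
  have e2 : 0 < e / 2 / (hnorm ip y + 1) by rewrite !divr_gt0.
  have [N hN] := small _ e2; exists N => k l Nk Nl.
  pose c : R := k.+1%:R^-1 + l.+1%:R^-1.
  have c0 : 0 <= c by rewrite addr_ge0// ltW.
  have adj : adjoint_of ip (fun x => (u k).1 x - (u l).1 x)
      (fun x => (u k).2 x - (u l).2 x).
    by move=> x z; rewrite ipBl ipBr !(hu _).1.
  have bnd x : hnorm ip ((u k).1 x - (u l).1 x) <= c * hnorm ip x.
    have -> : (u k).1 x - (u l).1 x = (T x - (u l).1 x) - (T x - (u k).1 x).
      by rewrite opprB [RHS]addrC addrA subrK.
    apply: le_trans (ler_hnormD _ _) _; rewrite hnormN /c mulrDl addrC.
    by rewrite lerD ?(hu _).2.
  apply: le_trans (adjoint_of_bound c0 bnd adj y) _.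
  apply: (@le_trans _ _ (c * (hnorm ip y + 1))); first by rewrite ler_wpM2l// lerDl.
  rewrite -ler_pdivlMr//.
  have -> : e / (hnorm ip y + 1) = e / 2 / (hnorm ip y + 1) + e / 2 / (hnorm ip y + 1).
    by rewrite -mulrDl -splitr.
  by rewrite lerD ?hN.
have [T' hT'] := choice lim; exists T' => x y; apply/eqP; rewrite -subr_eq0.
apply/eqP/eq0_normc/eqP; rewrite eq_le normc_ge0 andbT.
apply/ler_addgt0Pr => e e0; rewrite add0r.
pose B := hnorm ip x * hnorm ip y + hnorm ip x + 1.
have B0 : 0 < B.
  by rewrite ltr_wpDl// addr_ge0 ?mulr_ge0 ?hnorm_ge0.
have [N hN] := small _ (divr_gt0 e0 B0); have [M hM] := hT' y _ (divr_gt0 e0 B0).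
pose k := maxn N M; have [adj bnd] := hu k.
have -> : ip (T x) y - ip x (T' y) = ip (T x - (u k).1 x) y + ip x ((u k).2 y - T' y).
  by rewrite ipBl ipBr adj addrA subrK.
apply: le_trans (le_normcD _ _) _.
have h1 := cauchy_schwarz (T x - (u k).1 x) y.
have h2 := cauchy_schwarz x ((u k).2 y - T' y).
have h3 := hM k (leq_maxr _ _).
have h4 : hnorm ip (T x - (u k).1 x) <= e / B * hnorm ip x.
  by apply: le_trans (bnd x) _; rewrite ler_wpM2r ?hnorm_ge0// hN ?leq_maxl.
have -> : e = e / B * B by rewrite divfK// gt_eqF.
have eB : 0 < e / B by rewrite divr_gt0.
have hx := hnorm_ge0 x; have hy := hnorm_ge0 y.
apply: (@le_trans _ _ (e / B * (hnorm ip x * hnorm ip y) + e / B * hnorm ip x)).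
  apply: lerD; first by apply: le_trans h1 _; rewrite mulrA ler_wpM2r.
  by apply: le_trans h2 _; rewrite mulrC ler_wpM2r.
by rewrite /B !mulrDr mulr1 lerDl ltW.
Qed.

Lemma adjoint_of_bounded T T' : bounded_operator ip T -> adjoint_of ip T T' ->
  bounded_operator ip T'.
Proof.
move=> [lT [M hM]] TT'; split; first exact: adjoint_of_linear TT'.
exists `|M|; apply: adjoint_of_bound TT' => // x; apply: le_trans (hM x) _.
by rewrite ler_wpM2r ?hnorm_ge0 ?ler_norm.
Qed.

(** Any family of adjointable bounded operators generates a subalgebra of this one, which is how
    adjoints come to exist throughout a generated algebra. *)
Lemma adjointable_algebra : operator_cstar_algebra ip
  [set T | bounded_operator ip T /\ exists T', adjoint_of ip T T'].
Proof.
split.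
- by move=> T [].
- split.
    split; last by exists (fun=> 0) => x y; rewrite ip0l ip0r.
    split=> [c x y|]; first by rewrite scaler0 addr0.
    by exists 0 => x; rewrite hnorm0 mul0r.
  move=> c S T [[lS [M hM]] [S' SS']] [[lT [N hN]] [T' TT']]; split.
    split=> [k x y|].
      by rewrite lS lT !scalerDr !scalerA [c * k]mulrC addrACA.
    exists (normc c * M + N) => x; apply: le_trans (ler_hnormD _ _) _.
    by rewrite hnormZ mulrDl -mulrA lerD// ler_wpM2l ?normc_ge0.
  exists (fun x => conjc c *: S' x + T' x) => x y.
  by rewrite (ip_linear hH) ipDr ipZr conjcK SS' TT'.
- move=> S T [[lS [M hM]] [S' SS']] [[lT [N hN]] [T' TT']]; split.
    split=> [k x y|]; first by rewrite /= lT lS.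
    exists (`|M| * N) => x /=; apply: le_trans (hM _) _; rewrite -mulrA.
    apply: (@le_trans _ _ (`|M| * hnorm ip (T x))).
      by rewrite ler_wpM2r ?hnorm_ge0 ?ler_norm.
    by rewrite ler_wpM2l.
  by exists (T' \o S') => x y /=; rewrite SS' TT'.
- move=> T T' [bT _] TT'; split; first exact: adjoint_of_bounded TT'.
  by exists T; exact: adjoint_of_sym.
- move=> T bT hT; split=> //; apply: adjointable_limit => e /hT[S [_ SS'] hS].
  by exists S.
Qed.

(** [smallest] is an intersection, and its elements are known to be bounded only once some member of
    the intersected family is exhibited; the algebra of adjointable operators is that member. *)
Lemma generated_algebra (G : set (H -> H)) :
  (forall T, G T -> bounded_operator ip T /\ exists T', adjoint_of ip T T') ->
  operator_cstar_algebra ip (operator_cstar_generated ip G) /\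
  (forall T, operator_cstar_generated ip G T -> exists T', adjoint_of ip T T').
Proof.
move=> hG.
have sub T : operator_cstar_generated ip G T ->
    bounded_operator ip T /\ exists T', adjoint_of ip T T'.
  by move=> hT; apply: (hT _ (conj adjointable_algebra hG)).
split=> [|T /sub[]//]; split.
- by move=> T /sub[].
- split=> [M [[_ [M0 _] _ _ _] _]//|c S T hS hT M hM].
  have [[_ [_ ML] _ _ _] _] := hM; apply: ML; [exact: hS hM|exact: hT hM].
- move=> S T hS hT M hM; have [[_ _ MM _ _] _] := hM.
  by apply: MM; [exact: hS hM|exact: hT hM].
- move=> T T' hT TT' M hM; have [[_ _ _ Ma _] _] := hM.
  exact: (Ma _ _ (hT _ hM) TT').
- move=> T bT hT M hM; have [[_ _ _ _ Mc] _] := hM; apply: Mc => // e /hT[S hS hST].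
  by exists S => //; exact: hS hM.
Qed.

End HilbertSpace.

(** * Operator algebras as abstract C*-algebras *)

Record concrete_cstar (R : realType) := ConcreteCStar {
  ccar : lmodType R[i] ;
  cip : ccar -> ccar -> R[i] ;
  cops : set (ccar -> ccar) ;
  chilbert : hilbert_space cip ;
  calgebra : operator_cstar_algebra cip cops ;
  cid1 : cops id ;
  cadj : forall T, cops T -> exists T', adjoint_of cip T T' ;
  cnontrivial : exists x : ccar, x <> 0
}.

Section ConcreteCStarAlgebra.
Context (R : realType) (D : concrete_cstar R).
Local Notation H := (ccar D).
Local Notation ip := (@cip R D).
Let hH : hilbert_space ip := chilbert D.

Definition cops_pred : {pred H -> H} := mem (@cops R D).

Lemma cops_submod_closed : submod_closed cops_pred.
Proof.
have [_ [h0 hl] _ _ _] := calgebra D.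
by split=> [|c S T]; rewrite !inE//; exact: hl.
Qed.

HB.instance Definition _ :=
  GRing.isSubmodClosed.Build _ _ cops_pred cops_submod_closed.

(** The type depends on the whole record [D], so that the structures declared on it can recover the
    Hilbert space axioms and the closure properties from the type itself. *)
Definition cop := {T : H -> H | T \in cops_pred}.
HB.instance Definition _ := SubType.on cop.
HB.instance Definition _ := Choice.on cop.
HB.instance Definition _ := [SubChoice_isSubLmodule of cop by <:].

Implicit Types a b c : cop.

Lemma copP a : cops (val a). Proof. by case: a => T /=; rewrite inE. Qed.

Lemma cop_linear a : linear (val a).
Proof. by have [sub _ _ _ _] := calgebra D; have [] := sub _ (copP a). Qed.

Lemma copD a x y : val a (x + y) = val a x + val a y.
Proof. by have := cop_linear a 1 x y; rewrite !scale1r. Qed.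

Lemma cop0 a : val a 0 = 0.
Proof. by have /eqP := copD a 0 0; rewrite addr0 eq_sym -subr_eq0 addrK => /eqP. Qed.

Lemma copZ a k x : val a (k *: x) = k *: val a x.
Proof. by have := cop_linear a k x 0; rewrite !addr0 cop0 addr0. Qed.

Definition mk_cop T (hT : cops T) : cop := Sub T (mem_set hT).

Lemma cop_mul_subproof a b : cops (val a \o val b).
Proof. by have [_ _ h _ _] := calgebra D; apply: h; exact: copP. Qed.

Definition cop_mul a b := mk_cop (cop_mul_subproof a b).
Definition cop_one := mk_cop (cid1 D).

Let valD a b x : val (a + b) x = val a x + val b x.
Proof. by []. Qed.
Let valZ k a x : val (k *: a) x = k *: val a x.
Proof. by []. Qed.

Let mulA : associative cop_mul.
Proof. by move=> a b c; apply: val_inj. Qed.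
Let mul1 : left_id cop_one cop_mul.
Proof. by move=> a; apply: val_inj. Qed.
Let mulr_1 : right_id cop_one cop_mul.
Proof. by move=> a; apply: val_inj. Qed.
Let mulDl : left_distributive cop_mul +%R.
Proof. by move=> a b c; apply: val_inj. Qed.
Let mulDr : right_distributive cop_mul +%R.
Proof. by move=> a b c; apply: val_inj; apply/funext => x; exact: copD. Qed.
Let one_neq0 : cop_one != 0.
Proof.
apply/eqP => /(congr1 val) h; have [x] := cnontrivial D; apply.
by have := congr1 (fun T => T x) h.
Qed.

HB.instance Definition _ := GRing.Zmodule_isNzRing.Build cop
  mulA mul1 mulr_1 mulDl mulDr one_neq0.

Let scaleAl (k : R[i]) a b : k *: (a * b) = k *: a * b.
Proof. exact: val_inj. Qed.

HB.instance Definition _ := GRing.Lmodule_isLalgebra.Build R[i] cop scaleAl.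

Let scaleAr (k : R[i]) a b : k *: (a * b) = a * (k *: b).
Proof. by apply: val_inj; apply/funext => x; exact/esym/copZ. Qed.

HB.instance Definition _ := GRing.Lalgebra_isAlgebra.Build R[i] cop scaleAr.

Lemma cop_star_subproof a : exists T, cops T /\ adjoint_of ip (val a) T.
Proof.
have [T hT] := cadj (copP a); exists T; split=> //.
by have [_ _ _ h _] := calgebra D; exact: h (copP a) hT.
Qed.

Definition cop_star a := mk_cop (projT2 (cid (cop_star_subproof a))).1.

Lemma cop_starP a : adjoint_of ip (val a) (val (cop_star a)).
Proof. exact: (projT2 (cid (cop_star_subproof a))).2. Qed.

Let star_eq a b : adjoint_of ip (val a) (val b) -> cop_star a = b.
Proof. by move=> h; apply: val_inj; exact: (adjoint_of_uniq hH (cop_starP a) h). Qed.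

Let cop_starD a b : cop_star (a + b) = cop_star a + cop_star b.
Proof.
by apply: star_eq => x y; rewrite !valD (ipDl hH) (ipDr hH) !cop_starP.
Qed.

Let cop_starZ k a : cop_star (k *: a) = conjc k *: cop_star a.
Proof.
by apply: star_eq => x y; rewrite !valZ (ipZl hH) (ipZr hH) conjcK !cop_starP.
Qed.

Let cop_starM a b : cop_star (a * b) = cop_star b * cop_star a.
Proof. by apply: star_eq => x y /=; rewrite !cop_starP. Qed.

Let cop_starK a : cop_star (cop_star a) = a.
Proof. by apply: star_eq; exact: (adjoint_of_sym hH (cop_starP a)). Qed.

Let op_bounds a : set R :=
  [set k | 0 <= k /\ forall x, hnorm ip (val a x) <= k * hnorm ip x].

Definition cop_norm a : R := inf (op_bounds a).

Let op_bounds_neq0 a : op_bounds a !=set0.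
Proof.
have [sub _ _ _ _] := calgebra D; have [_ [M hM]] := sub _ (copP a).
exists `|M|; split=> // x; apply: le_trans (hM x) _.
by rewrite ler_wpM2r ?hnorm_ge0// ler_norm.
Qed.

Let op_bounds_lb a : lbound (op_bounds a) 0.
Proof. by move=> k []. Qed.

Lemma cop_norm_ge0 a : 0 <= cop_norm a.
Proof. by apply: lb_le_inf => //; exact: op_bounds_lb. Qed.

Lemma cop_norm_le a k : 0 <= k ->
  (forall x, hnorm ip (val a x) <= k * hnorm ip x) -> cop_norm a <= k.
Proof. by move=> k0 hk; apply: ge_inf; [exists 0; exact: op_bounds_lb|split]. Qed.

Lemma cop_normP a x : hnorm ip (val a x) <= cop_norm a * hnorm ip x.
Proof.
have [x0|x0] := eqVneq (hnorm ip x) 0.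
  by rewrite (hnorm_eq0 hH x0) cop0 hnorm0// mulr0.
have x_gt0 : 0 < hnorm ip x by rewrite lt_def x0 hnorm_ge0.
rewrite -ler_pdivrMr//; apply: lb_le_inf => // k [_ hk].
by rewrite ler_pdivrMr.
Qed.

Let cop_norm0_eq0 a : cop_norm a = 0 -> a = 0.
Proof.
move=> a0; apply: val_inj; apply/funext => x; apply: (hnorm_eq0 hH); apply/eqP.
by rewrite eq_le hnorm_ge0 andbT; have := cop_normP a x; rewrite a0 mul0r.
Qed.

Let ler_cop_normD a b : cop_norm (a + b) <= cop_norm a + cop_norm b.
Proof.
apply: cop_norm_le => [|x]; first by rewrite addr_ge0 ?cop_norm_ge0.
by apply: le_trans (ler_hnormD hH _ _) _; rewrite mulrDl lerD ?cop_normP.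
Qed.

Let cop_normZ k a : cop_norm (k *: a) = normc k * cop_norm a.
Proof.
have le j b : cop_norm (j *: b) <= normc j * cop_norm b.
  apply: cop_norm_le => [|x]; first by rewrite mulr_ge0 ?cop_norm_ge0 ?normc_ge0.
  by rewrite valZ (hnormZ hH) -mulrA ler_wpM2l ?normc_ge0 ?cop_normP.
apply/eqP; rewrite eq_le le /=; have [->|k0] := eqVneq k 0.
  by rewrite normc0 mul0r cop_norm_ge0.
have nk0 : 0 < normc k.
  by rewrite lt_def normc_ge0 andbT; apply: contra_neq k0; exact: eq0_normc.
rewrite -ler_pdivlMl// -normcV.
by apply: le_trans (le k^-1 (k *: a)); rewrite scalerA mulVf// scale1r.
Qed.

Let ler_cop_normM a b : cop_norm (a * b) <= cop_norm a * cop_norm b.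
Proof.
apply: cop_norm_le => [|x]; first by rewrite mulr_ge0 ?cop_norm_ge0.
apply: le_trans (cop_normP a (val b x)) _.
by rewrite -mulrA ler_wpM2l ?cop_norm_ge0 ?cop_normP.
Qed.

(** The nontrivial inequality is [|a x|^2 = <x, a^* a x> <= |a^* a| |x|^2]. *)
Let cop_norm_star_mul a : cop_norm (cop_star a * a) = cop_norm a ^+ 2.
Proof.
apply/eqP; rewrite eq_le; apply/andP; split.
  apply: le_trans (ler_cop_normM _ _) _; rewrite expr2 ler_wpM2r ?cop_norm_ge0//.
  apply: cop_norm_le (cop_norm_ge0 _) _ => x.
  exact: (adjoint_of_bound hH (cop_norm_ge0 a) (cop_normP a) (cop_starP a)).
rewrite -(@sqr_sqrtr _ (cop_norm (cop_star a * a))) ?cop_norm_ge0//.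
rewrite lerXn2r ?nnegrE ?cop_norm_ge0 ?sqrtr_ge0//.
apply: cop_norm_le => [|x]; first exact: sqrtr_ge0.
rewrite -(@ler_sqr R) ?nnegrE ?mulr_ge0 ?hnorm_ge0 ?sqrtr_ge0// exprMn.
rewrite (sqr_sqrtr (cop_norm_ge0 _)) (hnorm_sqr hH (val a x)) cop_starP.
apply: (@le_trans _ _ (normc (ip x (val (cop_star a * a) x)))).
  rewrite /=; case: (ip _ _) => p q /=; apply: le_trans (ler_norm p) _.
  by rewrite -sqrtr_sqr ler_wsqrtr// lerDl sqr_ge0.
apply: le_trans (cauchy_schwarz hH _ _) _.
by rewrite expr2 mulrCA ler_wpM2l ?hnorm_ge0 ?cop_normP.
Qed.

(** Completeness of the space gives a pointwise limit [T]. Letting one index tend to infinity in the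
    Cauchy estimate shows that the convergence holds in operator norm, and the algebra is closed for
    that norm. *)
Let cop_norm_complete (u : nat -> cop) :
  (forall e : R, 0 < e -> exists N : nat, forall m n : nat,
     (N <= m)%N -> (N <= n)%N -> cop_norm (u m - u n) <= e) ->
  exists l : cop, forall e : R, 0 < e ->
    exists N : nat, forall n : nat, (N <= n)%N -> cop_norm (u n - l) <= e.
Proof.
move=> cu.
have ptw x : exists l, forall e : R, 0 < e -> exists N : nat, forall k, (N <= k)%N ->
    hnorm ip (val (u k) x - l) <= e.
  apply: (hnorm_complete hH) => e e0.
  have x1 : 0 < hnorm ip x + 1 by rewrite ltr_wpDl ?hnorm_ge0.
  have [N hN] := cu _ (divr_gt0 e0 x1); exists N => m n Nm Nn.
  apply: le_trans (cop_normP (u m - u n) x) _.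
  apply: (@le_trans _ _ (e / (hnorm ip x + 1) * (hnorm ip x + 1))).
    by rewrite ler_pM ?cop_norm_ge0 ?hnorm_ge0 ?hN// lerDl.
  by rewrite divfK// gt_eqF.
have [T hT] := choice ptw.
have unif (e : R) : 0 < e -> exists N : nat, forall n, (N <= n)%N ->
    forall x, hnorm ip (val (u n) x - T x) <= e * hnorm ip x.
  move=> e0; have [N hN] := cu _ e0; exists N => n Nn x.
  apply/ler_addgt0Pr => d d0; have [M hM] := hT x _ d0.
  pose m := maxn N M.
  have -> : val (u n) x - T x = (val (u n) x - val (u m) x) + (val (u m) x - T x).
    by rewrite addrA subrK.
  apply: le_trans (ler_hnormD hH _ _) _; rewrite lerD ?hM ?leq_maxr//.
  apply: le_trans (cop_normP (u n - u m) x) _.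
  by rewrite ler_wpM2r ?hnorm_ge0// hN ?leq_maxl.
have Tlin : linear T.
  move=> c x y; apply/eqP; rewrite -subr_eq0; apply/eqP/(hnorm_eq0 hH)/eqP.
  rewrite eq_le hnorm_ge0 andbT; apply/ler_addgt0Pr => e e0; rewrite add0r.
  (* The three approximation errors add up to [e / B * (B - 1)]; the last summand 1 makes [B]
     positive. *)
  pose B := hnorm ip (c *: x + y) + normc c * hnorm ip x + hnorm ip y + 1.
  have B0 : 0 < B.
    by rewrite ltr_wpDl// !addr_ge0 ?mulr_ge0 ?hnorm_ge0 ?normc_ge0.
  have [N hN] := unif _ (divr_gt0 e0 B0); have {}hN := hN N (leqnn N).
  have -> : T (c *: x + y) - (c *: T x + T y) =
      c *: (val (u N) x - T x) + (val (u N) y - T y)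
      - (val (u N) (c *: x + y) - T (c *: x + y)).
    by rewrite cop_linear scalerBr addrACA -opprD opprB [RHS]addrC addrA subrK.
  apply: le_trans (ler_hnormD hH _ _) _; rewrite (hnormN hH).
  apply: le_trans (lerD (ler_hnormD hH _ _) (lexx _)) _; rewrite (hnormZ hH).
  apply: (@le_trans _ _ (e / B * (B - 1))).
    have -> : e / B * (B - 1) = normc c * (e / B * hnorm ip x) +
        e / B * hnorm ip y + e / B * hnorm ip (c *: x + y).
      by move: (e / B) => t; rewrite /B; ring.
    by rewrite !lerD ?hN// ler_wpM2l ?normc_ge0.
  rewrite -[leRHS](divfK (lt0r_neq0 B0)) ler_wpM2l//.
    by rewrite ltW ?divr_gt0.
  by rewrite gerBl.
have Tbd : bounded_operator ip T.
  split=> //; have [N hN] := unif 1 ltr01; exists (1 + cop_norm (u N)) => x.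
  have -> : T x = val (u N) x - (val (u N) x - T x) by rewrite subKr.
  apply: le_trans (ler_hnormD hH _ _) _; rewrite (hnormN hH) mulrDl addrC.
  by rewrite lerD ?hN ?cop_normP.
have hTA : cops T.
  have [_ _ _ _ h] := calgebra D; apply: h Tbd _ => e e0.
  have [N hN] := unif _ e0; exists (val (u N)); first exact: copP.
  by move=> x; rewrite -(hnormN hH) opprB hN.
exists (mk_cop hTA) => e e0; have [N hN] := unif _ e0; exists N => n Nn.
by apply: cop_norm_le (ltW e0) _ => x; exact: hN.
Qed.

HB.instance Definition _ := isCStar.Build R cop cop_starD cop_starZ cop_starM
  cop_starK cop_norm0_eq0 ler_cop_normD cop_normZ ler_cop_normM
  cop_norm_star_mul cop_norm_complete.

Lemma cop_isomorphic : cstar_isomorphic ip (cop : cstarAlgType R) (@cops R D).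
Proof.
exists (fun a => val a); split=> //; last by move=> a; exact: cop_starP.
split; first exact: val_inj.
apply/seteqP; split=> [_ [a _ <-]|T hT]; first exact: copP.
by exists (mk_cop hT).
Qed.

End ConcreteCStarAlgebra.

(** * The space L2 *)

Lemma normc_sqrE (R : rcfType) (z : R[i]) :
  normc z ^+ 2 = complex.Re z ^+ 2 + complex.Im z ^+ 2.
Proof. by case: z => a b /=; rewrite sqr_sqrtr// addr_ge0// sqr_ge0. Qed.

Section SquareIntegrable.
Context d (T : measurableType d) (R : realType) (mu : {measure set T -> \bar R}).
Implicit Types f g : T -> R[i]^o.

(** The inner product on functions instead of classes: representatives can then be exchanged almost
    everywhere, by [pairing_ae]. *)
Definition pairing f g : R[i] :=
  let h t := f t * conjc (g t) in
  Complex (\int[mu]_t complex.Re (h t)) (\int[mu]_t complex.Im (h t)).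

Let Re_conj (z w : R[i]) : complex.Re (z * conjc w) =
  complex.Re z * complex.Re w + complex.Im z * complex.Im w.
Proof. by case: z w => a b [p q] /=; ring. Qed.

Let Im_conj (z w : R[i]) : complex.Im (z * conjc w) =
  complex.Im z * complex.Re w - complex.Re z * complex.Im w.
Proof. by case: z w => a b [p q] /=; ring. Qed.

Lemma measurable_normc_sqr f :
  measurable_fun setT (fun x => complex.Re (f x)) ->
  measurable_fun setT (fun x => complex.Im (f x)) ->
  measurable_fun setT (fun x => normc (f x) ^+ 2 : R).
Proof.
move=> mr mi; under eq_fun do rewrite normc_sqrE.
by apply: measurable_funD; apply: measurable_funX.
Qed.

Let measurable_Re_conj f g : square_integrable mu f -> square_integrable mu g ->
  measurable_fun setT (fun x => complex.Re (f x * conjc (g x))).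
Proof.
move=> [fr fi _] [gr gi _]; under eq_fun do rewrite Re_conj.
by apply: measurable_funD; apply: measurable_funM.
Qed.

Let measurable_Im_conj f g : square_integrable mu f -> square_integrable mu g ->
  measurable_fun setT (fun x => complex.Im (f x * conjc (g x))).
Proof.
move=> [fr fi _] [gr gi _]; under eq_fun do rewrite Im_conj.
by apply: measurable_funB; apply: measurable_funM.
Qed.

Lemma integrable_normc_sqr f : square_integrable mu f ->
  mu.-integrable setT (EFin \o (fun x => normc (f x) ^+ 2 : R)).
Proof.
move=> [fr fi foo]; apply/integrableP; split.
  exact/measurable_EFinP/measurable_normc_sqr.
apply: le_lt_trans foo; rewrite le_eqVlt; apply/orP; left; apply/eqP.
by apply: eq_integral => x _ /=; rewrite ger0_norm ?sqr_ge0.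
Qed.

Let dominated f g (h : T -> R) : square_integrable mu f -> square_integrable mu g ->
  measurable_fun setT h ->
  (forall x, `|h x| <= normc (f x) ^+ 2 + normc (g x) ^+ 2) ->
  mu.-integrable setT (EFin \o h).
Proof.
move=> sf sg mh hle.
have := integrableD measurableT (integrable_normc_sqr sf) (integrable_normc_sqr sg).
apply: le_integrable => //; first exact/measurable_EFinP.
by move=> x _ /=; rewrite lee_fin; apply: le_trans (hle x) _; exact: ler_norm.
Qed.

Lemma integrable_Re_conj f g : square_integrable mu f -> square_integrable mu g ->
  mu.-integrable setT (EFin \o (fun x => complex.Re (f x * conjc (g x)))).
Proof.
move=> sf sg; apply: (dominated sf sg); first exact: measurable_Re_conj.
move=> x; rewrite Re_conj !normc_sqrE; case: (f x) (g x) => a b [p q] /=.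
have := sqr_ge0 (a + p); have := sqr_ge0 (a - p); have := sqr_ge0 (b + q).
have := sqr_ge0 (b - q); have := sqr_ge0 a; have := sqr_ge0 b.
have := sqr_ge0 p; have := sqr_ge0 q.
by move=> *; rewrite ler_norml; apply/andP; split; nra.
Qed.

Lemma integrable_Im_conj f g : square_integrable mu f -> square_integrable mu g ->
  mu.-integrable setT (EFin \o (fun x => complex.Im (f x * conjc (g x)))).
Proof.
move=> sf sg; apply: (dominated sf sg); first exact: measurable_Im_conj.
move=> x; rewrite Im_conj !normc_sqrE; case: (f x) (g x) => a b [p q] /=.
have := sqr_ge0 (b + p); have := sqr_ge0 (b - p); have := sqr_ge0 (a + q).
have := sqr_ge0 (a - q); have := sqr_ge0 a; have := sqr_ge0 b.
have := sqr_ge0 p; have := sqr_ge0 q.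
by move=> *; rewrite ler_norml; apply/andP; split; nra.
Qed.

Lemma pairing_ae f f' g g' :
  square_integrable mu f -> square_integrable mu f' ->
  square_integrable mu g -> square_integrable mu g' ->
  {ae mu, forall x, f x = f' x} -> {ae mu, forall x, g x = g' x} ->
  pairing f g = pairing f' g'.
Proof.
move=> sf sf' sg sg' ff' gg'; rewrite /pairing.
congr Complex; rewrite /Rintegral; congr fine; apply: ae_eq_integral => //.
- exact/measurable_EFinP/measurable_Re_conj.
- exact/measurable_EFinP/measurable_Re_conj.
- by apply: filterS2 ff' gg' => x -> ->.
- exact/measurable_EFinP/measurable_Im_conj.
- exact/measurable_EFinP/measurable_Im_conj.
- by apply: filterS2 ff' gg' => x -> ->.
Qed.

Lemma pairing_linear c f g h : square_integrable mu f -> square_integrable mu g ->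
  square_integrable mu h ->
  pairing (fun x => c * f x + g x) h = c * pairing f h + pairing g h.
Proof.
move=> sf sg sh; have fr := integrable_Re_conj sf sh; have fi := integrable_Im_conj sf sh.
have gr := integrable_Re_conj sg sh; have gi := integrable_Im_conj sg sh.
case: c => a b; rewrite /pairing; apply/eqP; rewrite eq_complex /=.
have Zi k (u : T -> R) : mu.-integrable setT (EFin \o u) ->
    mu.-integrable setT (EFin \o (fun x => k * u x)).
  by move=> iu; exact: (@integrableZl _ _ _ mu setT measurableT k (EFin \o u) iu).
have Bi (u v : T -> R) : mu.-integrable setT (EFin \o u) ->
    mu.-integrable setT (EFin \o v) ->
    mu.-integrable setT (EFin \o (fun x => u x - v x)).
  by move=> iu iv; exact: (@integrableB _ _ _ mu setT measurableT (EFin \o u) (EFin \o v)).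
have Di (u v : T -> R) : mu.-integrable setT (EFin \o u) ->
    mu.-integrable setT (EFin \o v) ->
    mu.-integrable setT (EFin \o (fun x => u x + v x)).
  by move=> iu iv; exact: (@integrableD _ _ _ mu setT measurableT (EFin \o u) (EFin \o v)).
apply/andP; split; apply/eqP.
  rewrite -!RintegralZl// -RintegralB ?RintegralZl//; [|exact: Zi..].
  rewrite -RintegralD//; last by apply: Bi; exact: Zi.
  apply: eq_Rintegral => x _; case: (f x) (g x) (h x) => ? ? [? ?] [? ?] /=; ring.
rewrite -!RintegralZl// -RintegralD//; [|exact: Zi..].
rewrite -RintegralD//; last by apply: Di; exact: Zi.
by apply: eq_Rintegral => x _; case: (f x) (g x) (h x) => ? ? [? ?] [? ?] /=; ring.
Qed.

Lemma pairing_conj f g : square_integrable mu f -> square_integrable mu g ->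
  pairing g f = conjc (pairing f g).
Proof.
move=> sf sg; rewrite /pairing /=; congr Complex.
  by apply: eq_Rintegral => x _; case: (f x) (g x) => ? ? [? ?] /=; ring.
rewrite -mulN1r -RintegralZl//; last exact: integrable_Im_conj.
by apply: eq_Rintegral => x _; case: (f x) (g x) => ? ? [? ?] /=; ring.
Qed.

Lemma pairing_self f : square_integrable mu f ->
  (complex.Re (pairing f f))%:E = (\int[mu]_x (normc (f x) ^+ 2)%:E)%E.
Proof.
move=> sf; rewrite /pairing /= /Rintegral fineK; last first.
  exact/integrable_fin_num/integrable_Re_conj.
by apply: eq_integral => x _; rewrite Re_conj normc_sqrE !expr2.
Qed.

End SquareIntegrable.

Section L2Space.
Context d (T : measurableType d) (R : realType) (mu : {measure set T -> \bar R}).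
Local Notation L2 := (L2 mu).
Local Open Scope quotient_scope.
Implicit Types (x y z : L2) (f g : T -> R[i]).

Lemma L2_reprP x : square_integrable mu (L2_repr x).
Proof. by have := valP (repr x); rewrite inE. Qed.

Lemma L2_class_repr f : square_integrable mu f ->
  {ae mu, forall t, L2_repr (L2_class mu f) t = f t}.
Proof.
move=> sf; rewrite /L2_class; case: insubP => [u _ uf|/negP[]]; last by rewrite inE.
have : repr (\pi_L2 u) - u \in @ae_null _ _ _ mu by apply/eq_pi_L2; rewrite reprK.
rewrite inE /= /L2_repr -uf; apply: filterS => t h.
by apply/eqP; rewrite -subr_eq0; apply/eqP; exact: h.
Qed.

Lemma L2_eqP x y : x = y <-> {ae mu, forall t, L2_repr x t = L2_repr y t}.
Proof.
split=> [->|xy]; first exact: nearW.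
rewrite -[x]reprK -[y]reprK; apply/eq_pi_L2; rewrite inE.
apply: filterS xy => t; rewrite /L2_repr => xyt.
by apply/eqP; rewrite subr_eq0; apply/eqP.
Qed.

Lemma L2_repr_linear c x y :
  {ae mu, forall t, L2_repr (c *: x + y) t = c * L2_repr x t + L2_repr y t}.
Proof.
have : repr (c *: x + y) - (c *: repr x + repr y) \in @ae_null _ _ _ mu.
  apply/eq_pi_L2; rewrite reprK pi_L2D reprK; congr (_ + _).

rewrite inE /=; apply: filterS => t h.
by apply/eqP; rewrite -subr_eq0; apply/eqP; exact: h.
Qed.

Lemma square_integrable_linear c f g :
  square_integrable mu f -> square_integrable mu g ->
  square_integrable mu (fun t => c * f t + g t).
Proof.
move=> sf sg; have [_ h] := sqint_submod_closed mu.
by have := h c (f : T -> R[i]^o) g; rewrite !inE; apply.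
Qed.

Lemma L2_repr0 : {ae mu, forall t, L2_repr (0 : L2) t = 0}.
Proof.
have := L2_repr_linear (-1) 0 0; rewrite scaler0 addr0.
by apply: filterS => t ->; rewrite mulN1r addNr.
Qed.

Lemma L2_ipE x y : L2_ip mu x y = pairing mu (L2_repr x) (L2_repr y).
Proof. by []. Qed.

Lemma L2_ip_class f g : square_integrable mu f -> square_integrable mu g ->
  L2_ip mu (L2_class mu f) (L2_class mu g) = pairing mu f g.
Proof.
move=> sf sg; rewrite L2_ipE; apply: pairing_ae => //; try exact: L2_reprP.
  exact: L2_class_repr.
exact: L2_class_repr.
Qed.

Lemma L2_normE x :
  (complex.Re (L2_ip mu x x))%:E = (\int[mu]_t (normc (L2_repr x t) ^+ 2)%:E)%E.
Proof. by rewrite L2_ipE pairing_self//; exact: L2_reprP. Qed.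

Lemma L2_norm_class f : square_integrable mu f ->
  (complex.Re (L2_ip mu (L2_class mu f) (L2_class mu f)))%:E =
  (\int[mu]_t (normc (f t) ^+ 2)%:E)%E.
Proof. by move=> sf; rewrite L2_ip_class// pairing_self. Qed.

Lemma L2_ip_linear c x y z :
  L2_ip mu (c *: x + y) z = c * L2_ip mu x z + L2_ip mu y z.
Proof.
rewrite !L2_ipE -pairing_linear; try exact: L2_reprP.
apply: pairing_ae; try exact: L2_reprP.
- by apply: square_integrable_linear; exact: L2_reprP.
- exact: L2_repr_linear.
- exact: nearW.
Qed.

Lemma L2_ip_conj x y : L2_ip mu y x = conjc (L2_ip mu x y).
Proof. by rewrite !L2_ipE; apply: pairing_conj; exact: L2_reprP. Qed.

Lemma L2_ip_ge0 x : 0 <= complex.Re (L2_ip mu x x).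
Proof.
rewrite -lee_fin L2_normE; apply: integral_ge0 => t _.
by rewrite lee_fin sqr_ge0.
Qed.

Lemma L2_ip_eq0 x : complex.Re (L2_ip mu x x) = 0 -> x = 0.
Proof.
move=> x0; apply/L2_eqP; have [xr xi _] := L2_reprP x.
have mx : measurable_fun setT (EFin \o (fun t => normc (L2_repr x t) ^+ 2 : R)).
  exact/measurable_EFinP/measurable_normc_sqr.
have : ae_eq mu setT (EFin \o (fun t => normc (L2_repr x t) ^+ 2 : R)) (cst 0%E).
  apply/(ae_eq_integral_abs mu measurableT mx).
  rewrite -[RHS]/(0%:E) -x0 L2_normE; apply: eq_integral => t _ /=.
  by rewrite ger0_norm ?sqr_ge0.
move=> h; apply: filterS2 h L2_repr0 => t /(_ I) /= [] /eqP.
by rewrite expf_eq0 /= => /eqP/eq0_normc -> ->.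
Qed.

End L2Space.

(** * Completeness of L2 *)

Lemma cvgn_of_summable_steps (R : realType) (a b : nat -> R) :
  (forall k, `|a k.+1 - a k| <= b k) ->
  (\sum_(k <oo) (b k)%:E < +oo)%E -> cvgn a.
Proof.
move=> ab boo.
have b0 k : 0 <= b k by apply: le_trans (ab k).
have -> : a = (fun n => a 0%N + series (telescope a) n).
  by apply/funext => n; rewrite -eq_sum_telescope.
apply: is_cvgD; first exact: is_cvg_cst.
apply: normed_cvg; apply: nondecreasing_is_cvgn.
  by apply: nondecreasing_series => k _ _ /=.
have s0 : (0 <= \sum_(k <oo) (b k)%:E)%E.
  by apply: nneseries_ge0 => k _ _; rewrite lee_fin.
exists (fine (\sum_(k <oo) (b k)%:E)%E) => _ [n _ <-].
rewrite -lee_fin fineK; last by rewrite ge0_fin_numE.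
apply: le_trans (nneseries_lim_ge n _); last by move=> k _ _; rewrite lee_fin.
rewrite /series /= -sumEFin; apply: lee_sum => k _.
by rewrite lee_fin; exact: ab.
Qed.

Section L2Complete.
Context d (T : measurableType d) (R : realType) (mu : {measure set T -> \bar R}).
Hypothesis mufin : (mu setT < +oo)%E.
Local Notation L2 := (L2 mu).
Local Notation nrm := (hnorm (L2_ip mu)).

Let fatou_bound (h : nat -> T -> R) (H : T -> R) (c : \bar R) :
  (forall n, measurable_fun setT (h n)) -> (forall n t, 0 <= h n t) ->
  (forall t, (h ^~ t) @ \oo --> H t) ->
  (forall n, (\int[mu]_t (h n t)%:E <= c)%E) -> (\int[mu]_t (H t)%:E <= c)%E.
Proof.
move=> mh h0 hH hc.
have mh' n : measurable_fun setT (fun t => (h n t)%:E).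
  exact/measurable_EFinP.
have := @fatou _ _ _ mu setT measurableT _ mh' (fun n t _ => h0 n t).
have -> : (\int[mu]_t limn_einf (fun n => (h n t)%:E) = \int[mu]_t (H t)%:E)%E.
  apply: eq_integral => t _.
  have /cvg_limn_einf_sup[-> _]// : (fun n => (h n t)%:E) @ \oo --> (H t)%:E.
  by apply: cvg_EFin; [exact: nearW|exact: hH].
move/le_trans; apply; apply: le_trans (limn_einf_sup _) _.
rewrite limn_esup_lim; apply: lime_le; first exact: is_cvg_esups.
by apply: nearW => n; apply: ub_ereal_sup => _ [k _ <-]; exact: hc.
Qed.

Let measurable_dist (f g : T -> R[i]) :
  measurable_fun setT (fun t => complex.Re (f t)) ->
  measurable_fun setT (fun t => complex.Im (f t)) ->
  measurable_fun setT (fun t => complex.Re (g t)) ->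
  measurable_fun setT (fun t => complex.Im (g t)) ->
  measurable_fun setT (fun t => (normc (f t - g t) ^+ 2)%:E).
Proof.
move=> fr fi gr gi; apply/measurable_EFinP/measurable_normc_sqr.
  rewrite (_ : (fun t => _) = (fun t => complex.Re (f t) - complex.Re (g t))).
    exact: measurable_funB.
  by apply/funext => t; case: (f t) (g t) => ? ? [].
rewrite (_ : (fun t => _) = (fun t => complex.Im (f t) - complex.Im (g t))).
  exact: measurable_funB.
by apply/funext => t; case: (f t) (g t) => ? ? [].
Qed.

Let measurable_vanish (E : set T) (h : T -> R) : measurable E ->
  measurable_fun setT h -> measurable_fun setT (fun t => if t \in E then 0 else h t).
Proof.
move=> mE mh; apply: measurable_fun_ifT => //; apply: (measurable_fun_bool true).
rewrite setTI (_ : _ @^-1` _ = E)//.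
by apply/seteqP; split=> t; [exact: set_mem|exact: mem_set].
Qed.

Let half_sum : (\sum_(k <oo) ((1 / 2) ^+ k.+1)%:E <= 1%:E :> \bar R)%E.
Proof.
apply: le_trans (@epsilon_trick0 R 1 xpredT ler01); apply: lee_nneseries => k _.
  by move=> _; rewrite lee_fin exprn_ge0.
by rewrite lee_fin expr_div_n expr1n natrX.
Qed.

(* On a finite measure space an L2-bound [4^-k] on the steps gives an L1-bound
   of order [2^-k], by [s <= 2^k s^2 + 2^-k]; so the steps are summable a.e. *)
Let summable_steps (f : nat -> T -> R[i]) :
  (forall k, square_integrable mu (f k)) ->
  (forall k, (\int[mu]_t (normc (f k.+1 t - f k t) ^+ 2)%:E <= ((1 / 4) ^+ k.+1)%:E)%E) ->
  {ae mu, forall t, (\sum_(k <oo) (normc (f k.+1 t - f k t))%:E < +oo)%E}.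
Proof.
move=> sf hf; pose s k t : R := normc (f k.+1 t - f k t).
have s0 k t : 0 <= s k t by exact: normc_ge0.
have sq k : square_integrable mu (fun t => f k.+1 t - f k t).
  have := square_integrable_linear (-1) (sf k) (sf k.+1).
  by congr square_integrable; apply/funext => t; rewrite mulN1r addrC.
have ms2 k : measurable_fun setT (fun t => s k t ^+ 2).
  by case: (sq k) => mr mi _; exact: measurable_normc_sqr.
have ms k : measurable_fun setT (s k).
  rewrite [s k](_ : _ = (fun t => Num.sqrt (s k t ^+ 2))).
    by apply: measurableT_comp (ms2 k); apply: continuous_measurable_fun; exact: sqrt_continuous.
  by apply/funext => t; rewrite sqrtr_sqr ger0_norm.
have muE : mu setT = (fine (mu setT))%:E by rewrite fineK// ge0_fin_numE.
pose M : R := fine (mu setT).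
have M0 : 0 <= M by rewrite fine_ge0.
have int_s k : (\int[mu]_t (s k t)%:E <= ((1 + M) * (1 / 2) ^+ k.+1)%:E)%E.
  have p2 : 0 < 2 ^+ k.+1 :> R by rewrite exprn_gt0.
  have h2 : 0 <= (1 / 2) ^+ k.+1 :> R by rewrite exprn_ge0.
  have hh : 2 ^+ k.+1 * (1 / 2) ^+ k.+1 = 1 :> R.
    by rewrite -exprMn mulrA mulr1 divff// expr1n.
  apply: (@le_trans _ _ (\int[mu]_t ((2 ^+ k.+1)%:E * (s k t ^+ 2)%:E +
      ((1 / 2) ^+ k.+1)%:E))%E).
    apply: ge0_le_integral => //.
    - by move=> t _; rewrite lee_fin.
    - exact/measurable_EFinP.
    - apply: emeasurable_funD; last exact: measurable_cst.
      by apply: measurable_funeM; exact/measurable_EFinP.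
    - move=> t _; rewrite -EFinM -EFinD lee_fin.
      by have := sqr_ge0 (2 ^+ k.+1 * s k t - 1); have := s0 k t; nra.
  rewrite ge0_integralD//; last 2 first.
  - by move=> t _; rewrite -EFinM lee_fin mulr_ge0 ?sqr_ge0// ltW.
  - by apply: measurable_funeM; exact/measurable_EFinP.
  rewrite ge0_integralZl//; last 2 first.
  - exact/measurable_EFinP.
  - by move=> t _; rewrite lee_fin sqr_ge0.
  rewrite integral_cst// muE -/M -EFinM mulrDl mul1r EFinD.
  apply: leeD; last by rewrite lee_fin mulrC.
  apply: (@le_trans _ _ ((2 ^+ k.+1)%:E * ((1 / 4) ^+ k.+1)%:E)%E).
    by apply: lee_wpmul2l; [rewrite lee_fin ltW|exact: hf].
  rewrite -EFinM lee_fin -exprMn.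
  have -> : 2 * (1 / 4) = 1 / 2 :> R by field.
  by rewrite div1r mul1r.
have int_sum : (\int[mu]_t (\sum_(k <oo) (s k t)%:E) < +oo)%E.
  rewrite integral_nneseries//; last first.
  - by move=> k t _; rewrite lee_fin.
  - by move=> k; exact/measurable_EFinP.
  apply: (@le_lt_trans _ _ (\sum_(k <oo) ((1 + M)%:E * ((1 / 2) ^+ k.+1)%:E))%E).
    apply: lee_nneseries => k _.
      by move=> _; apply: integral_ge0 => t _; rewrite lee_fin.
    by rewrite -EFinM; exact: int_s.
  rewrite nneseriesZl; last by move=> k _; rewrite lee_fin exprn_ge0.
  apply: lte_mul_pinfty => //; first by rewrite lee_fin addr_ge0.
  exact: le_lt_trans half_sum (ltry _).
have msum : measurable_fun setT (fun t => \sum_(k <oo) (s k t)%:E)%E.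
  apply: (@ge0_emeasurable_sum _ _ _ setT (fun k t => (s k t)%:E) xpredT).
    by move=> k t _ _; rewrite lee_fin.
  by move=> k _; exact/measurable_EFinP.
have sum0 t : (0 <= \sum_(k <oo) (s k t)%:E)%E.
  by apply: nneseries_ge0 => k _ _; rewrite lee_fin.
have int : mu.-integrable setT (fun t => \sum_(k <oo) (s k t)%:E)%E.
  apply/integrableP; split=> //; under eq_integral do rewrite gee0_abs//.
  exact: int_sum.
apply: filterS (integrable_ae measurableT int) => t /(_ I).
by rewrite ge0_fin_numE.
Qed.

(** The Riesz-Fischer argument: a rapidly converging subsequence has an almost everywhere limit, and
    Fatou's lemma transfers the norm estimates to that limit. *)
Lemma L2_complete (u : nat -> L2) :
  (forall e : R, 0 < e -> exists N : nat, forall m n : nat,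
     (N <= m)%N -> (N <= n)%N -> nrm (u m - u n) <= e) ->
  exists l : L2, forall e : R, 0 < e ->
    exists N : nat, forall n : nat, (N <= n)%N -> nrm (u n - l) <= e.
Proof.
move=> cu.
have nrm_sq x : ((nrm x ^+ 2)%:E = \int[mu]_t (normc (L2_repr x t) ^+ 2)%:E)%E.
  by rewrite /hnorm sqr_sqrtr ?L2_ip_ge0// L2_normE.
have distE x y : ((nrm (x - y) ^+ 2)%:E =
    \int[mu]_t (normc (L2_repr x t - L2_repr y t) ^+ 2)%:E)%E.
  have [xr xi _] := L2_reprP x; have [yr yi _] := L2_reprP y.
  have [zr zi _] := L2_reprP (x - y).
  rewrite nrm_sq; apply: ge0_ae_eq_integral => //.
  - exact/measurable_EFinP/measurable_normc_sqr.
  - exact: measurable_dist.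
  - by move=> t _; rewrite lee_fin sqr_ge0.
  - by move=> t _; rewrite lee_fin sqr_ge0.
  - apply: filterS (L2_repr_linear (-1) y x) => t.
    by rewrite scaleN1r mulN1r => h _; rewrite [x - y]addrC h addrC.
have pos k : 0 < (1 / 2) ^+ k.+1 :> R by rewrite exprn_gt0.
have [N0 hN0] := choice (fun k => cu _ (pos k)).
(* Partial sums turn the thresholds [N0] into a nondecreasing sequence above [N0]; the successors
   also ensure [k <= N k]. *)
pose N k := (\sum_(i < k.+1) (N0 i).+1)%N.
have N0N k : (N0 k <= N k)%N by rewrite /N big_ord_recr/= -addSnnS leq_addl.
have NS k : (N k <= N k.+1)%N by rewrite /N [leqRHS]big_ord_recr leq_addr.
have leN k : (k <= N k)%N.
  by elim: k => // k IH; rewrite /N big_ord_recr/= addnS ltnS (leq_trans IH)// leq_addr.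
pose f k := L2_repr (u (N k)).
have sf k : square_integrable mu (f k) by exact: L2_reprP.
have steps k : (\int[mu]_t (normc (f k.+1 t - f k t) ^+ 2)%:E <= ((1 / 4) ^+ k.+1)%:E)%E.
  rewrite -distE lee_fin (_ : 1 / 4 = (1 / 2) ^+ 2 :> R); last by field.
  rewrite -exprM mulnC exprM lerXn2r// ?nnegrE ?sqrtr_ge0 ?exprn_ge0//.
  by apply: hN0; [exact: leq_trans (N0N k) (NS k)|exact: N0N].
have [E [mE E0 hE]] := summable_steps sf steps.
(* Values are reset to 0 on the null set [E], so that the sequence converges at every point and its
   limit is measurable. *)
pose g k t : R[i] := if t \in E then 0 else f k t.
have ng t k : t \notin E -> g k t = f k t by rewrite /g => /negbTE ->.
have step t : t \notin E -> (\sum_(k <oo) (normc (f k.+1 t - f k t))%:E < +oo)%E.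
  by move=> tE; apply: contrapT => /hE tE'; move/negP: tE; apply; rewrite inE.
have cvgr t : cvgn (fun k => complex.Re (g k t)).
  have [tE|tE] := boolP (t \in E).
    by rewrite /g tE; exact: is_cvg_cst.
  apply: (@cvgn_of_summable_steps _ _ (fun k => normc (f k.+1 t - f k t))); last exact: step.
  move=> k; rewrite !ng//; case: (f k.+1 t) (f k t) => a b [p q] /=.
  by rewrite -sqrtr_sqr ler_wsqrtr// lerDl sqr_ge0.
have cvgi t : cvgn (fun k => complex.Im (g k t)).
  have [tE|tE] := boolP (t \in E).
    by rewrite /g tE; exact: is_cvg_cst.
  apply: (@cvgn_of_summable_steps _ _ (fun k => normc (f k.+1 t - f k t))); last exact: step.
  move=> k; rewrite !ng//; case: (f k.+1 t) (f k t) => a b [p q] /=.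
  by rewrite -sqrtr_sqr ler_wsqrtr// lerDr sqr_ge0.
pose F t : R[i] := Complex (limn (fun k => complex.Re (g k t)))
                           (limn (fun k => complex.Im (g k t))).
have mg k : measurable_fun setT (fun t => complex.Re (g k t)) /\
    measurable_fun setT (fun t => complex.Im (g k t)).
  have [fr fi _] := sf k; split.
    have := measurable_vanish mE fr; congr measurable_fun.
    by apply/funext => t; rewrite /g; case: ifP.
  have := measurable_vanish mE fi; congr measurable_fun.
  by apply/funext => t; rewrite /g; case: ifP.
have Fr : measurable_fun setT (fun t => complex.Re (F t)).
  apply: (@measurable_fun_cvg _ _ _ _ (fun k t => complex.Re (g k t))).
    by move=> k; exact: (mg k).1.
  by move=> t _; exact: cvgr.
have Fi : measurable_fun setT (fun t => complex.Im (F t)).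
  apply: (@measurable_fun_cvg _ _ _ _ (fun k t => complex.Im (g k t))).
    by move=> k; exact: (mg k).2.
  by move=> t _; exact: cvgi.
(* Fatou along the subsequence, started at [k0]. It serves with [c = 1] to show that [F] is square
   integrable, and with [c = e] for the convergence. *)
have bound (x : L2) c k0 : 0 <= c -> (forall k, (k0 <= k)%N -> nrm (u (N k) - x) <= c) ->
    (\int[mu]_t (normc (F t - L2_repr x t) ^+ 2)%:E <= (c ^+ 2)%:E)%E.
  move=> c0 hc; have [xr xi _] := L2_reprP x.
  apply: (@fatou_bound (fun k t => normc (g (k + k0)%N t - L2_repr x t) ^+ 2)).
  - move=> k; have [gr gi] := mg (k + k0)%N.
    by apply/measurable_EFinP; exact: measurable_dist.
  - by move=> k t; exact: sqr_ge0.
  - move=> t; rewrite (_ : (fun k => _) = (fun k =>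
      (complex.Re (g (k + k0)%N t) - complex.Re (L2_repr x t)) ^+ 2 +
      (complex.Im (g (k + k0)%N t) - complex.Im (L2_repr x t)) ^+ 2)); last first.
      by apply/funext => k; rewrite normc_sqrE; case: (g _ t) (L2_repr x t) => ? ? [].
    rewrite [X in _ --> X](_ : _ = (complex.Re (F t) - complex.Re (L2_repr x t)) ^+ 2 +
      (complex.Im (F t) - complex.Im (L2_repr x t)) ^+ 2); last first.
      by rewrite normc_sqrE; case: (F t) (L2_repr x t) => ? ? [].
    have cr : (fun k => complex.Re (g (k + k0)%N t)) @ \oo --> complex.Re (F t).
      by rewrite (cvg_shiftn k0 (fun k => complex.Re (g k t))); exact: cvgr.
    have ci : (fun k => complex.Im (g (k + k0)%N t)) @ \oo --> complex.Im (F t).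
      by rewrite (cvg_shiftn k0 (fun k => complex.Im (g k t))); exact: cvgi.
    have cr' : (fun k => complex.Re (g (k + k0)%N t) - complex.Re (L2_repr x t)) @ \oo
        --> complex.Re (F t) - complex.Re (L2_repr x t).
      exact: (cvgB cr (cvg_cst (complex.Re (L2_repr x t)))).
    have ci' : (fun k => complex.Im (g (k + k0)%N t) - complex.Im (L2_repr x t)) @ \oo
        --> complex.Im (F t) - complex.Im (L2_repr x t).
      exact: (cvgB ci (cvg_cst (complex.Im (L2_repr x t)))).
    have sqr_cvg (a : nat -> R) (l : R) : a @ \oo --> l -> (fun k => a k ^+ 2) @ \oo --> l ^+ 2.
      move=> al; rewrite expr2 (_ : (fun k => _) = (fun k => a k * a k)).
        exact: cvgM.
      by apply/funext => k; rewrite expr2.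
    by apply: cvgD; apply: sqr_cvg.
  - move=> k.
    rewrite (@ge0_ae_eq_integral _ _ _ mu setT _
      (fun t => (normc (f (k + k0)%N t - L2_repr x t) ^+ 2)%:E)) //.
    + rewrite -distE lee_fin lerXn2r ?nnegrE ?sqrtr_ge0// hc//; exact: leq_addl.
    + by have [gr gi] := mg (k + k0)%N; exact: measurable_dist.
    + by have [fr fi _] := sf (k + k0)%N; exact: measurable_dist.
    + by move=> t _; rewrite lee_fin sqr_ge0.
    + by move=> t _; rewrite lee_fin sqr_ge0.
    + exists E; split=> //. move=> t /= h. apply: contrapT => tE; apply: h => _.
      by rewrite ng//; apply/negP => /set_mem.
have sF : square_integrable mu F.
  have [N1 hN1] := cu 1 ltr01.
  have sd : square_integrable mu (fun t => F t - L2_repr (u N1) t).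
    have [xr xi _] := L2_reprP (u N1); split.
    - rewrite (_ : (fun t => _) = (fun t => complex.Re (F t) - complex.Re (L2_repr (u N1) t))).
        exact: measurable_funB.
      by apply/funext => t; case: (F t) (L2_repr _ t) => ? ? [].
    - rewrite (_ : (fun t => _) = (fun t => complex.Im (F t) - complex.Im (L2_repr (u N1) t))).
        exact: measurable_funB.
      by apply/funext => t; case: (F t) (L2_repr _ t) => ? ? [].
    - apply: le_lt_trans (ltry (1 ^+ 2)); apply: (bound _ _ N1) => // k N1k.
      by apply: hN1 => //; exact: leq_trans N1k (leN k).
  have := square_integrable_linear 1 sd (L2_reprP (u N1)).
  by congr square_integrable; apply/funext => t; rewrite mul1r subrK.
exists (L2_class mu F) => e e0; have [N1 hN1] := cu e e0; exists N1 => n N1n.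
rewrite -(@ler_sqr R) ?nnegrE ?sqrtr_ge0 ?(ltW e0)// -lee_fin distE.
have [xr xi _] := L2_reprP (u n); have [lr li _] := L2_reprP (L2_class mu F).
rewrite (@ge0_ae_eq_integral _ _ _ mu setT _
  (fun t => (normc (F t - L2_repr (u n) t) ^+ 2)%:E)) //.
- apply: (bound _ _ N1); first exact: ltW.
  by move=> k N1k; apply: hN1 => //; exact: leq_trans N1k (leN k).
- exact: measurable_dist.
- exact: measurable_dist.
- by move=> t _; rewrite lee_fin sqr_ge0.
- by move=> t _; rewrite lee_fin sqr_ge0.
- by apply: filterS (L2_class_repr sF) => t -> _; rewrite -opprB normcN.
Qed.

Lemma L2_hilbert : hilbert_space (L2_ip mu).
Proof.
split.
- exact: L2_ip_linear.
- exact: L2_ip_conj.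
- exact: L2_ip_ge0.
- exact: L2_ip_eq0.
- exact: L2_complete.
Qed.

End L2Complete.

(** * Self-similar measures and their operators *)

Section CompactMetric.
Context (R : realType) (K : pmetricType R).

(** Continuity for the real modulus [normc], in which all operator bounds are expressed, instead of
    the complex-valued norm of [R[i]^o]. *)
Definition edelta_continuous (f : K -> R[i]) := forall x (e : R), 0 < e ->
  exists2 r : R, 0 < r & forall y, mdist x y < r -> normc (f x - f y) <= e.

Lemma continuous_edelta (f : K -> R[i]^o) : continuous f -> edelta_continuous f.
Proof.
move=> cf x e e0.
have ec : 0 < e%:C%C by rewrite ltcR.
have h : \forall y \near x, `|f x - f y| <= e%:C%C.
  by have /cvgr_dist_le := cf x; apply.
have /nbhs_ballP[r /= r0 hr] := h.
exists r => // y xy; have := hr y; rewrite ballEmdist => /(_ xy) /=.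
by rewrite -lecR.
Qed.

Lemma edelta_measurable (f : K -> R) :
  (forall x (e : R), 0 < e ->
    exists2 r : R, 0 < r & forall y, mdist x y < r -> `|f x - f y| <= e) ->
  measurable_fun setT (f : borel K -> R).
Proof.
move=> hf; apply: (measurability _ (RGenOInfty.measurableE R)) => //.
move=> _ [_ [a ->] <-]; rewrite setTI; apply: sub_sigma_algebra.
suff : open (f @^-1` `]a, +oo[ : set K) by [].
rewrite openE => x /=; rewrite in_itv /= andbT => ax.
have e0 : 0 < (f x - a) / 2 by rewrite divr_gt0// subr_gt0.
have [r r0 hr] := hf x _ e0.
rewrite /interior -nbhs_ballE; exists r => // y; rewrite ballEmdist => /hr.
by rewrite /= in_itv /= andbT ler_norml => /andP[_]; lra.
Qed.

Hypothesis cK : compact [set: K].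

(** Heine-Cantor, from the near-covering form of compactness with the radius tending to 0 from the
    right. *)
Lemma compact_edelta_uniform (f : K -> R[i]) (e : R) : 0 < e -> edelta_continuous f ->
  exists2 r : R, 0 < r & forall x y, mdist x y <= r -> normc (f x - f y) <= e.
Proof.
move=> e0 cf.
have /compact_near_coveringP := cK.
move=> /(_ R (0^'+) (fun r x => forall y, mdist x y <= r -> normc (f x - f y) <= e)).
have e2 : 0 < e / 2 by rewrite divr_gt0.
have loc : forall x, [set: K] x -> \forall x' \near x & r \near 0^'+,
    forall y, mdist x' y <= r -> normc (f x' - f y) <= e.
  move=> x _; have [r r0 hr] := cf x _ e2.
  have r2 : 0 < r / 2 by rewrite divr_gt0.
  exists ([set y | mdist x y < r / 2], [set d | d < r / 2]) => /=.
    split; last exact: nbhs_right_lt.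
    by apply/nbhs_ballP; exists (r / 2) => // y; rewrite ballEmdist.
  move=> [x' d] /= [xx' dr] y x'y.
  have h1 : normc (f x - f x') <= e / 2 by apply: hr; lra.
  have xy : mdist x y < r.
    by have := metric_triangle x x' y; lra.
  have h2 := hr y xy.
  have -> : f x' - f y = (f x - f y) - (f x - f x') by rewrite opprB [RHS]addrC addrA subrK.
  apply: le_trans (le_normcD _ _) _; rewrite normcN; lra.
move=> /(_ _ loc) [r /= r0 hr]; exists (r / 2); first by rewrite divr_gt0.
move=> x y; apply: hr => //=; rewrite ?divr_gt0//.
by rewrite sub0r normrN gtr0_norm ?divr_gt0// ltr_pdivrMr//; lra.
Qed.

Lemma compact_locally_bounded (g : K -> R) :
  (forall x, exists2 r : R, 0 < r & exists C, forall y, mdist x y < r -> g y <= C) ->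
  exists C, forall x, g x <= C.
Proof.
move=> hg; have /compact_near_coveringP := cK.
move=> /(_ R +oo (fun C x => g x <= C)) h.
have loc : forall x, [set: K] x -> \forall x' \near x & C \near +oo, g x' <= C.
  move=> x _; have [r r0 [C hC]] := hg x.
  exists ([set y | mdist x y < r], [set D | C < D]) => /=.
    split; last by exists C; split=> //; exact: num_real.
    by apply/nbhs_ballP; exists r => // y; rewrite ballEmdist.
  by move=> [x' D] /= [xx' CD]; apply: le_trans (ltW CD); exact: hC.
have [M [_ hM]] := h _ loc.
by exists (M + 1) => x; apply: (hM (M + 1)) => //; rewrite ltrDl.
Qed.

Lemma compact_edelta_bounded (f : K -> R[i]) : edelta_continuous f ->
  exists2 C, 0 <= C & forall x, normc (f x) <= C.
Proof.
move=> cf; have [|C hC] := @compact_locally_bounded (fun x => normc (f x)).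
  move=> x; have [r r0 hr] := cf x 1 ltr01; exists r => //; exists (normc (f x) + 1).
  move=> y /hr fxy; rewrite -[f y](subKr (f x)).
  by apply: le_trans (le_normcD _ _) _; rewrite normcN lerD2l.
by exists C => //; apply: le_trans (hC point); exact: normc_ge0.
Qed.

Lemma compact_mdist_bounded : exists2 C : R, 0 < C & forall x y : K, mdist x y <= C.
Proof.
have [|C hC] := @compact_locally_bounded (fun x => mdist (point : K) x).
  move=> x; exists 1 => //; exists (mdist point x + 1) => y xy.
  by have := metric_triangle point x y; lra.
exists (C + C + 1).
  by have := hC point; rewrite mdistxx; lra.
move=> x y; have := hC x; have := hC y; have := metric_triangle x point y.
by rewrite [mdist x point]metric_sym; lra.
Qed.

Lemma compact_image_measurable (g : K -> K) : continuous g ->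
  measurable (range g : set (borel K)).
Proof.
move=> cg; rewrite -[range g]setCK; apply: measurableC; apply: sub_sigma_algebra.
rewrite openC; apply: compact_closed; first exact: metric_hausdorff.
by apply: continuous_compact cK; exact: continuous_subspaceT.
Qed.

Lemma continuous_borel (g : K -> K) : continuous g ->
  measurable_fun setT (g : borel K -> borel K).
Proof.
move=> cg; apply: (@measurability _ _ (borel K) (borel K) setT g (@open K)) => //.
move=> _ [U oU <-]; rewrite setTI; apply: sub_sigma_algebra.
by move/continuousP: cg; apply.
Qed.

End CompactMetric.

(** * Integration against a self-similar measure *)

Section SelfSimilarIntegral.
Context (R : realType) (K : pmetricType R) (n : nat) (gamma : 'I_n -> K -> K).
Variables (p : 'I_n -> R) (mu : probability (borel K) R).
Hypothesis p0 : forall i, 0 < p i.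
Hypothesis mgamma : forall i,
  measurable_fun setT (gamma i : borel K -> borel K).
Hypothesis self_mu : self_similar_measure gamma p mu.

(** [msum] takes a sequence of measures indexed by [nat]; from [n] on, the branches are extended by
    the identity and the weights by 0. *)
Let gamma_nat (k : nat) : borel K -> borel K :=
  if insub k is Some i then gamma i else id.
Let p_nat (k : nat) : R := if insub k is Some i then p i else 0.

Let mgamma_nat k : measurable_fun setT (gamma_nat k).
Proof. by rewrite /gamma_nat; case: insub => [i|]. Qed.

Let p_nat_ge0 k : 0 <= p_nat k.
Proof. by rewrite /p_nat; case: insub => [i|//]; exact: ltW. Qed.

Let push (k : nat) : {measure set (borel K) -> \bar R} :=
  measure_function_pushforward__canonical__measure_function_Measure mu (mgamma_nat k).

Let scaled (k : nat) : {measure set (borel K) -> \bar R} :=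
  mscale (NngNum (p_nat_ge0 k)) (push k).

(** Self-similarity says that [mu] is the sum of the pushforwards by the [gamma i] scaled by [p i];
    the formula integrates against that sum. *)
Lemma self_similar_integral (h : borel K -> \bar R) :
  measurable_fun setT h -> (forall x, 0 <= h x)%E ->
  (\int[mu]_x h x = \sum_(i < n) (p i)%:E * \int[mu]_x h (gamma i x))%E.
Proof.
move=> mh h0.
have pE (i : 'I_n) : p_nat i = p i by rewrite /p_nat valK.
have gE (i : 'I_n) : gamma_nat i = gamma i by rewrite /gamma_nat valK.
rewrite (@eq_measure_integral _ _ _ setT (msum scaled n)); last first.
  move=> A mA _; apply: etrans (self_mu mA) _; apply: eq_bigr => i _.
  have -> : scaled i A = ((p_nat i)%:E * mu (gamma_nat i @^-1` A))%E by [].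
  by rewrite pE gE.
rewrite ge0_integral_measure_sum//; apply: eq_bigr => i _.
rewrite /scaled ge0_integral_mscale//= pE; congr (_ * _)%E.
rewrite /push /= ge0_integral_pushforward//.
by rewrite preimage_setT; apply: eq_integral => x _; rewrite /= gE.
Qed.

(** The measure of the preimage, times [p i > 0], is one term of a nonnegative sum equal to
    [mu N = 0]. Composition with [gamma i] thus respects almost everywhere equality. *)
Lemma self_similar_null (i : 'I_n) (N : set (borel K)) : measurable N -> mu N = 0%E ->
  mu (gamma i @^-1` N) = 0%E.
Proof.
move=> mN N0; have le0 : ((p i)%:E * mu (gamma i @^-1` N) <= 0)%E.
  rewrite -N0 (_ : mu N = \sum_(j < n) (p j)%:E * mu (gamma j @^-1` N))%E; last exact: self_mu.
  rewrite (bigD1 i)//= leeDl// sume_ge0// => j _.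
  by rewrite mule_ge0// lee_fin ltW.
by apply/eqP; rewrite -measure_le0 -(@pmule_rle0 _ (p i)%:E) ?lte_fin.
Qed.

Lemma self_similar_ae (i : 'I_n) (P : borel K -> Prop) :
  {ae mu, forall x, P x} -> {ae mu, forall x, P (gamma i x)}.
Proof.
move=> [N [mN N0 PN]]; exists (gamma i @^-1` N); split.
- by rewrite -[X in measurable X]setTI; exact: mgamma.
- exact: self_similar_null.
- by move=> x nPx; exact: PN.
Qed.

Hypothesis p1 : \sum_(i < n) p i = 1.
Variable phi : K -> K.
Hypothesis mphi : measurable_fun setT (phi : borel K -> borel K).
Hypothesis phiK : inverse_branches gamma phi.

Lemma branch_ae (P : borel K -> Prop) :
  {ae mu, forall x, P x} -> {ae mu, forall x, P (phi x)}.
Proof.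
move=> [N [mN N0 PN]]; exists (phi @^-1` N).
have mpN : measurable (phi @^-1` N : set (borel K)).
  by rewrite -[X in measurable X]setTI; exact: mphi.
split=> //; last by move=> x nPx; exact: PN.
apply: etrans (self_mu mpN) _; apply: big1 => i _.
rewrite (_ : gamma i @^-1` _ = N) ?N0 ?mule0//.
by apply/seteqP; split=> x /=; rewrite phiK.
Qed.

(** [phi] preserves [mu]: each [phi \o gamma i] is the identity, so self-similarity averages equal
    integrals with weights of sum 1. *)
Lemma branch_integral (h : borel K -> \bar R) :
  measurable_fun setT h -> (forall x, 0 <= h x)%E ->
  (\int[mu]_x h (phi x) = \int[mu]_x h x)%E.
Proof.
move=> mh h0; rewrite self_similar_integral//; last exact: measurableT_comp mphi.
under eq_bigr do under eq_integral do rewrite phiK.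
by rewrite -ge0_sume_distrl ?sumEFin ?p1 ?mul1e// => i _; rewrite lee_fin ltW.
Qed.

End SelfSimilarIntegral.

(** * Multiplication operators on L2 *)

Section MultiplicationOperators.
Context (R : realType) (K : pmetricType R) (mu : probability (borel K) R).
Local Notation H := (L2 mu).
Local Notation ip := (L2_ip mu).

Definition bounded_borel (a : K -> R[i]) (c : R) := [/\
  measurable_fun setT (fun t : borel K => complex.Re (a t)),
  measurable_fun setT (fun t : borel K => complex.Im (a t)) &
  forall t, normc (a t) <= c].

Lemma bounded_borel_conj a c : bounded_borel a c -> bounded_borel (fun t => conjc (a t)) c.
Proof.
move=> [ar ai ac]; split.
- by move: ar; congr measurable_fun; apply/funext => t; case: (a t).
- rewrite (_ : (fun t => _) = (fun t => - complex.Im (a t))).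
    by apply: measurableT_comp ai; exact: oppr_measurable.
  by apply/funext => t; case: (a t).
- by move=> t; have := ac t; case: (a t) => p q /=; rewrite sqrrN.
Qed.

Lemma bounded_borel_cst (k : R[i]) : bounded_borel (fun=> k) (normc k).
Proof. by split=> //; exact: measurable_cst. Qed.

Lemma square_integrable_mult a c (f : borel K -> R[i]) : bounded_borel a c ->
  square_integrable mu f -> square_integrable mu (fun t => a t * f t).
Proof.
move=> [ar ai ac] [fr fi foo].
have mr : measurable_fun setT (fun t : borel K => complex.Re (a t * f t)).
  rewrite (_ : (fun t => _) = (fun t : borel K =>
      complex.Re (a t) * complex.Re (f t) - complex.Im (a t) * complex.Im (f t))).
    by apply: measurable_funB; apply: measurable_funM.
  by apply/funext => t; case: (a t) (f t) => ? ? [].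
have mi : measurable_fun setT (fun t : borel K => complex.Im (a t * f t)).
  rewrite (_ : (fun t => _) = (fun t : borel K =>
      complex.Re (a t) * complex.Im (f t) + complex.Im (a t) * complex.Re (f t))).
    by apply: measurable_funD; apply: measurable_funM.
  by apply/funext => t; case: (a t) (f t) => ? ? [].
split=> //.
apply: (@le_lt_trans _ _ (\int[mu]_t ((c ^+ 2)%:E * (normc (f t) ^+ 2)%:E))%E).
  apply: ge0_le_integral => //.
  - by move=> t _; rewrite lee_fin sqr_ge0.
  - exact/measurable_EFinP/measurable_normc_sqr.
  - by apply: measurable_funeM; exact/measurable_EFinP/measurable_normc_sqr.
  - move=> t _; rewrite -EFinM lee_fin normcM exprMn ler_wpM2r ?sqr_ge0//.
    by rewrite lerXn2r// nnegrE ?normc_ge0// (le_trans (normc_ge0 (a t))).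
rewrite ge0_integralZl//; last 3 first.
- exact/measurable_EFinP/measurable_normc_sqr.
- by move=> t _; rewrite lee_fin sqr_ge0.
- by rewrite lee_fin sqr_ge0.
by apply: lte_mul_pinfty; rewrite ?lee_fin ?sqr_ge0.
Qed.

Variables (a : K -> R[i]) (c : R).
Hypothesis ha : bounded_borel a c.

Lemma mult_op_repr (x : H) :
  {ae mu, forall t : borel K, L2_repr (mult_op mu a x) t = a t * L2_repr x t}.
Proof. by apply: L2_class_repr; apply: square_integrable_mult ha _; exact: L2_reprP. Qed.

Lemma mult_op_linear : linear (mult_op mu a).
Proof.
move=> k x y; apply/L2_eqP.
have h1 := mult_op_repr (k *: x + y); have h2 := L2_repr_linear k x y.
have h3 := L2_repr_linear k (mult_op mu a x) (mult_op mu a y).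
have h4 := mult_op_repr x; have h5 := mult_op_repr y.
apply: filterS3 (filterI h1 h2) h3 (filterI h4 h5) => t [-> ->] -> [-> ->].
by rewrite mulrDr mulrCA.
Qed.

Lemma mult_op_adjoint : adjoint_of ip (mult_op mu a) (mult_op mu (fun t => conjc (a t))).
Proof.
move=> x y; have hc := bounded_borel_conj ha.
have sx := L2_reprP x; have sy := L2_reprP y.
have sax := square_integrable_mult ha sx; have say := square_integrable_mult hc sy.
rewrite !L2_ipE.
rewrite (@pairing_ae _ _ _ mu _ (fun t => a t * L2_repr x t) _ (L2_repr y))//; last 3 first.
- exact: L2_reprP.
- exact: mult_op_repr.
- exact: aeW.
rewrite [RHS](@pairing_ae _ _ _ mu _ (L2_repr x) _ (fun t => conjc (a t) * L2_repr y t))//;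
  last 3 first.
- exact: L2_reprP.
- exact: aeW.
- by apply: L2_class_repr.
rewrite /pairing; congr Complex; apply: eq_Rintegral => t _;
  by rewrite rmorphM /= conjcK mulrA [a t * _]mulrC.
Qed.

Lemma mult_op_bound (x : H) : hnorm ip (mult_op mu a x) <= c * hnorm ip x.
Proof.
have c0 : 0 <= c by have [_ _ h] := ha; apply: le_trans (h point); exact: normc_ge0.
rewrite -(@ler_sqr R) ?nnegrE ?mulr_ge0 ?sqrtr_ge0// exprMn.
rewrite !sqr_sqrtr ?L2_ip_ge0// -lee_fin EFinM L2_norm_class; last first.
  by apply: square_integrable_mult ha _; exact: L2_reprP.
have sx := L2_reprP x; have [xr xi _] := sx.
have [sr si _] := square_integrable_mult ha sx.
rewrite L2_normE -ge0_integralZl//; last 3 first.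
- exact/measurable_EFinP/measurable_normc_sqr.
- by move=> t _; rewrite lee_fin sqr_ge0.
- by rewrite lee_fin sqr_ge0.
apply: ge0_le_integral => //.
- by move=> t _; rewrite lee_fin sqr_ge0.
- exact/measurable_EFinP/measurable_normc_sqr.
- by apply: measurable_funeM; exact/measurable_EFinP/measurable_normc_sqr.
- move=> t _; rewrite -EFinM lee_fin normcM exprMn ler_wpM2r ?sqr_ge0//.
  by have [_ _ ac] := ha; rewrite lerXn2r// nnegrE ?normc_ge0.
Qed.

Lemma mult_op_sub_cst (k : R[i]) (x : H) :
  mult_op mu a x - k *: x = mult_op mu (fun t => a t - k) x.
Proof.
have hk : bounded_borel (fun t => a t - k) (c + normc k).
  have [ar ai ac] := ha; split.
  - rewrite (_ : (fun t => _) = (fun t : borel K => complex.Re (a t) - complex.Re k)).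
      by apply: measurable_funB => //; exact: measurable_cst.
    by apply/funext => t; case: (a t) (k) => ? ? [].
  - rewrite (_ : (fun t => _) = (fun t : borel K => complex.Im (a t) - complex.Im k)).
      by apply: measurable_funB => //; exact: measurable_cst.
    by apply/funext => t; case: (a t) (k) => ? ? [].
  - by move=> t; apply: le_trans (le_normcD _ _) _; rewrite normcN lerD2r.
rewrite addrC -scaleNr; apply/L2_eqP.
have h1 := L2_repr_linear (- k) x (mult_op mu a x); have h2 := mult_op_repr x.
have h3 : {ae mu, forall t : borel K, L2_repr (mult_op mu (fun t => a t - k) x) t =
    (a t - k) * L2_repr x t}.
  by apply: L2_class_repr; apply: square_integrable_mult hk _; exact: L2_reprP.
apply: filterS3 h1 h2 h3 => t -> -> ->.
by rewrite mulrBl mulNr addrC.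
Qed.

End MultiplicationOperators.

Lemma mult_op1 (R : realType) (K : pmetricType R) (mu : probability (borel K) R) :
  mult_op mu (fun=> 1) = id.
Proof.
apply/funext => x; rewrite /mult_op -[RHS]L2_reprK; congr L2_class.
by apply/funext => t; rewrite mul1r.
Qed.

Lemma continuous_bounded_borel (R : realType) (K : pmetricType R) (a : K -> R[i]) :
  compact [set: K] -> edelta_continuous a -> exists c, bounded_borel a c.
Proof.
move=> cK ca; have [c _ ac] := compact_edelta_bounded cK ca; exists c; split=> //.
- apply: edelta_measurable => x e e0; have [r r0 hr] := ca x e e0.
  exists r => // y /hr; apply: le_trans; case: (a x) (a y) => p q [p' q'] /=.
  by rewrite -sqrtr_sqr ler_wsqrtr// lerDl sqr_ge0.
- apply: edelta_measurable => x e e0; have [r r0 hr] := ca x e e0.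
  exists r => // y /hr; apply: le_trans; case: (a x) (a y) => p q [p' q'] /=.
  by rewrite -sqrtr_sqr ler_wsqrtr// lerDr sqr_ge0.
Qed.

(** * The Cuntz family attached to the inverse branches *)

Section CuntzOperators.
Context (R : realType) (K : pmetricType R) (n : nat) (gamma : 'I_n -> K -> K).
Variables (phi : K -> K) (mu : probability (borel K) R).
Hypothesis n0 : (0 < n)%N.
Hypothesis cK : compact [set: K].
Hypothesis cgamma : forall i, continuous (gamma i).
Hypothesis mphi : measurable_fun setT (phi : borel K -> borel K).
Hypothesis phiK : inverse_branches gamma phi.
Hypothesis selfK : self_similar gamma.
Hypothesis overlap0 : forall i j : 'I_n, i != j ->
  mu (range (gamma i) `&` range (gamma j)) = 0%E.
Hypothesis hutch : hutchinson_measure gamma mu.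

Local Notation H := (L2 mu).
Local Notation ip := (L2_ip mu).
Implicit Types x y : H.

Let p0 (i : 'I_n) : 0 < n%:R^-1 :> R. Proof. by rewrite invr_gt0 ltr0n. Qed.

Let p1 : \sum_(i < n) n%:R^-1 = 1 :> R.
Proof. by rewrite sumr_const card_ord -[LHS]mulr_natl divff// pnatr_eq0 -lt0n. Qed.

Let mgamma i : measurable_fun setT (gamma i : borel K -> borel K).
Proof. exact: continuous_borel. Qed.

Let mrange i : measurable (range (gamma i) : set (borel K)).
Proof. exact: compact_image_measurable. Qed.

Let gamma_ae i (P : borel K -> Prop) :
  {ae mu, forall t, P t} -> {ae mu, forall t, P (gamma i t)}.
Proof. exact: (self_similar_ae p0 mgamma hutch). Qed.

Let phi_ae (P : borel K -> Prop) :
  {ae mu, forall t, P t} -> {ae mu, forall t, P (phi t)}.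
Proof. exact: (branch_ae hutch mphi phiK). Qed.

Let hilbertH : hilbert_space ip.
Proof.
apply: L2_hilbert; apply: le_lt_trans (ltry 1).
exact: (probability_le1 mu (@measurableT _ (borel K))).
Qed.

Let rn : R := Num.sqrt n%:R.
Let rn0 : 0 < rn. Proof. by rewrite sqrtr_gt0 ltr0n. Qed.
Let rn2 : rn * rn = n%:R. Proof. by rewrite -expr2 sqr_sqrtr. Qed.

Let sq_meas (f : borel K -> R[i]) : square_integrable mu f ->
  measurable_fun setT (fun t => (normc (f t) ^+ 2)%:E).
Proof. by move=> [fr fi _]; exact/measurable_EFinP/measurable_normc_sqr. Qed.

Let integral_split (f : borel K -> R[i]) : square_integrable mu f ->
  (\int[mu]_t (normc (f t) ^+ 2)%:E =
   \sum_(i < n) (n%:R^-1)%:E * \int[mu]_t (normc (f (gamma i t)) ^+ 2)%:E)%E.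
Proof.
move=> sf; rewrite (self_similar_integral p0 mgamma hutch)//; first exact: sq_meas.
by move=> t; rewrite lee_fin sqr_ge0.
Qed.

Let sq_comp i (f : borel K -> R[i]) : square_integrable mu f ->
  square_integrable mu (fun t => f (gamma i t)).
Proof.
move=> sf; have [fr fi foo] := sf; split.
- by apply: (measurableT_comp fr); exact: mgamma.
- by apply: (measurableT_comp fi); exact: mgamma.
- have le : ((n%:R^-1)%:E * \int[mu]_t (normc (f (gamma i t)) ^+ 2)%:E <
      +oo)%E.
    apply: le_lt_trans foo; rewrite (integral_split sf) (bigD1 i)//= leeDl//.
    apply: sume_ge0 => j _; rewrite mule_ge0// ?lee_fin ?(ltW (p0 j))//.
    by apply: integral_ge0 => t _; rewrite lee_fin sqr_ge0.
  have -> : (\int[mu]_t (normc (f (gamma i t)) ^+ 2)%:E = n%:R%:E *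
      ((n%:R^-1)%:E * \int[mu]_t (normc (f (gamma i t)) ^+ 2)%:E))%E.
    by rewrite muleA -EFinM divff ?mul1e// pnatr_eq0 -lt0n.
  by apply: lte_mul_pinfty => //; rewrite lee_fin.
Qed.

Lemma comp_op_repr i x :
  {ae mu, forall t, L2_repr (comp_op mu (gamma i) x) t = L2_repr x (gamma i t)}.
Proof. by apply: L2_class_repr; apply: sq_comp; exact: L2_reprP. Qed.

(** The factor [sqrt n] compensates for the weight [1/n] of each branch in the Hutchinson
    measure. *)
Definition branch_fun i (f : borel K -> R[i]) (t : borel K) : R[i] :=
  if t \in range (gamma i) then rn%:C%C * f (phi t) else 0.

Let branch_fun_gamma i f t : branch_fun i f (gamma i t) = rn%:C%C * f t.
Proof. by rewrite /branch_fun phiK mem_set//; exists t. Qed.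

Let sq_branch i (f : borel K -> R[i]) : square_integrable mu f ->
  square_integrable mu (branch_fun i f).
Proof.
move=> sf; have [fr fi foo] := sf.
have mmem : measurable_fun setT (fun t : borel K => t \in range (gamma i)).
  apply: (measurable_fun_bool true); rewrite setTI.
  rewrite (_ : _ @^-1` _ = range (gamma i)); first exact: mrange.
  by apply/seteqP; split=> t; [exact: set_mem|exact: mem_set].
have mr : measurable_fun setT (fun t => complex.Re (branch_fun i f t)).
  rewrite (_ : (fun t => _) = (fun t => if t \in range (gamma i)
      then rn * complex.Re (f (phi t)) else 0)).
    apply: measurable_fun_ifT => //; apply: measurable_funM => //.
    exact: (measurableT_comp fr mphi).
  apply/funext => t; rewrite /branch_fun; case: ifP => // _.
  by case: (f _) => a b /=; rewrite mul0r subr0.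
have mi : measurable_fun setT (fun t => complex.Im (branch_fun i f t)).
  rewrite (_ : (fun t => _) = (fun t => if t \in range (gamma i)
      then rn * complex.Im (f (phi t)) else 0)).
    apply: measurable_fun_ifT => //; apply: measurable_funM => //.
    exact: (measurableT_comp fi mphi).
  apply/funext => t; rewrite /branch_fun; case: ifP => // _.
  by case: (f _) => a b /=; rewrite mul0r addr0.
split=> //.
- apply: (@le_lt_trans _ _ (\int[mu]_t (n%:R%:E * (normc (f (phi t)) ^+ 2)%:E))%E).
    apply: ge0_le_integral => //.
    + by move=> t _; rewrite lee_fin sqr_ge0.
    + exact/measurable_EFinP/measurable_normc_sqr.
    + apply: measurable_funeM; exact: (measurableT_comp (sq_meas sf) mphi).
    + move=> t _; rewrite -EFinM lee_fin /branch_fun; case: ifP => _.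
        by rewrite normcM normc_real exprMn ger0_norm ?(ltW rn0)// [rn ^+ 2]expr2 rn2.
      by rewrite normc0 expr0n mulr_ge0 ?sqr_ge0.
  rewrite ge0_integralZl//; last 2 first.
  + exact: (measurableT_comp (sq_meas sf) mphi).
  + by move=> t _; rewrite lee_fin sqr_ge0.
  rewrite (branch_integral p0 mgamma hutch p1 mphi phiK (h := fun t => (normc (f t) ^+ 2)%:E)).
  - by apply: lte_mul_pinfty => //; rewrite lee_fin.
  - exact: sq_meas.
  - by move=> t; rewrite lee_fin sqr_ge0.
Qed.

Definition branch_op i x : H := L2_class mu (branch_fun i (L2_repr x)).

Let branch_op_repr i x :
  {ae mu, forall t, L2_repr (branch_op i x) t = branch_fun i (L2_repr x) t}.
Proof. by apply: L2_class_repr; apply: sq_branch; exact: L2_reprP. Qed.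

Let L2_repr_sum (F : 'I_n -> H) :
  {ae mu, forall t, L2_repr (\sum_i F i) t = \sum_i L2_repr (F i) t}.
Proof.
elim: (index_enum _) => [|i s IH].
  by apply: filterS (L2_repr0 mu) => t h; rewrite !big_nil h.
apply: filterS2 IH (L2_repr_linear 1 (F i) (\sum_(j <- s) F j)) => t h1 h2.
by rewrite !big_cons -h1 -[F i]scale1r h2 scale1r mul1r.
Qed.

Lemma comp_op_linear i : linear (comp_op mu (gamma i)).
Proof.
move=> c x y; apply/L2_eqP.
have h1 := comp_op_repr i (c *: x + y).
have h2 := gamma_ae i (L2_repr_linear c x y).
have h3 := L2_repr_linear c (comp_op mu (gamma i) x) (comp_op mu (gamma i) y).
have h4 := comp_op_repr i x; have h5 := comp_op_repr i y.
apply: filterS3 (filterI h1 h2) h3 (filterI h4 h5) => t [-> ->] -> [-> ->].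
by [].
Qed.

Lemma comp_branch_op i x : comp_op mu (gamma i) (branch_op i x) = rn%:C%C *: x.
Proof.
apply/L2_eqP; have h1 := comp_op_repr i (branch_op i x).
have h2 := gamma_ae i (branch_op_repr i x).
have h3 := L2_repr_linear rn%:C%C x 0; rewrite addr0 in h3.
apply: filterS3 (filterI h1 h2) h3 (L2_repr0 mu) => t [-> ->] -> ->.
by rewrite branch_fun_gamma addr0.
Qed.

Let ae_forall (P : 'I_n -> borel K -> Prop) :
  (forall i, {ae mu, forall t, P i t}) -> {ae mu, forall t, forall i, P i t}.
Proof. by move=> h; apply: filter_forall => i; exact: h. Qed.

Let overlap_ae i j : i != j ->
  {ae mu, forall t : borel K, ~ (range (gamma i) t /\ range (gamma j) t)}.
Proof.
move=> ij; exists (range (gamma i) `&` range (gamma j)); split.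
- exact: measurableI.
- exact: overlap0.
- by move=> t /= /contrapT.
Qed.

(** Where it does not vanish, [gamma j t] lies in the overlap of the ranges of [gamma i] and
    [gamma j]. The overlap is null by separation, and so is its preimage under [gamma j]. *)
Lemma comp_branch_op_neq i j x : i != j ->
  comp_op mu (gamma j) (branch_op i x) = 0.
Proof.
move=> ij; apply/L2_eqP; have h1 := comp_op_repr j (branch_op i x).
have h2 := gamma_ae j (branch_op_repr i x).
have h3 := gamma_ae j (overlap_ae ij).
apply: filterS3 (filterI h1 h2) h3 (L2_repr0 mu) => t [-> ->] nij ->.
rewrite /branch_fun; case: ifP => // /set_mem it.
by case: nij; split=> //; exists t.
Qed.

(** Almost every [t] lies in exactly one range: at least one by self-similarity of the space, at
    most one by separation. If [t = gamma j s] then [phi t = s], and the only remaining term is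
    [sqrt n] times the value of [x] at [t]. *)
Lemma sum_branch_comp_op x :
  \sum_i branch_op i (comp_op mu (gamma i) x) = rn%:C%C *: x.
Proof.
apply/L2_eqP.
have h1 := L2_repr_sum (fun i => branch_op i (comp_op mu (gamma i) x)).
have h2 : {ae mu, forall t : borel K, forall i,
    L2_repr (branch_op i (comp_op mu (gamma i) x)) t =
    branch_fun i (L2_repr (comp_op mu (gamma i) x)) t}.
  apply: (@ae_forall (fun i (t : borel K) =>
    L2_repr (branch_op i (comp_op mu (gamma i) x)) t =
    branch_fun i (L2_repr (comp_op mu (gamma i) x)) t)) => i.
  exact: branch_op_repr.
have h3 : {ae mu, forall t : borel K, forall i,
    L2_repr (comp_op mu (gamma i) x) (phi t) = L2_repr x (gamma i (phi t))}.
  apply: (@ae_forall (fun i (t : borel K) =>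
    L2_repr (comp_op mu (gamma i) x) (phi t) = L2_repr x (gamma i (phi t)))) => i.
  exact: (phi_ae (comp_op_repr i x)).
have h4 : {ae mu, forall t : borel K, forall i j, i != j ->
    ~ (range (gamma i) t /\ range (gamma j) t)}.
  apply: (@ae_forall (fun i (t : borel K) => forall j, i != j ->
    ~ (range (gamma i) t /\ range (gamma j) t))) => i.
  apply: (@ae_forall (fun j (t : borel K) => i != j ->
    ~ (range (gamma i) t /\ range (gamma j) t))) => j.
  have [->|ij] := eqVneq i j; first by apply: aeW => t; case/eqP.
  by apply: filterS (overlap_ae ij) => t h _.
have h5 := L2_repr_linear rn%:C%C x 0; rewrite addr0 in h5.
apply: filterS3 (filterI h1 h2) (filterI h3 h4) (filterI h5 (L2_repr0 mu)).
move=> t [-> e2] [e3 e4] [-> ->]; rewrite addr0.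
have [j _ [s _ sjt]] : (\bigcup_(i in [set: 'I_n]) range (gamma i)) t.
  by rewrite -selfK.
rewrite (bigD1 j)//= big1 ?addr0.
  by rewrite e2 /branch_fun mem_set ?e3 -?sjt ?phiK//; exists s.
move=> i ij; rewrite e2 /branch_fun; case: ifP => // /set_mem it.
by case: (e4 i j ij); split=> //; exists s.
Qed.

Let ip_self_decomposition x :
  ip x x = \sum_i (n%:R^-1)%:C%C *
    ip (comp_op mu (gamma i) x) (comp_op mu (gamma i) x).
Proof.
have normE y : ((hnorm ip y ^+ 2)%:E = \int[mu]_t (normc (L2_repr y t) ^+ 2)%:E)%E.
  by rewrite (hnorm_sqr hilbertH) L2_normE.
rewrite (ip_self hilbertH); under eq_bigr do rewrite (ip_self hilbertH) -rmorphM.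
rewrite -rmorph_sum; congr (_%:C)%C; apply: EFin_inj.
rewrite normE (integral_split (L2_reprP x)) -sumEFin; apply: eq_bigr => i _.
rewrite EFinM (hnorm_sqr hilbertH (comp_op _ _ _)) L2_norm_class//.
by apply: sq_comp; exact: L2_reprP.
Qed.

(** Self-similarity of the integral is stated for nonnegative integrands, which gives the case
    [x = y]; polarization gives the rest. *)
Lemma ip_decomposition x y :
  ip x y = \sum_i (n%:R^-1)%:C%C *
    ip (comp_op mu (gamma i) x) (comp_op mu (gamma i) y).
Proof.
pose B x y := ip x y - \sum_i (n%:R^-1)%:C%C *
    ip (comp_op mu (gamma i) x) (comp_op mu (gamma i) y).
apply/eqP; rewrite -subr_eq0 -/(B x y); apply/eqP; apply: sesquilinear_diag0.
- move=> c u v z; rewrite /B (ip_linear hilbertH c u v z) mulrBr addrACA -opprD.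
  congr (_ - _); rewrite mulr_sumr -big_split; apply: eq_bigr => i _.
  rewrite (comp_op_linear i c u v) (ip_linear hilbertH) mulrDr.
  by congr (_ + _); exact: mulrCA.
- move=> c u v z; rewrite /B (ipDr hilbertH _ _ z) (ipZr hilbertH _ _ z) mulrBr.
  rewrite addrACA -opprD.
  congr (_ - _); rewrite mulr_sumr -big_split; apply: eq_bigr => i _.
  rewrite (comp_op_linear i c u v) (ipDr hilbertH) (ipZr hilbertH) mulrDr.
  by congr (_ + _); exact: mulrCA.
- by move=> u; rewrite /B ip_self_decomposition subrr.
Qed.

Definition coisometry i x : H := (rn^-1)%:C%C *: comp_op mu (gamma i) x.

(** In the decomposition of [<x, V_i y>] only the term of index [i] survives, where [gamma i]
    composed with [V_i y] is [sqrt n] times [y]; the scalars combine as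
    [sqrt n / n = 1 / sqrt n]. *)
Lemma coisometry_adjoint i : adjoint_of ip (coisometry i) (branch_op i).
Proof.
move=> x y; rewrite [RHS]ip_decomposition (bigD1 i)//= big1 ?addr0.
  rewrite comp_branch_op /coisometry (ipZl hilbertH) (ipZr hilbertH) conjc_real.
  rewrite mulrA -rmorphM; congr (_%:C%C * _).
  by rewrite -rn2 invfM -mulrA mulVf ?mulr1// gt_eqF.
move=> j ji; rewrite comp_branch_op_neq 1?eq_sym//.
by rewrite (ip0r hilbertH) mulr0.
Qed.

Lemma coisometry_linear i : linear (coisometry i).
Proof.
move=> c x y; rewrite /coisometry comp_op_linear scalerDr !scalerA.
by rewrite [_ * c]mulrC.
Qed.

Lemma coisometryK i x : coisometry i (branch_op i x) = x.
Proof.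
by rewrite /coisometry comp_branch_op scalerA -rmorphM mulVf ?gt_eqF// scale1r.
Qed.

Lemma branch_op_linear i : linear (branch_op i).
Proof. exact: (adjoint_of_linear hilbertH (coisometry_adjoint i)). Qed.

Lemma sum_branch_coisometry x : \sum_i branch_op i (coisometry i x) = x.
Proof.
have Z i c y : branch_op i (c *: y) = c *: branch_op i y.
  have h := branch_op_linear i c y 0; rewrite addr0 in h; rewrite h.
  have := branch_op_linear i 1 0 0; rewrite scaler0 addr0 scale1r => /eqP.
  by rewrite eq_sym -subr_eq0 addrK => /eqP ->; rewrite addr0.
rewrite /coisometry; under eq_bigr do rewrite Z.
by rewrite -scaler_sumr sum_branch_comp_op scalerA -rmorphM mulVf ?gt_eqF// scale1r.
Qed.

(** A Parseval identity: the coisometries split the space into [n] orthogonal blocks, so that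
    estimates can be made block by block. *)
Lemma coisometry_norm x : hnorm ip x ^+ 2 = \sum_i hnorm ip (coisometry i x) ^+ 2.
Proof.
apply: complexI; rewrite rmorph_sum/= -(ip_self hilbertH) -{2}(sum_branch_coisometry x).
rewrite (ip_sumr hilbertH); apply: eq_bigr => i _.
by rewrite -coisometry_adjoint (ip_self hilbertH).
Qed.

Lemma coisometry_branch_neq i j x : i != j -> coisometry j (branch_op i x) = 0.
Proof. by move=> ij; rewrite /coisometry comp_branch_op_neq// scaler0. Qed.

Lemma comp_op_coisometry i x :
  comp_op mu (gamma i) x = (Num.sqrt n%:R)%:C%C *: coisometry i x.
Proof. by rewrite /coisometry scalerA -rmorphM divff ?gt_eqF// scale1r. Qed.

Lemma coisometry_le i x : hnorm ip (coisometry i x) <= hnorm ip x.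
Proof.
rewrite -(@ler_sqr R) ?nnegrE ?hnorm_ge0// (coisometry_norm x) (bigD1 i)//=.
by rewrite lerDl sumr_ge0// => j _; exact: sqr_ge0.
Qed.

Lemma coisometry_mult i a c x : bounded_borel a c ->
  coisometry i (mult_op mu a x) = mult_op mu (fun t => a (gamma i t)) (coisometry i x).
Proof.
move=> ha; have hg : bounded_borel (fun t => a (gamma i t)) c.
  have [ar ai ac] := ha; split=> [||t]; last exact: ac.
  - exact: (measurableT_comp ar (mgamma i)).
  - exact: (measurableT_comp ai (mgamma i)).
rewrite /coisometry; have := @mult_op_linear _ _ mu _ _ hg (rn^-1)%:C%C (comp_op mu (gamma i) x) 0.
have -> : mult_op mu (fun t => a (gamma i t)) 0 = 0.
  have /eqP := @mult_op_linear _ _ mu _ _ hg 1 0 0; rewrite scaler0 addr0 scale1r.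
  by rewrite eq_sym -subr_eq0 addrK => /eqP.
rewrite !addr0 => ->; congr (_ *: _); apply/L2_eqP.
have h1 := comp_op_repr i (mult_op mu a x).
have h2 := gamma_ae i (mult_op_repr ha x).
have h3 := mult_op_repr hg (comp_op mu (gamma i) x); have h4 := comp_op_repr i x.
by apply: filterS3 (filterI h1 h2) h3 h4 => t [-> ->] -> ->.
Qed.

End CuntzOperators.

(** * The algebra of multiplication and composition operators *)

Lemma exists_small_power (R : realType) (c d r : R) : 0 <= c -> c < 1 -> 0 < r ->
  exists k, d * c ^+ k <= r.
Proof.
move=> c0 c1 r0.
have : geometric d c @ \oo --> 0 by apply: cvg_geometric; rewrite ger0_norm.
move/cvgr_dist_le => /(_ r r0) [N _ hN]; exists N.
have := hN N (leqnn N); rewrite /= sub0r normrN; apply: le_trans; exact: ler_norm.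
Qed.

Section MultiplicationCompositionAlgebra.
Context (R : realType) (K : pmetricType R) (n : nat) (gamma : 'I_n -> K -> K).
Variables (phi : K -> K) (mu : probability (borel K) R).
Hypothesis cK : compact [set: K].
Hypothesis n2 : (2 <= n)%N.
Hypothesis contr : forall i, proper_contraction (gamma i).
Hypothesis mphi : measurable_fun setT (phi : borel K -> borel K).
Hypothesis phiK : inverse_branches gamma phi.
Hypothesis selfK : self_similar gamma.
Hypothesis sep : measure_separation gamma.
Hypothesis hutch : hutchinson_measure gamma mu.

Local Notation H := (L2 mu).
Local Notation ip := (L2_ip mu).

Let n0 : (0 < n)%N. Proof. exact: ltnW. Qed.

Let cgamma i : continuous (gamma i). Proof. by case: (contr i). Qed.

Let overlap0 (i j : 'I_n) : i != j ->
  mu (range (gamma i) `&` range (gamma j)) = 0%E.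
Proof.
apply: (sep (p := fun=> n%:R^-1)) => //; split=> [k|].
  by rewrite invr_gt0 ltr0n.
by rewrite sumr_const card_ord -[LHS]mulr_natl divff// pnatr_eq0 -lt0n.
Qed.

Let hilbertH : hilbert_space ip.
Proof.
apply: L2_hilbert; apply: le_lt_trans (ltry 1).
exact: (probability_le1 mu (@measurableT _ (borel K))).
Qed.

Let V i : H -> H := branch_op gamma phi i.
Let W i : H -> H := coisometry gamma i.

Let W_linear i : linear (W i).
Proof. exact: coisometry_linear. Qed.
Let WV_adjoint i : adjoint_of ip (W i) (V i).
Proof. exact: coisometry_adjoint. Qed.
Let WK i x : W i (V i x) = x.
Proof. exact: coisometryK. Qed.
Let W_neq i j x : i != j -> W j (V i x) = 0.
Proof. exact: coisometry_branch_neq. Qed.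
Let sumVW x : \sum_i V i (W i x) = x.
Proof. exact: sum_branch_coisometry. Qed.
Let W_norm x : hnorm ip x ^+ 2 = \sum_i hnorm ip (W i x) ^+ 2.
Proof. exact: (coisometry_norm n0 cK cgamma mphi phiK selfK overlap0 hutch). Qed.
Let W_le i x : hnorm ip (W i x) <= hnorm ip x.
Proof. exact: (coisometry_le n0 cK cgamma mphi phiK selfK overlap0 hutch). Qed.
Let W_mult i a c x : bounded_borel a c ->
  W i (mult_op mu a x) = mult_op mu (fun t => a (gamma i t)) (W i x).
Proof. exact: coisometry_mult. Qed.
Let comp_W i : comp_op mu (gamma i) = (fun x => (Num.sqrt n%:R)%:C%C *: W i x).
Proof. by apply/funext => x; exact: comp_op_coisometry. Qed.

Let mult_adjointable (a : K -> R[i]^o) : continuous a ->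
  bounded_operator ip (mult_op mu a) /\ exists T', adjoint_of ip (mult_op mu a) T'.
Proof.
move=> /continuous_edelta ca; have [c hc] := continuous_bounded_borel cK ca.
split; last by exists (mult_op mu (fun t => conjc (a t))); exact: mult_op_adjoint hc.
by split; [exact: mult_op_linear hc|exists c; exact: mult_op_bound hc].
Qed.

Let comp_adjointable i :
  bounded_operator ip (comp_op mu (gamma i)) /\
  exists T', adjoint_of ip (comp_op mu (gamma i)) T'.
Proof.
rewrite comp_W; split.
  split=> [c x y|]; first by rewrite W_linear scalerDr !scalerA [_ * c]mulrC.
  exists (normc (Num.sqrt n%:R : R)%:C%C) => x.
  by rewrite (hnormZ hilbertH) ler_wpM2l ?normc_ge0.
exists (fun x => (Num.sqrt n%:R)%:C%C *: V i x) => x y.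
by rewrite (ipZl hilbertH) (ipZr hilbertH) conjc_real WV_adjoint.
Qed.

Let MC_spec : operator_cstar_algebra ip (MC gamma mu) /\
  (forall T, MC gamma mu T -> exists T', adjoint_of ip T T').
Proof.
apply: generated_algebra => // T [[a ca <-]|[i _ <-]].
  exact: mult_adjointable.
exact: comp_adjointable.
Qed.

Let MC_mult (a : K -> R[i]^o) : continuous a -> MC gamma mu (mult_op mu a).
Proof. by move=> ca M [_]; apply; left; exists a. Qed.

Let MC_comp i : MC gamma mu (comp_op mu (gamma i)).
Proof. by move=> M [_]; apply; right; exists i. Qed.

Let MC_id : MC gamma mu id.
Proof. by rewrite -(mult_op1 mu); apply: MC_mult => x; exact: cvg_cst. Qed.

(** Ensures that the identity operator is not 0: the constant function 1 has norm 1, the measure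
    being a probability. *)
Let L2_nontrivial : exists x : H, x <> 0.
Proof.
have s1 : square_integrable mu (fun=> 1 : R[i]^o).
  split; [exact: measurable_cst|exact: measurable_cst|].
  under eq_integral do rewrite normc1 expr1n.
  rewrite integral_cst// mul1e; apply: le_lt_trans (ltry 1).
  exact: (probability_le1 mu (@measurableT _ (borel K))).
exists (L2_class mu (fun=> 1)) => h.
have := L2_norm_class s1; rewrite h (ip0l hilbertH).
under eq_integral do rewrite normc1 expr1n.
rewrite integral_cst// mul1e => h0.
have [/eqP] := etrans h0 (probability_setT mu).
by rewrite eq_sym oner_eq0.
Qed.

Let D : concrete_cstar R :=
  ConcreteCStar hilbertH MC_spec.1 MC_id MC_spec.2 L2_nontrivial.

Let MC_W i : MC gamma mu (W i).
Proof.
have [[_ [M0 ML] _ _ _] _] := MC_spec.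
have -> : W i = (fun x => (Num.sqrt n%:R)^-1%:C%C *: comp_op mu (gamma i) x + 0).
  by apply/funext => x; rewrite addr0.
by apply: (ML _ (comp_op mu (gamma i)) (fun=> 0)).
Qed.

Let MC_V i : MC gamma mu (V i).
Proof. by have [[_ _ _ Ma _] _] := MC_spec; exact: Ma (MC_W i) (WV_adjoint i). Qed.

Let O : cstarAlgType R := cop D.
Let mkO T (hT : MC gamma mu T) : O := @mk_cop R D T hT.
Let ev (a : O) : H -> H := val (a : cop D).
Let S i : O := mkO (MC_V i).

Let ev_starS i : ev (star (S i)) = W i.
Proof.
apply: (adjoint_of_uniq hilbertH (cop_starP (S i : cop D))).
exact: (adjoint_of_sym hilbertH (WV_adjoint i)).
Qed.

Let ev_sum (F : 'I_n -> O) x : ev (\sum_i F i) x = \sum_i ev (F i) x.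
Proof.
elim: (index_enum _) => [|i s IH]; first by rewrite !big_nil.
by rewrite !big_cons -IH.
Qed.

Let cuntzS : cuntz_family S.
Proof.
split=> [i|]; apply: val_inj; apply/funext => x.
  rewrite -[LHS]/(ev (star (S i)) (ev (S i) x)) ev_starS; exact: WK.
rewrite -[LHS]/(ev (\sum_j S j * star (S j)) x) ev_sum -[RHS]sumVW.
by apply: eq_bigr => j _; rewrite -[LHS]/(ev (S j) (ev (star (S j)) x)) ev_starS.
Qed.

Let evM (a b : O) x : ev (a * b) x = ev a (ev b x).
Proof. by []. Qed.

Let ratio_exists : exists c : R, [/\ 0 < c, c < 1 &
  forall i x y, mdist (gamma i x) (gamma i y) <= c * mdist x y].
Proof.
have h i : exists c : R, c < 1 /\
    forall x y, mdist (gamma i x) (gamma i y) <= c * mdist x y.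
  have [_ [c1 [c2 [_ _ c21 hc]]]] := contr i; exists c2; split=> // x y.
  by case/andP: (hc x y).
(* The maximum is seeded with [1/2] to keep the common ratio positive, since the scale [r] will be
   divided by it. *)
have [c hc] := choice h; pose m := \big[Num.max/(1 / 2 : R)]_i c i.
exists m; split.
- by apply: (@lt_le_trans _ _ (1 / 2)); [lra|exact: bigmax_ge_id].
- by apply: bigmax_lt => [|i _]; [lra|exact: (hc i).1].
- move=> i x y; apply: le_trans ((hc i).2 x y) _.
  by rewrite ler_wpM2r ?mdist_ge0//; exact: le_bigmax.
Qed.

(* Since [W i] intertwines multiplication by [a] with multiplication by
   [a \o gamma i], the operator [mult_op a] equals
   [\sum_i V i \o mult_op (a \o gamma i) \o W i]; iterating, [a] is replaced by
   functions of small oscillation, which are nearly constant. *)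
Let mult_approx (C : set O) (k : nat) (a : K -> R[i]) (r e : R) (d c : R) :
  cstar_subalgebra C -> (forall i, C (S i)) ->
  0 < c -> c < 1 -> (forall i x y, mdist (gamma i x) (gamma i y) <= c * mdist x y) ->
  (forall x y : K, mdist x y <= d) ->
  edelta_continuous a -> 0 <= e ->
  (forall x y, mdist x y <= r -> normc (a x - a y) <= e) -> d * c ^+ k <= r ->
  exists2 b, C b & forall x, hnorm ip (mult_op mu a x - ev b x) <= e * hnorm ip x.
Proof.
move=> [C1 CZ CM Cs _] CS c0 c1 hc hd; elim: k a r => [|k IH] a r ca e0 osc dr.
  (* For [k = 0] the bound [d] on distances is at most [r], so [a] stays within [e] of its value at
     [point], and that scalar is the approximation. *)
  have [c' hc'] := continuous_bounded_borel cK ca.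
  have C0 : C 0 by have := CZ (-1) 1 1 C1 C1; rewrite scaleN1r addNr.
  exists (a point *: 1); first by have := CZ (a point) 1 0 C1 C0; rewrite addr0.
  move=> x; rewrite -[ev _ x]/(a point *: x) (mult_op_sub_cst hc').
  apply: mult_op_bound; split.
  - have [[ar ai _] [kr ki _]] := (hc', bounded_borel_cst K (a point)).
    rewrite (_ : (fun t => _) = (fun t : borel K => complex.Re (a t) - complex.Re (a point))).
      exact: measurable_funB.
    by apply/funext => t; case: (a t) (a point) => ? ? [].
  - have [[ar ai _] [kr ki _]] := (hc', bounded_borel_cst K (a point)).
    rewrite (_ : (fun t => _) = (fun t : borel K => complex.Im (a t) - complex.Im (a point))).
      exact: measurable_funB.
    by apply/funext => t; case: (a t) (a point) => ? ? [].
  - by move=> t; apply: osc; apply: le_trans dr; rewrite expr0 mulr1.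
have [m hm] := continuous_bounded_borel cK ca.
have step i : exists b, C b /\ forall x,
    hnorm ip (mult_op mu (fun t => a (gamma i t)) x - ev b x) <= e * hnorm ip x.
  (* A branch contracts distances by [c], so [a \o gamma i] has at scale [r / c] the oscillation of
     [a] at scale [r], and [d c^(k+1) <= r] becomes [d c^k <= r / c]. *)
  have [|//|x y xy||b Cb hb] := IH (fun t => a (gamma i t)) (r / c).
  - move=> x e' e'0; have [r' r'0 hr'] := ca (gamma i x) _ e'0.
    exists r' => // y xy; apply: hr'; apply: le_lt_trans xy.
    apply: le_trans (hc i x y) _.
    by rewrite ler_piMl ?mdist_ge0// ltW.
  - apply: osc; apply: le_trans (hc i x y) _.
    by rewrite mulrC -ler_pdivlMr.
  - by rewrite ler_pdivlMr// -mulrA -exprSr.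
  - by exists b.
have [b hb] := choice step.
exists (\sum_i S i * b i * star (S i)).
  have C0 : C 0 by have := CZ (-1) 1 1 C1 C1; rewrite scaleN1r addNr.
  apply: (big_ind C) => // [u v Cu Cv|i _].
    by have := CZ 1 u v Cu Cv; rewrite scale1r.
  by apply: (CM _ _ (CM _ _ (CS i) (hb i).1)); exact: Cs.
(* Both sides split along the blocks [W j], on which the error is at most [e |W j x|]; adding
   squares keeps the constant [e], so the induction loses nothing. *)
move=> x; rewrite -(@ler_sqr R) ?nnegrE ?mulr_ge0 ?hnorm_ge0// exprMn.
rewrite (W_norm x) W_norm mulr_sumr; apply: ler_sum => j _.
have Wadd u v : W j (u - v) = W j u - W j v.
  by rewrite addrC -scaleN1r W_linear scaleN1r addrC.
have -> : W j (mult_op mu a x - ev (\sum_i S i * b i * star (S i)) x) =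
    mult_op mu (fun t => a (gamma j t)) (W j x) - ev (b j) (W j x).
  rewrite Wadd (W_mult _ _ hm); congr (_ - _).
  rewrite ev_sum; have WS (F : 'I_n -> H) : W j (\sum_i F i) = \sum_i W j (F i).
    have W0 : W j 0 = 0 by have := Wadd 0 0; rewrite !subrr.
    elim: (index_enum _) => [|i s IHs]; first by rewrite !big_nil.
    rewrite !big_cons -IHs -[F i]scale1r.
    by have := W_linear j 1 (F i) (\sum_(i0 <- s) F i0); rewrite !scale1r.
  rewrite WS (bigD1 j)//= big1 ?addr0.
    by rewrite !evM ev_starS; exact: WK.
  by move=> i ij; rewrite !evM ev_starS; exact: W_neq.
rewrite -exprMn lerXn2r// ?nnegrE ?mulr_ge0 ?hnorm_ge0//.
exact: (hb j).2.
Qed.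

(** If [C] contains the [S i], then the operators coming from [C] form an operator C*-algebra that
    contains all multiplication and composition operators. By minimality of [MC] it is
    everything. *)
Let generatedS : cstar_generated (range S) = setT.
Proof.
apply/seteqP; split=> // o _ C [hC CS'].
have CS i : C (S i) by apply: CS'; exists i.
have [C1 CZ CM Cs Cc] := hC.
(* Closedness of [C] is a statement in the abstract norm of [O]; this restates it with operator
   bounds, for operators already known to lie in [MC]. *)
have closure T : MC gamma mu T -> (forall e : R, 0 < e ->
    exists2 b, C b & forall x, hnorm ip (T x - ev b x) <= e * hnorm ip x) ->
    exists2 b, C b & ev b = T.
  move=> hT happ; exists (mkO hT) => //; apply: Cc => e e0.
  have [b Cb hb] := happ e e0; exists b => //.
  by apply: cop_norm_le => //; exact: ltW.
suff : [set T | exists2 b, C b & ev b = T] (ev o).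
  by move=> [b Cb /val_inj <-].
have C0 : C 0 by have := CZ (-1) 1 1 C1 C1; rewrite scaleN1r addNr.
apply: (copP (o : cop D)); split; last first.
  move=> T [[a ca <-]|[i _ <-]].
    apply: closure; first exact: MC_mult.
    move=> e e0; have cea := continuous_edelta ca.
    have [r r0 osc] := compact_edelta_uniform cK e0 cea.
    have [c [c0 c1 hc]] := ratio_exists.
    have [d d0 hd] := compact_mdist_bounded cK.
    have [k hk] := exists_small_power d (ltW c0) c1 r0.
    exact: (mult_approx hC CS c0 c1 hc hd cea (ltW e0) osc hk).
  exists ((Num.sqrt n%:R)%:C%C *: star (S i)).
    by have := CZ (Num.sqrt n%:R)%:C%C (star (S i)) 0 (Cs _ (CS i)) C0; rewrite addr0.
  by rewrite comp_W -ev_starS.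
have [[MCb _ _ _ MCc] _] := MC_spec.
split.
- by move=> _ [b _ <-]; apply: MCb; exact: (copP (b : cop D)).
- split; first by exists 0.
  by move=> k _ _ [u Cu <-] [v Cv <-]; exists (k *: u + v) => //; exact: CZ.
- by move=> _ _ [u Cu <-] [v Cv <-]; exists (u * v) => //; exact: CM.
- move=> _ T' [u Cu <-] hT'; exists (star u); first exact: Cs.
  exact: (adjoint_of_uniq hilbertH (cop_starP (u : cop D)) hT').
- move=> T bT happ; apply: closure => [|e /happ[_ [b Cb <-] hb]]; last by exists b.
  (* As a limit of operators of [MC], [T] belongs to [MC], a condition for being the value of an
     element of [O]. *)
  apply: MCc => // e /happ[_ [b Cb <-] hb]; exists (ev b) => //.
  exact: (copP (b : cop D)).
Qed.

Lemma cuntz_MC : exists2 A : cstarAlgType R, is_cuntz_algebra n A &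
  cstar_isomorphic ip A (MC gamma mu).
Proof.
exists O; first exact: cuntz_algebra_of_generators cuntzS n2 generatedS.
exact: (cop_isomorphic D).
Qed.

End MultiplicationCompositionAlgebra.

Theorem theorem2p5 (R : realType) (K : pmetricType R) (n : nat)
    (gamma : 'I_n -> K -> K) (phi : K -> K) (muH : probability (borel K) R) :
  compact [set: K] ->
  (2 <= n)%N ->
  (forall i, proper_contraction (gamma i)) ->
  measurable_fun [set: borel K] (phi : borel K -> borel K) ->
  inverse_branches gamma phi ->
  self_similar gamma ->
  measure_separation gamma ->
  hutchinson_measure gamma muH ->
  exists2 O : cstarAlgType R, is_cuntz_algebra n O &
    cstar_isomorphic (L2_ip muH) O (MC gamma muH).
Proof.
move=> cK n2 contr mphi phiK selfK sep hutch.
exact: (cuntz_MC cK n2 contr mphi phiK selfK sep hutch).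
Qed.
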